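(* Let $N\ge 1$ be an integer, $\alpha\in(0,N)$ and $p>0$. If $\max\bigl(\frac{N-2}{N+\alpha},\frac12\bigr)<\frac1p<\frac{N}{N+\alpha}$, then $c_{\mathrm{nod}}=c_0$, and $c_{\mathrm{nod}}$ is not achieved in $\mathcal{N}_{\mathrm{nod}}$, that is, there is no $u\in\mathcal{N}_{\mathrm{nod}}$ with $\mathcal{A}(u)=c_{\mathrm{nod}}$.
   Context: The Riesz potential is $I_\alpha(x)=\frac{A_\alpha}{|x|^{N-\alpha}}$ for $x\in\mathbb{R}^N\setminus\{0\}$, with $A_\alpha=\frac{\Gamma(\frac{N-\alpha}{2})}{\Gamma(\frac{\alpha}{2})\pi^{N/2}2^\alpha}$. All functions are real-valued. The action functional on $H^1(\mathbb{R}^N)$ is $$\mathcal{A}(u)=\frac12\int_{\mathbb{R}^N}|\nabla u|^2+|u|^2-\frac1{2p}\int_{\mathbb{R}^N}\bigl(I_\alpha*|u|^p\bigr)|u|^p,$$ which is continuously differentiable, with $\langle\mathcal{A}'(u),\varphi\rangle=\int_{\mathbb{R}^N}\nabla u\cdot\nabla\varphi+u\varphi-\int_{\mathbb{R}^N}(I_\alpha*|u|^p)|u|^{p-2}u\varphi$. Set $\mathcal{N}_0=\{u\in H^1(\mathbb{R}^N)\setminus\{0\}:\langle\mathcal{A}'(u),u\rangle=0\}$ and $c_0=\inf_{\mathcal{N}_0}\mathcal{A}$. Write $u^+=\max(u,0)\ge0$ and $u^-=\min(u,0)\le0$. The Nehari nodal set is $$\mathcal{N}_{\mathrm{nod}}=\{u\in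 H^1(\mathbb{R}^N): u^+\ne0\ne u^-,\ \langle\mathcal{A}'(u),u^+\rangle=0\text{ and }\langle\mathcal{A}'(u),u^-\rangle=0\},$$ and $c_{\mathrm{nod}}=\inf_{\mathcal{N}_{\mathrm{nod}}}\mathcal{A}$. *)

(* Defs.v *)
From HB Require Import structures.
From mathcomp Require Import all_boot all_order all_algebra.
From mathcomp Require Import all_classical all_reals all_analysis.

Set Implicit Arguments.
Unset Strict Implicit.
Unset Printing Implicit Defensive.

Import Order.TTheory GRing.Theory Num.Theory.
Import numFieldNormedType.Exports.

Local Open Scope classical_set_scope.
Local Open Scope ring_scope.

Section rV_measurable.
Context {R : realType} {n : nat}.

Let coord : 'I_n -> 'rV[R]_n -> measurableTypeR R := fun i x => x ord0 i.

Let rV_set0 : g_sigma_preimage coord set0.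
Proof. exact: sigma_algebra0. Qed.

Let rV_setC A : g_sigma_preimage coord A -> g_sigma_preimage coord (~` A).
Proof. exact: sigma_algebraC. Qed.

Let rV_bigcup (F : (set 'rV[R]_n)^nat) :
  (forall i, g_sigma_preimage coord (F i)) ->
  g_sigma_preimage coord (\bigcup_i F i).
Proof. exact: sigma_algebra_bigcup. Qed.

(* The sigma-algebra generated by the coordinates, i.e. the Borel sets. *)
HB.instance Definition _ :=
  @isMeasurable.Build (measure_tuple_display default_measure_display)
    'rV[R]_n (g_sigma_preimage coord) rV_set0 rV_setC rV_bigcup.

End rV_measurable.

Definition rV_cons {R : realType} {n : nat}
    (z : measurableTypeR R * 'rV[R]_n) : 'rV[R]_n.+1 :=
  \row_j oapp (z.2 ord0) z.1 (unlift ord0 j).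

Section rV_cons_measurable.
Context {R : realType}.

Lemma measurable_coord n (i : 'I_n) :
  measurable_fun [set: 'rV[R]_n] (fun x => x ord0 i : measurableTypeR R).
Proof.
move=> _ Y mY; rewrite setTI; apply: sub_sigma_algebra => /=.
rewrite -bigcup_seq/=; exists i => /=; first by rewrite mem_index_enum.
by exists Y => //; rewrite setTI.
Qed.

Lemma measurable_fun_rV d (T : measurableType d) n (f : T -> 'rV[R]_n) :
  (forall i, measurable_fun setT (fun t => f t ord0 i : measurableTypeR R)) ->
  measurable_fun setT f.
Proof.
move=> mf _ A mA; rewrite setTI.
suff : measurable `<=` [set B | measurable (f @^-1` B)] by exact.
apply: smallest_sub.
  split => /= [|B mB|F mF].
  - by rewrite preimage_set0.
  - by rewrite setTD preimage_setC; exact: measurableC.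
  - by rewrite preimage_bigcup; exact: bigcupT_measurable.
rewrite -bigcup_seq => B [/= i _] [C mC <-]; rewrite setTI /=.
by rewrite -comp_preimage -[X in measurable X]setTI; exact: mf.
Qed.

Lemma measurable_rV_cons n : measurable_fun setT (@rV_cons R n).
Proof.
apply: measurable_fun_rV => i; case: (unliftP ord0 i) => [j ->|->].
  rewrite (_ : (fun _ => _) =
    (fun x : 'rV[R]_n => x ord0 j : measurableTypeR R) \o snd).
    by apply: measurableT_comp => //; exact: measurable_coord.
  by apply/funext => z /=; rewrite mxE liftK.
rewrite (_ : (fun _ => _) = fst); first exact: measurable_fst.
by apply/funext => z /=; rewrite mxE unlift_none.
Qed.

Definition rV_uncons n (x : 'rV[R]_n.+1) : measurableTypeR R * 'rV[R]_n :=
  (x ord0 ord0, \row_j x ord0 (lift ord0 j)).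

Lemma measurable_rV_uncons n : measurable_fun setT (@rV_uncons n).
Proof.
apply/measurable_fun_pairP; split; first exact: measurable_coord.
apply: measurable_fun_rV => i; rewrite (_ : (fun _ => _) =
  (fun x : 'rV[R]_n.+1 => x ord0 (lift ord0 i) : measurableTypeR R)).
  exact: measurable_coord.
by apply/funext => x /=; rewrite mxE.
Qed.

Lemma rV_consK n : cancel (@rV_cons R n) (@rV_uncons n).
Proof.
move=> [t x]; rewrite /rV_uncons mxE unlift_none /=; congr pair.
by apply/rowP => j; rewrite !mxE liftK.
Qed.

Lemma rV_unconsK n : cancel (@rV_uncons n) (@rV_cons R n).
Proof.
move=> x; apply/rowP => i; rewrite mxE.
by case: (unliftP ord0 i) => [j ->|->]; rewrite ?liftK ?unlift_none //= mxE.
Qed.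

End rV_cons_measurable.

Lemma sigma_finite_product d1 d2 (T1 : measurableType d1)
    (T2 : measurableType d2) (R : realType)
    (m1 : {sigma_finite_measure set T1 -> \bar R})
    (m2 : {sigma_finite_measure set T2 -> \bar R}) :
  sigma_finite setT (m1 \x m2)%E.
Proof.
have /sigma_finiteP[F [TF ndF Foo]] := sigma_finiteT m1.
have /sigma_finiteP[G [TG ndG Goo]] := sigma_finiteT m2.
exists (fun n => F n `*` G n).
  rewrite -setXTT TF TG predeqE => -[x y]; split.
    move=> [/= [n _ Fnx] [k _ Gky]]; exists (maxn n k) => //; split.
    - by move: x Fnx; exact/subsetPset/ndF/leq_maxl.
    - by move: y Gky; exact/subsetPset/ndG/leq_maxr.
  by move=> [n _ []/= ? ?]; split; exists n.
move=> k; have [? ?] := Foo k; have [? ?] := Goo k.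
split; first exact: measurableX.
by rewrite product_measure1E// lte_mul_pinfty// ge0_fin_numE.
Qed.

Section lebesgue_rV.
Context {R : realType}.

Section step.
Context {n : nat}.
Variable m : {sigma_finite_measure set 'rV[R]_n -> \bar R}.

Definition rV_step : set 'rV[R]_n.+1 -> \bar R :=
  pushforward (@lebesgue_measure R \x m)%E (@rV_cons R n).

HB.instance Definition _ := Measure.copy rV_step
  (@measure_function_pushforward__canonical__measure_function_Measure
    _ _ _ _ _ _ _ (@measurable_rV_cons R n)).

Let rV_step_sigma_finite : sigma_finite setT rV_step.
Proof.
have [F FT Foo] := sigma_finite_product (@lebesgue_measure R) m.
exists (fun k => @rV_uncons R n @^-1` F k).
  by rewrite -preimage_bigcup -FT preimage_setT.
move=> k; have [mF mFoo] := Foo k; split.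
  by rewrite -[X in measurable X]setTI; exact: measurable_rV_uncons.
rewrite /rV_step /pushforward -comp_preimage.
by rewrite (_ : _ \o _ = id) //; apply/funext => z /=; rewrite rV_consK.
Qed.

HB.instance Definition _ := Measure_isSigmaFinite.Build _ _ _ rV_step
  rV_step_sigma_finite.

End step.

(* Lebesgue measure on R^n, as the n-fold product of the one on R. *)
Fixpoint lebesgue_rV n : {sigma_finite_measure set 'rV[R]_n -> \bar R} :=
  match n with
  | 0 => \d_(0 : 'rV[R]_0)
  | n'.+1 => rV_step (lebesgue_rV n')
  end.

End lebesgue_rV.

Definition Gamma {R : realType} (a : R) : R :=
  \int[@lebesgue_measure R]_(t in `]0, +oo[) (t `^ (a - 1) * expR (- t)).

Section sobolev.
Context {R : realType} {N : nat}.
Implicit Types (u v g phi : 'rV[R]_N -> R) (x : 'rV[R]_N).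

Local Notation leb := (@lebesgue_rV R N).

(* The library norm on 'rV[R]_N is the sup norm. *)
Definition enorm x : R := Num.sqrt (\sum_i x ord0 i ^+ 2).

Definition partial (i : 'I_N) phi : 'rV[R]_N -> R :=
  fun x => 'D_(delta_mx ord0 i) phi x.

(* C^oo: the iterated partial derivatives of every order (including order 0)
   are differentiable, hence continuous, everywhere. *)
Definition smooth phi :=
  forall (s : seq 'I_N) x, differentiable (foldr partial phi s) x.

Definition test_function phi :=
  smooth phi /\ compact (closure [set x | phi x != 0]).

Definition weak_partial (i : 'I_N) u g :=
  forall phi, test_function phi ->
    \int[leb]_x (u x * partial i phi x) = - \int[leb]_x (g x * phi x).

(* Elements of L^2 and H^1 are represented by measurable functions, not by
   classes modulo equality almost everywhere. *)
Definition H1 : set ('rV[R]_N -> R) :=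
  [set u | u \in Lfun leb 2%:E /\
    forall i, exists2 g, g \in Lfun leb 2%:E & weak_partial i u g].

(* A representative of the weak derivative d_i u, which is unique up to
   equality almost everywhere; the value outside H1 is irrelevant. *)
Definition wpartial (i : 'I_N) u : 'rV[R]_N -> R :=
  xget (cst 0) [set g | g \in Lfun leb 2%:E /\ weak_partial i u g].

Definition grad_dot u v x : R := \sum_i wpartial i u x * wpartial i v x.

Definition pos_part u : 'rV[R]_N -> R := fun x => Num.max (u x) 0.

(* Nonpositive, unlike the library's u^\-. *)
Definition neg_part u : 'rV[R]_N -> R := fun x => Num.min (u x) 0.

Definition ae_zero u := {ae leb, forall x, u x = 0}.

End sobolev.

Section choquard.
Context {R : realType} {N : nat}.
Variables alpha p : R.
Implicit Types (u phi : 'rV[R]_N -> R) (x : 'rV[R]_N).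

Local Notation leb := (@lebesgue_rV R N).

Definition riesz_const : R :=
  Gamma ((N%:R - alpha) / 2) /
  (Gamma (alpha / 2) * pi `^ (N%:R / 2) * 2 `^ alpha).

Definition riesz x : R := riesz_const / enorm x `^ (N%:R - alpha).

(* I_alpha * |u|^p; it may be infinite on a negligible set. *)
Definition riesz_conv u x : \bar R :=
  (\int[leb]_y (riesz (x - y) * `|u y| `^ p)%:E)%E.

Definition action u : R :=
  2^-1 * \int[leb]_x (grad_dot u u x + `|u x| ^+ 2)
  - (2 * p)^-1 * fine (\int[leb]_x (riesz_conv u x * (`|u x| `^ p)%:E))%E.

(* <A'(u), phi>. Where u vanishes |u|^(p-2) u is 0, also for p < 2. *)
Definition daction u phi : R :=
  \int[leb]_x (grad_dot u phi x + u x * phi x)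
  - fine (\int[leb]_x
      (riesz_conv u x * (`|u x| `^ (p - 2) * u x * phi x)%:E))%E.

Definition nehari : set ('rV[R]_N -> R) :=
  [set u | [/\ H1 u, ~ ae_zero u & daction u u = 0]].

Definition nehari_nod : set ('rV[R]_N -> R) :=
  [set u | [/\ H1 u, ~ ae_zero (pos_part u), ~ ae_zero (neg_part u),
    daction u (pos_part u) = 0 & daction u (neg_part u) = 0]].

Definition c_0 : \bar R := ereal_inf [set (action u)%:E | u in nehari].

Definition c_nod : \bar R := ereal_inf [set (action u)%:E | u in nehari_nod].

End choquard.

Arguments c_0 {R} N alpha p.
Arguments c_nod {R} N alpha p.

(* Main.v *)
Require Import Defs.
From HB Require Import structures.
From mathcomp Require Import all_boot all_order all_algebra.
From mathcomp Require Import all_classical all_reals all_analysis.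
From mathcomp Require Import measurable_realfun ring lra.

(** Let [S] be the squared [H^1] norm and [D(f, g)] the Riesz energy of the
    densities [|f|^p] and [|g|^p]. The constraint that defines the Nehari set is
    [S(u) = D(u, u)], on which the action is [kappa * S], where
    [kappa = 1/2 - 1/(2p)] is positive because the upper hypothesis on [1/p]
    forces [p > 1]; every function of positive finite energy is, up to scaling,
    in that set. The lower hypothesis forces [p < 2], and this is what makes the
    nodal problem degenerate.

    The nodal set lies in the Nehari set ([nehari_nod_sub]), hence [c_0 <= c_nod].

    Conversely, let [u] be in the Nehari set, and let [f] be a cut-off of [|u|]
    with almost the same norm and energy ([compact_approximation]). Let [w] be a
    translate of [f] to a great distance, so that the interaction [b = D(f, w)]
    is small and positive. The function [t (f - r w)] satisfies both nodal
    constraints for a suitable [t] as soon as [r] solves the equation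
    [r^(2-p) a + r^2 b = r^p a + b], where [a = D(f, f)] ([c_nod_le]). Since
    [2 - p < p], it has a solution that tends to 0 with [b] ([balance_exists]):
    an arbitrarily small negative bump can be attached to [f] at an arbitrarily
    small cost. Hence [c_nod <= c_0] ([c_nod_le_action]).

    Suppose now that the common level is achieved at a nodal function [u], which
    is then a minimiser on the whole Nehari set. Let [z] be its positive part. A
    function whose energy is finite and at least that of [u] has at least the
    norm of [u] ([minimal_norm]). Comparing with [max(|u^-|, z + eps phi)], for
    [phi >= 0], and using that [S] is additive on pairs of maximum and minimum,
    yields that [z] is a weak supersolution of [- Delta z + z >= 0], with no
    condition on the sign of [u] on the support of [phi]
    ([pos_part_supersolution]). The strong maximum principle then forbids [z] to
    vanish on the support of [u^-]. To stay within classical calculus, it is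
    applied to the correlation of [z] with a compactly supported minorant of
    [|u^-|]: this is a continuous function whose second differences converge
    ([corr_laplacian]), a supersolution in turn, and it vanishes at the origin;
    sliding a Gaussian barrier below it shows that it is identically zero
    ([strong_maximum_principle]), so that one of the two parts of [u] is zero
    almost everywhere ([no_nodal_minimiser]).

    The weak derivatives are handled through difference quotients, which are
    bounded in [L^2] by the weak derivative and converge to it strongly
    ([dq_bound], [dq_cvg_weak_partial]); the chain rule for positive parts
    follows ([weak_partial_pos]). The energies are handled by Tonelli's theorem;
    their finiteness rests on the local integrability of the kernel
    ([riesz_unit_ball_ltoo], [energy_ball_finite]). *)

Set Implicit Arguments.
Unset Strict Implicit.
Unset Printing Implicit Defensive.

Import Order.TTheory GRing.Theory Num.Theory.
Import numFieldNormedType.Exports.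

Local Open Scope classical_set_scope.
Local Open Scope ring_scope.

(** * Square integrable functions *)

Section square_integrable.
Context d (T : measurableType d) (R : realType).
Variable mu : {measure set T -> \bar R}.
Implicit Types f g h : T -> R.

Definition rint f := mu.-integrable [set: T] (EFin \o f).

Lemma rint_meas f : rint f -> measurable_fun setT f.
Proof. by case/integrableP => /measurable_EFinP. Qed.

Lemma rintD f g : rint f -> rint g -> rint (fun x => f x + g x).
Proof. by move=> fi gi; exact: (integrableD measurableT fi gi). Qed.

Lemma rintZ (c : R) f : rint f -> rint (fun x => c * f x).
Proof. by move=> fi; exact: (integrableZl measurableT c fi). Qed.

Lemma rint_sum I (s : seq I) (F : I -> T -> R) :
  (forall i, rint (F i)) -> rint (fun x => \sum_(i <- s) F i x).
Proof.
move=> Fi; elim: s => [|i s IH].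
  rewrite /rint (_ : _ \o _ = cst 0%E); first exact: integrable0.
  by apply/funext => x /=; rewrite big_nil.
rewrite (_ : (fun x => _) = (fun x => F i x + \sum_(j <- s) F j x)).
  exact: rintD.
by apply/funext => x; rewrite big_cons.
Qed.

Lemma le_rint f g : measurable_fun setT f -> (forall x, `|f x| <= g x) ->
  rint g -> rint f.
Proof.
move=> mf fg gi; apply: (le_integrable measurableT _ _ gi).
  exact/measurable_EFinP.
by move=> x _ /=; rewrite lee_fin (le_trans (fg x))// ler_norm.
Qed.

Lemma Rintegral_sum I (s : seq I) (F : I -> T -> R) :
  (forall i, rint (F i)) ->
  \int[mu]_x (\sum_(i <- s) F i x) = \sum_(i <- s) \int[mu]_x F i x.
Proof.
move=> Fi; elim: s => [|i s IH].
  rewrite big_nil (@eq_Rintegral _ _ _ mu setT (cst 0)).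
    by rewrite (Rintegral_cst _ measurableT) mul0r.
  by move=> x _; rewrite big_nil.
rewrite big_cons -IH -RintegralD//; [|exact: Fi|exact: rint_sum].
by apply: eq_Rintegral => x _; rewrite big_cons.
Qed.

Lemma EFin_Rintegral f : rint f ->
  (\int[mu]_x f x)%:E = (\int[mu]_x (f x)%:E)%E.
Proof. by move=> fi; rewrite /Rintegral fineK//; exact: integrable_fin_num. Qed.

Lemma ge0_rint f : measurable_fun setT f -> (forall x, 0 <= f x) ->
  (\int[mu]_x (f x)%:E < +oo)%E -> rint f.
Proof.
move=> mf f0 foo; apply/integrableP; split; first exact/measurable_EFinP.
by under eq_integral do rewrite gee0_abs ?lee_fin//.
Qed.

Lemma rint_ltoo f : rint f -> (\int[mu]_x (f x)%:E < +oo)%E.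
Proof. by move=> fi; rewrite -EFin_Rintegral// ltry. Qed.

Lemma ge0_Rintegral_eq0 f : rint f -> (forall x, 0 <= f x) ->
  \int[mu]_x f x = 0 -> {ae mu, forall x, f x = 0}.
Proof.
move=> fi f0 f00.
have mf : measurable_fun setT (EFin \o f) by case/integrableP : fi.
have : (\int[mu]_x `|(f x)%:E| = 0)%E.
  under eq_integral do rewrite gee0_abs ?lee_fin//.
  by rewrite -EFin_Rintegral// f00.
move/(ae_eq_integral_abs mu measurableT mf); apply: filterS => x /(_ I) /=.
by case.
Qed.

Lemma ae_Rintegral_eq f g : measurable_fun setT f -> measurable_fun setT g ->
  {ae mu, forall x, f x = g x} -> \int[mu]_x f x = \int[mu]_x g x.
Proof.
move=> mf mg fg; congr fine.
apply: ae_eq_integral => //; [exact/measurable_EFinP|exact/measurable_EFinP|].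
by apply: filterS fg => x /= ->.
Qed.

(** Dominated convergence, for finite values and everywhere convergence. *)
Lemma Rdct (F : nat -> T -> R) f G : (forall n, measurable_fun setT (F n)) ->
  (forall x, F ^~ x @ \oo --> f x) -> rint G ->
  (forall n x, `|F n x| <= G x) ->
  rint f /\ (\int[mu]_x F n x @[n --> \oo] --> \int[mu]_x f x).
Proof.
move=> mF Ff Gi FG.
have mf : measurable_fun setT f.
  by apply: (@measurable_fun_cvg _ _ _ setT F f) => // x _; exact: Ff.
have [fi _ cv] : [/\ mu.-integrable setT (EFin \o f),
    [sequence \int[mu]_x (`|(EFin \o F n) x - (EFin \o f) x|)]_n @ \oo --> 0 &
    [sequence \int[mu]_x ((EFin \o F n) x)]_n @ \oo
      --> \int[mu]_x ((EFin \o f) x)]%E.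
  apply: (@dominated_convergence _ _ _ mu setT measurableT _ _ (EFin \o G)) => //.
  - by move=> n; exact/measurable_EFinP.
  - exact/measurable_EFinP.
  - by apply: aeW => x _ /=; apply: cvg_EFin (Ff x); exact: nearW.
  - by apply: aeW => x n _; rewrite /= lee_fin.
split; first exact: fi.
apply: (fine_cvg (f := fun n => \int[mu]_x ((EFin \o F n) x))%E).
by rewrite EFin_Rintegral.
Qed.

Definition L2 f := measurable_fun setT f /\ rint (fun x => f x ^+ 2).

Lemma L2_meas f : L2 f -> measurable_fun setT f. Proof. by case. Qed.

Lemma Lfun2P f : f \in Lfun mu 2%:E <-> L2 f.
Proof.
split=> [l2|[mf fi]].
  split; last exact: Lfun2_integrable_sqr.
  by move: l2; rewrite inE => /andP[]; rewrite inE.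
rewrite inE; apply/andP; split; rewrite inE//=.
rewrite /finite_norm unlock /Lnorm poweR_lty//.
case/integrableP : fi => _; apply: le_lt_trans.
apply: ge0_le_integral => //.
- by move=> x _; rewrite lee_fin powR_ge0.
- apply/measurable_EFinP.
  apply/(@measurableT_comp _ _ _ _ _ _ (fun x : R => x `^ 2)%R) => //.
  exact/measurableT_comp.
- do 2 apply/measurableT_comp => //; exact: measurable_funX.
- by move=> x _ /=; rewrite lee_fin normrX powR_mulrn.
Qed.

Lemma L2M f g : L2 f -> L2 g -> rint (fun x => f x * g x).
Proof.
move=> [mf fi] [mg gi]; apply: (le_rint _ _ (rintD fi gi)).
  exact: measurable_funM.
move=> x; rewrite ler_norml; apply/andP; split.
  by have := sqr_ge0 (f x + g x); have := sqr_ge0 (f x); have := sqr_ge0 (g x); lra.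
by have := sqr_ge0 (f x - g x); have := sqr_ge0 (f x); have := sqr_ge0 (g x); lra.
Qed.

Lemma le_L2 f g : measurable_fun setT f -> (forall x, `|f x| <= `|g x|) ->
  L2 g -> L2 f.
Proof.
move=> mf fg [mg gi]; split => //; apply: (le_rint _ _ gi).
  exact: measurable_funX.
by move=> x; rewrite normrX -(real_normK (num_real (g x))) lerXn2r// nnegrE.
Qed.

Lemma L2Z (c : R) f : L2 f -> L2 (fun x => c * f x).
Proof.
move=> [mf fi]; split; first exact: measurable_funM.
have := rintZ (c ^+ 2) fi; congr rint; apply/funext => x.
by rewrite exprMn.
Qed.

Lemma L2D f g : L2 f -> L2 g -> L2 (fun x => f x + g x).
Proof.
move=> lf lg; have [mf fi] := lf; have [mg gi] := lg.
split; first exact: measurable_funD.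
have := rintD (rintD fi gi) (rintZ 2 (L2M lf lg)).
by congr rint; apply/funext => x; ring.
Qed.

Lemma L2N f : L2 f -> L2 (fun x => - f x).
Proof.
move=> lf; have := L2Z (-1) lf; congr L2.
by apply/funext => x; rewrite mulN1r.
Qed.

Lemma L2B f g : L2 f -> L2 g -> L2 (fun x => f x - g x).
Proof. by move=> lf lg; apply: L2D lf _; exact: L2N. Qed.

Lemma L2_bnd f g (M : R) : measurable_fun setT g -> (forall x, `|g x| <= M) ->
  L2 f -> L2 (fun x => g x * f x).
Proof.
move=> mg gM lf; apply: (le_L2 _ _ (L2Z M lf)).
  by apply: measurable_funM => //; case: lf.
move=> x; rewrite !normrM ler_wpM2r//; apply: le_trans (gM x) _.
exact: ler_norm.
Qed.

Definition ip f g := \int[mu]_x (f x * g x).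

Lemma ipC f g : ip f g = ip g f.
Proof. by apply: eq_Rintegral => x _; rewrite mulrC. Qed.

Lemma eq_ip f f' g g' : f =1 f' -> g =1 g' -> ip f g = ip f' g'.
Proof. by move=> ff gg; apply: eq_Rintegral => x _; rewrite ff gg. Qed.

Lemma ipDl f g h : L2 f -> L2 g -> L2 h ->
  ip (fun x => f x + g x) h = ip f h + ip g h.
Proof.
move=> lf lg lh; rewrite -RintegralD//; [|exact: L2M..].
by apply: eq_Rintegral => x _; rewrite mulrDl.
Qed.

Lemma ipZl (c : R) f g : L2 f -> L2 g -> ip (fun x => c * f x) g = c * ip f g.
Proof.
move=> lf lg; rewrite -RintegralZl//; last exact: L2M.
by apply: eq_Rintegral => x _; rewrite mulrA.
Qed.

Lemma ipNl f g : L2 f -> L2 g -> ip (fun x => - f x) g = - ip f g.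
Proof.
move=> lf lg; rewrite -mulN1r -ipZl//; apply: eq_ip => // x.
by rewrite mulN1r.
Qed.

Lemma ipBl f g h : L2 f -> L2 g -> L2 h ->
  ip (fun x => f x - g x) h = ip f h - ip g h.
Proof. by move=> lf lg lh; rewrite ipDl ?ipNl//; exact: L2N. Qed.

Lemma ipDr f g h : L2 f -> L2 g -> L2 h ->
  ip h (fun x => f x + g x) = ip h f + ip h g.
Proof. by move=> lf lg lh; rewrite ipC ipDl// !(ipC h). Qed.

Lemma ipZr (c : R) f g : L2 f -> L2 g -> ip g (fun x => c * f x) = c * ip g f.
Proof. by move=> lf lg; rewrite ipC ipZl// (ipC g). Qed.

Lemma ipNr f g : L2 f -> L2 g -> ip g (fun x => - f x) = - ip g f.
Proof. by move=> lf lg; rewrite ipC ipNl// (ipC g). Qed.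

Lemma ipBr f g h : L2 f -> L2 g -> L2 h ->
  ip h (fun x => f x - g x) = ip h f - ip h g.
Proof. by move=> lf lg lh; rewrite ipC ipBl// !(ipC h). Qed.

Lemma ip_ge0 f : 0 <= ip f f.
Proof. by apply: Rintegral_ge0 => x _; rewrite -expr2 sqr_ge0. Qed.

Lemma ip_eq0 f : L2 f -> ip f f = 0 -> {ae mu, forall x, f x = 0}.
Proof.
move=> lf; move/(ge0_Rintegral_eq0 (L2M lf lf)).
move=> /(_ (fun x => sqr_ge0 (f x))); apply: filterS => x /eqP.
by rewrite mulf_eq0 orbb => /eqP.
Qed.

Lemma ip_sqrB f g : L2 f -> L2 g ->
  ip (fun x => f x - g x) (fun x => f x - g x) = ip f f - 2 * ip f g + ip g g.
Proof.
move=> lf lg; have lfg := L2B lf lg.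
rewrite ipBl// !ipBr// (ipC g f); ring.
Qed.

Lemma ip_sqrD f g : L2 f -> L2 g ->
  ip (fun x => f x + g x) (fun x => f x + g x) = ip f f + 2 * ip f g + ip g g.
Proof.
move=> lf lg; have lfg := L2D lf lg.
rewrite ipDl// !ipDr// (ipC g f); ring.
Qed.

Lemma ip_CS f g : L2 f -> L2 g -> (ip f g) ^+ 2 <= ip f f * ip g g.
Proof.
move=> lf lg.
have H (t : R) : 0 <= ip f f - 2 * (t * ip f g) + t ^+ 2 * ip g g.
  have := ip_ge0 (fun x => f x - t * g x).
  rewrite ip_sqrB//; last exact: L2Z.
  by rewrite ipZr// ipZl//; [rewrite ipZr//; congr (_ <= _); ring|exact: L2Z].
have [g0|g0] := eqVneq (ip g g) 0.
  rewrite g0 mulr0; have [->|fg0] := eqVneq (ip f g) 0; first by rewrite expr0n.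
  have := H ((ip f f + 1) / (2 * ip f g)).
  rewrite g0 mulr0 addr0 (_ : 2 * (_ * _) = ip f f + 1); last by field.
  by move=> ?; lra.
have gg : 0 < ip g g by rewrite lt_neqAle eq_sym g0 ip_ge0.
have := H (ip f g / ip g g); rewrite -(pmulr_lge0 _ gg).
rewrite (_ : _ * _ = ip f f * ip g g - ip f g ^+ 2); last by field.
by move=> ?; lra.
Qed.

Lemma ip_bound f g : L2 f -> L2 g ->
  `|ip f g| <= Num.sqrt (ip f f) * Num.sqrt (ip g g).
Proof.
move=> lf lg; rewrite -sqrtrM ?ip_ge0// -sqrtr_sqr ler_wsqrtr//.
exact: ip_CS.
Qed.

End square_integrable.

Arguments rint_meas {d T R mu f}.
Arguments L2_meas {d T R mu f}.

(** * Lebesgue measure on the Euclidean space *)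

Section euclidean_space.
Context {R : realType}.
Local Notation leb := (@lebesgue_rV R).

Lemma coord_le_norm n (x : 'rV[R]_n) i : `|x ord0 i| <= `|x|.
Proof.
rewrite [leRHS]/Num.norm /= mx_normrE; apply/bigmax_geP; right => /=.
by exists (ord0, i).
Qed.

Lemma norm_rV_le n (x : 'rV[R]_n) (M : R) : 0 <= M ->
  (forall i, `|x ord0 i| <= M) -> `|x| <= M.
Proof.
move=> M0 xM; rewrite [leLHS]/Num.norm /= mx_normrE; apply/bigmax_leP; split => //.
by move=> [i j] _ /=; rewrite (ord1 i).
Qed.

Lemma norm_rV_lt n (x : 'rV[R]_n) (M : R) : 0 < M ->
  (forall i, `|x ord0 i| < M) -> `|x| < M.
Proof.
move=> M0 xM; rewrite [ltLHS]/Num.norm /= mx_normrE; apply/bigmax_ltP; split => //.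
by move=> [i j] _ /=; rewrite (ord1 i).
Qed.

Lemma measurable_box n (A : 'I_n -> set R) : (forall i, measurable (A i)) ->
  measurable [set x : 'rV[R]_n | forall i, A i (x ord0 i)].
Proof.
move=> mA.
rewrite (_ : mkset _ = \bigcap_(i in [set: 'I_n])
   ((fun x : 'rV[R]_n => x ord0 i : measurableTypeR R) @^-1` A i)).
  apply: fin_bigcap_measurable => // i _; rewrite -[X in measurable X]setTI.
  exact: (measurable_coord i measurableT (mA i)).
by apply/seteqP; split => x /= Ax i => [_|]; apply: Ax.
Qed.

Lemma measurable_ball_rV n (x : 'rV[R]_n) (r : R) : measurable (ball x r).
Proof.
have [r0|r0] := leP r 0.
  rewrite (_ : ball x r = set0) ?measurable0//.
  apply/seteqP; split => // y; rewrite -ball_normE /ball_ /= => xy.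
  by have := le_lt_trans (normr_ge0 _) xy; rewrite ltNge r0.
rewrite (_ : ball x r = [set y : 'rV[R]_n | forall i, ball (x ord0 i) r (y ord0 i)] :> set 'rV[R]_n).
  by apply: (@measurable_box n (fun i => ball (x ord0 i) r)) => i; exact: measurable_ball.
apply/seteqP; split => y.
  rewrite -ball_normE /ball_ /= => xy i; rewrite /ball/=; apply: le_lt_trans xy.
  by have := coord_le_norm (x - y) i; rewrite !mxE.
move=> xy; rewrite -ball_normE /ball_ /=; apply: norm_rV_lt => // i.
by rewrite !mxE; have := xy i; rewrite -ball_normE.
Qed.

(** The coordinates generate every open set because the rational balls form a
    countable base. *)
Lemma open_measurable_rV n (U : set 'rV[R]_n) : open U -> measurable U.
Proof.
move=> oU.
pose B (q : 'rV[rat]_n * rat) : set 'rV[R]_n :=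
  ball (map_mx (@ratr R) q.1) (ratr q.2).
rewrite (_ : U = \bigcup_q (if `[< B q `<=` U >] then B q else set0)).
  apply: countable_bigcupT_measurable; first exact: countableP.
  by move=> q; case: ifP => _ //; exact: measurable_ball_rV.
apply/seteqP; split; last first.
  by move=> x [q _]; case: asboolP => // qU; exact: qU.
move=> x Ux; have /nbhs_ballP[e /= e0 xU] := open_nbhs_nbhs (conj oU Ux).
have e2 : e / 4 < e / 2 by lra.
have [r] := rat_in_itvoo e2; rewrite in_itv/= => /andP[r1 r2].
have qP i : exists q : rat, ratr q \in `](x ord0 i), (x ord0 i + e / 4)[.
  by apply: rat_in_itvoo; lra.
pose q : 'rV[rat]_n := \row_i projT1 (cid (qP i)).
have xq : `|map_mx ratr q - x| <= e / 4.
  apply: norm_rV_le => [|i]; first by lra.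
  rewrite !mxE; case: cid => /= s; rewrite in_itv/= => /andP[s1 s2].
  by rewrite ger0_norm; lra.
exists (q, r) => //; case: asboolP => [_|]; last first.
  case => y; rewrite /B/= -ball_normE /ball_/= => qy; apply: xU.
  rewrite -ball_normE /ball_/=.
  rewrite (_ : x - y = (x - map_mx ratr q) + (map_mx ratr q - y)).
    rewrite (le_lt_trans (ler_normD _ _))//.
    by rewrite distrC; lra.
  by rewrite addrA subrK.
by rewrite /B -ball_normE /ball_/=; lra.
Qed.

Lemma continuous_measurable_rV n (f : 'rV[R]_n -> R) :
  continuous f -> measurable_fun setT f.
Proof.
move=> /continuousP cf; apply: (measurability _ (RGenOpens.measurableE R)).
move=> _ [_ [a [b ->] <-]]; rewrite setTI; apply: open_measurable_rV.
exact/cf/interval_open.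
Qed.

Lemma measurable_translation n (h : 'rV[R]_n) :
  measurable_fun setT (fun x : 'rV[R]_n => x + h).
Proof.
apply: measurable_fun_rV => i.
rewrite (_ : (fun _ => _) = (fun x : 'rV[R]_n =>
   (x ord0 i : measurableTypeR R) + h ord0 i)).
  by apply: measurable_funD => //; exact: measurable_coord.
by apply/funext => x; rewrite mxE.
Qed.

Lemma ge0_integral_rVS n (f : 'rV[R]_n.+1 -> \bar R) :
  measurable_fun setT f -> (forall x, 0 <= f x)%E ->
  (\int[leb n.+1]_x f x =
   \int[@lebesgue_measure R]_t \int[leb n]_y f (rV_cons (t, y)))%E.
Proof.
move=> mf f0.
have := @ge0_integral_pushforward _ _ _ _ R (@rV_cons R n)
  (@measurable_rV_cons R n) (@lebesgue_measure R \x leb n)%E setT f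
  measurableT mf (fun x _ => f0 x).
rewrite preimage_setT => H; apply: etrans H _.
apply: fubini_tonelli1 => [|z]; last exact: f0.
exact: (measurableT_comp mf (@measurable_rV_cons R n)).
Qed.

Lemma ge0_integral_translation1 (f : R -> \bar R) (c : R) :
  measurable_fun setT f -> (forall x, 0 <= f x)%E ->
  (\int[@lebesgue_measure R]_t f (t + c)%R = \int[@lebesgue_measure R]_t f t)%E.
Proof.
move=> mf f0.
have mc : measurable_fun setT (fun t : measurableTypeR R =>
    t + c : measurableTypeR R).
  by apply: measurable_funD.
have := @ge0_integral_pushforward _ _ _ _ R _ mc (@lebesgue_measure R) setT f
  measurableT mf (fun x _ => f0 x).
rewrite preimage_setT => <-.
apply: eq_measure_integral => A mA _; apply/esym.
suff H (X : set R) : ocitv X -> lebesgue_measure X =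
    measure_function_pushforward__canonical__measure_function_Measure
      (@lebesgue_measure R) mc X.
  exact: (lebesgue_measure_unique H mA).
move=> [[a b]] _ <-; rewrite /= /pushforward.
rewrite (_ : _ @^-1` _ = `](a - c), (b - c)]%classic).
  rewrite !lebesgue_measure_itv/= !lte_fin ltrD2r.
  by case: ifP => // _; rewrite -!EFinB; congr EFin; ring.
by apply/seteqP; split => t /=; rewrite !in_itv/=; lra.
Qed.

Lemma rV_consD n (t s : R) (y z : 'rV[R]_n) :
  rV_cons (t, y) + rV_cons (s, z) = rV_cons (t + s, y + z).
Proof.
apply/rowP => i; rewrite !mxE.
by case: (unliftP ord0 i) => [j _|_] //=; rewrite mxE.
Qed.

(** By induction on the dimension: Tonelli peels off one coordinate, and the
    one-dimensional case is the uniqueness of the Lebesgue measure. *)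
Lemma ge0_integral_translation n (f : 'rV[R]_n -> \bar R) h :
  measurable_fun setT f -> (forall x, 0 <= f x)%E ->
  (\int[leb n]_x f (x + h)%R = \int[leb n]_x f x)%E.
Proof.
elim: n f h => [|n IH] f h mf f0.
  by apply: eq_integral => x _; congr f; apply/rowP => -[].
have mfh : measurable_fun setT (fun x : 'rV[R]_n.+1 => f (x + h)).
  exact: (measurableT_comp mf (measurable_translation h)).
rewrite (ge0_integral_rVS mf f0) (ge0_integral_rVS mfh); last by move=> x; exact: f0.
have mF : measurable_fun setT (fun z => f (@rV_cons R n z)).
  exact: (measurableT_comp mf (@measurable_rV_cons R n)).
transitivity (\int[@lebesgue_measure R]_t
   (\int[leb n]_y f (rV_cons (t + (rV_uncons h).1, y)%R)))%E.
  apply: eq_integral => t _.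
  rewrite -(IH (fun y => f (rV_cons (t + (rV_uncons h).1, y))) (rV_uncons h).2).
  - apply: eq_integral => y _; congr f.
    by rewrite -rV_consD -[in LHS](rV_unconsK h).
  - exact: (measurableT_comp mF (measurable_pair1 _)).
  - by [].
apply: (ge0_integral_translation1 (f := fun t => \int[leb n]_y f (rV_cons (t, y)))%E).
  exact: (measurable_fun_fubini_tonelli_F (fun z => f (rV_cons z))).
by move=> t; apply: integral_ge0.
Qed.

(** Induction on the dimension: by Tonelli each coordinate contributes its own
    one-dimensional integral as a factor. *)
Lemma ge0_integral_prod_ltoo n (g : R -> R) :
  measurable_fun setT g -> (forall t, 0 <= g t) ->
  (\int[@lebesgue_measure R]_t (g t)%:E < +oo)%E ->
  (\int[leb n]_x (\prod_(i < n) g (x ord0 i))%:E < +oo)%E.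
Proof.
move=> mg g0 goo.
have mP k : measurable_fun setT (fun x : 'rV[R]_k => \prod_(i < k) g (x ord0 i)).
  by apply: measurable_prod => i _; exact: (measurableT_comp mg (measurable_coord i)).
elim: n => [|n IH].
  rewrite /= integral_dirac//; last by apply/measurable_EFinP; exact: mP.
  by rewrite diracT mul1e ltry.
rewrite ge0_integral_rVS; last 2 first.
- by apply/measurable_EFinP; exact: mP.
- by move=> x; rewrite lee_fin prodr_ge0.
rewrite (_ : (fun t => _) = fun t : R =>
   ((g t)%:E * \int[leb n]_x (\prod_(i < n) g (x ord0 i))%:E)%E); last first.
  apply/funext => t; rewrite -ge0_integralZl_EFin//; last first.
  - by apply/measurable_EFinP; exact: mP.
  - by move=> x _; rewrite lee_fin prodr_ge0.
  apply: eq_integral => x _; rewrite big_ord_recl -EFinM mxE unlift_none/=.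
  by congr (_ * _)%:E; apply: eq_bigr => i _; rewrite mxE liftK.
rewrite ge0_integralZr//.
- apply: lte_mul_pinfty => //; first by apply: integral_ge0 => t _; rewrite lee_fin.
  by rewrite ge0_fin_numE//; apply: integral_ge0 => t _; rewrite lee_fin.
- exact/measurable_EFinP.
- by move=> t _; rewrite lee_fin.
- by apply: integral_ge0 => x _; rewrite lee_fin prodr_ge0.
Qed.

Lemma lebesgue_box_ltoo n (M : R) :
  (leb n [set x | forall i, `|x ord0 i| <= M]%R < +oo)%E.
Proof.
have mI : measurable [set t : R | `|t| <= M].
  rewrite (_ : mkset _ = `[- M, M]%classic); first exact: measurable_itv.
  by apply/seteqP; split => t /=; rewrite in_itv/= ler_norml.
rewrite -[X in leb n X]setIT -integral_indic//; last first.
  exact: (@measurable_box n (fun=> [set t : R | `|t| <= M])).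
have := @ge0_integral_prod_ltoo n (\1_[set t : R | `|t| <= M]).
rewrite (_ : (fun x : 'rV[R]_n => (\prod_(i < n) _)%:E) =
  (fun x => (\1_[set x : 'rV[R]_n | forall i, `|x ord0 i| <= M] x)%:E)).
  apply => //.
  rewrite integral_indic// setIT (_ : mkset _ = `[- M, M]%classic).
    have : (lebesgue_measure (`[(- M)%R, M]%classic : set R) < +oo)%E.
      by rewrite lebesgue_measure_itv/=; case: ifP => _; rewrite ?ltry//= -EFinB ltry.
    exact.
  by apply/seteqP; split => t /=; rewrite in_itv/= ler_norml.
apply/funext => x; congr EFin; rewrite indicE.
have [/set_mem xM|xM] := boolP (x \in _).
  by rewrite big1// => i _; rewrite indicE mem_set//=; exact: xM.
have [i xi] : exists i, ~ `|x ord0 i| <= M.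
  by apply/existsNP => H; move/negP: xM; apply; exact/mem_set.
by rewrite (bigD1 i)//= indicE memNset ?mul0r.
Qed.

End euclidean_space.

(** * Smooth functions and test functions *)

Section mean_value.
Context {R : realType}.

Lemma lipschitz_of_derive (f df : R -> R) (M : R) :
  (forall t : R, is_derive t (1 : R) f (df t)) -> (forall t, `|df t| <= M) ->
  forall s t, `|f t - f s| <= M * `|t - s|.
Proof.
move=> fd fM.
have cf : continuous f.
  by move=> x; apply/differentiable_continuous/derivable1_diffP; case: (fd x).
have H a b : a <= b -> `|f b - f a| <= M * `|b - a|.
  move=> ab.
  have [|c _ ->] := MVT_segment ab (fun x _ => fd x).
    exact: continuous_subspaceT.
  by rewrite normrM ler_wpM2r.
move=> s t; have [st|/ltW ts] := leP s t; first exact: H.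
by rewrite distrC (distrC t); exact: H.
Qed.

(** Derivatives are limits along sequences, so that convergence theorems for
    sequences of integrals apply to difference quotients. *)
Lemma is_derive_seq (f : R -> R) (t l : R) :
  (forall u : nat -> R, (forall n, u n != 0) -> u n @[n --> \oo] --> 0 ->
    (f (t + u n) - f t) / u n @[n --> \oo] --> l) ->
  is_derive t 1 f l.
Proof.
move=> H.
have C : h^-1 *: ((f \o shift t) (h *: (1 : R)) - f t) @[h --> 0^'] --> (l : R^o).
  apply/cvgr_dnbhsP => u [u0 ucv].
  rewrite (_ : (fun n => _) = (fun n => (f (t + u n) - f t) / u n)); first exact: H.
  by apply/funext => n /=; rewrite /GRing.scale /= mulr1 mulrC (addrC _ t).
by apply: DeriveDef; [apply/cvg_ex; exists l|apply/cvg_lim].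
Qed.

End mean_value.

Section flat_function.
Context {R : realType}.

(** For [n = 0] the smooth function that is flat at the origin; the other
    exponents make the family closed under differentiation. *)
Definition flat (n : nat) (t : R) : R :=
  if 0 < t then t^-1 ^+ n * expR (- t^-1) else 0.

Lemma flat_ge0 n t : 0 <= flat n t.
Proof.
rewrite /flat; case: ifPn => // t0; rewrite mulr_ge0 ?expR_ge0//.
by rewrite exprn_ge0// invr_ge0 ltW.
Qed.

Lemma flat_le n t : flat n t <= n`!%:R.
Proof.
rewrite /flat; case: ifPn => // t0.
have s0 : 0 <= t^-1 by rewrite invr_ge0 ltW.
rewrite expRN ler_pdivrMr ?expR_gt0// mulrC.
case: n => [|n]; first by rewrite expr0 mulr1 -[leLHS]expR0 ler_expR.
rewrite -ler_pdivrMr ?ltr0n ?fact_gt0//.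
by apply: le_trans (expR_ge1Dxn n s0); rewrite lerDr.
Qed.

Lemma flatS n t : flat n t = t * flat n.+1 t.
Proof.
rewrite /flat; case: ifPn => t0; last by rewrite mulr0.
by rewrite exprS !mulrA mulfV ?mul1r// gt_eqF.
Qed.

(** At the origin, where the two branches meet, [flat n t = t ^ 2 * flat n.+2 t]
    makes the difference quotient vanish in the limit. *)
Lemma is_derive_flat n (t : R) :
  is_derive t (1 : R) (flat n) (flat n.+2 t - n%:R * flat n.+1 t).
Proof.
have [t0|t0|t0] := ltgtP 0 t.
- apply: (@near_eq_is_derive _ R R^o (fun s : R => s^-1 ^+ n * expR (- s^-1))).
    near=> s; rewrite /flat ifT//; near: s; exact: lt_nbhsr.
  have dV : is_derive t 1 (fun s : R => s^-1) (- (t ^- 2)).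
    have := @is_deriveV R id t 1 1 (lt0r_neq0 t0) (is_derive_id _ _).
    by rewrite /GRing.scale /= mulr1.
  have dX := @is_deriveX _ _ (fun s : R => s^-1) n t 1 _ dV.
  have dN := @is_deriveN _ _ _ (fun s : R => s^-1) t 1 _ dV.
  have dE := @is_derive1_comp _ expR (- (fun s : R => s^-1)) t _ _
     (is_derive_expR _) dN.
  rewrite (_ : (fun s : R => _) =
    ((fun s : R => s^-1) ^+ n) * (expR \o - (fun s : R => s^-1))); last first.
    by apply/funext => s; rewrite !fctE.
  apply: is_derive_eq.
  rewrite /flat t0 /GRing.scale /= !fctE /= exprVn.
  case: n {dX} => [|n] /=; first by rewrite !mul0r !mulr0 !addr0 !expr0; field; exact: lt0r_neq0.
  by rewrite -!exprVn !exprS; ring.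
- apply: (@near_eq_is_derive _ R R^o (cst 0)).
    near=> s; rewrite /flat /cst ifF//; apply/negbTE; rewrite -leNgt ltW//.
    near: s; exact: lt_nbhsl.
  by apply: is_derive_eq; rewrite /flat !ifF ?mulr0 ?subr0//; apply/negbTE; rewrite -leNgt ltW.
- rewrite -t0 [X in is_derive _ _ _ X](_ : _ = 0); last first.
    by rewrite /flat ltxx mulr0 subrr.
  apply: is_derive_seq => u u0 ucv.
  have E k : `|(flat n (0 + u k) - flat n 0) / u k| <= n.+2`!%:R * `|u k|.
    rewrite add0r {2}/flat ltxx subr0 flatS (flatS n.+1) mulrAC mulfV ?u0// mul1r.
    by rewrite normrM mulrC ler_wpM2r// ger0_norm ?flat_ge0 ?flat_le.
  apply/norm_cvg0P; apply: (squeeze_cvgr (f := cst 0) (h := fun k => n.+2`!%:R * `|u k|)).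
  + by near=> k; rewrite normr_ge0/=; exact: E.
  + exact: cvg_cst.
  + rewrite -(mulr0 (n.+2`!%:R : R)); apply: cvgMr.
    by apply/norm_cvg0P.
Unshelve. all: by end_near. Qed.

Lemma differentiable_flat n t : differentiable (flat n) t.
Proof. by apply/derivable1_diffP; case: (is_derive_flat n t). Qed.

Lemma derive1_flat n (t : R) :
  derive1 (flat n) t = flat n.+2 t - n%:R * flat n.+1 t.
Proof. by rewrite derive1E; case: (is_derive_flat n t). Qed.

End flat_function.

Section test_functions.
Context {R : realType} {N : nat}.
Implicit Types (f g phi : 'rV[R]_N -> R) (x h : 'rV[R]_N) (i j : 'I_N).

Local Notation e i := (delta_mx ord0 i : 'rV[R]_N).

(** The closure of the smooth functions under the operations below is stable
    under partial differentiation, hence consists of smooth functions. *)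
Inductive smooth_closure : ('rV[R]_N -> R) -> Prop :=
| SCsmooth f : smooth f -> smooth_closure f
| SCcst (c : R) : smooth_closure (cst c)
| SCflat n (c d : R) i : smooth_closure (fun x => flat n (c * x ord0 i + d))
| SCcomp (c : R) h f : smooth_closure f -> smooth_closure (fun x => f (c *: x + h))
| SCD f g : smooth_closure f -> smooth_closure g ->
    smooth_closure (fun x => f x + g x)
| SCM f g : smooth_closure f -> smooth_closure g ->
    smooth_closure (fun x => f x * g x).

Lemma is_diff_affine (c : R) h x :
  is_diff x (fun y : 'rV[R]_N => c *: y + h) ( *:%R c).
Proof.
have := @is_diffD R _ _ ( *:%R c) (cst h) _ _ x
  (is_diff_scaler c x) (is_diff_cst h x).
by rewrite addr0.
Qed.

Lemma is_diff_coord i x : is_diff x (fun y : 'rV[R]_N => y ord0 i : R) (fun v => v ord0 i).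
Proof.
have lin : linear (fun y : 'rV[R]_N => y ord0 i : R).
  by move=> a y z; rewrite !mxE.
pose L := GRing.isLinear.Build R 'rV[R]_N R *:%R (fun y : 'rV[R]_N => y ord0 i : R) lin.
pose F : {linear 'rV[R]_N -> R} := HB.pack (fun y : 'rV[R]_N => y ord0 i : R) L.
have cF : continuous F by exact: coord_continuous.
apply: DiffDef; first exact: differentiable_coord.
exact: (@diff_lin R _ _ F x cF).
Qed.

Lemma is_diff_flat n (c d : R) i x :
  is_diff x (fun y : 'rV[R]_N => flat n (c * y ord0 i + d))
   (fun v => derive1 (flat n) (c * x ord0 i + d) * (c * v ord0 i)).
Proof.
have da : is_diff x (fun y : 'rV[R]_N => c * y ord0 i + d) (fun v => c * v ord0 i).
  have := @is_diffD R _ _ (c *: (fun y : 'rV[R]_N => y ord0 i : R)) (cst d) _ _ x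
    (is_diffZ c (is_diff_coord i x)) (is_diff_cst d x).
  by rewrite addr0.
have df : is_diff (c * x ord0 i + d) (flat n)
    (fun t => derive1 (flat n) (c * x ord0 i + d) * t).
  apply: DiffDef; first exact: differentiable_flat.
  rewrite diff1E; last exact: differentiable_flat.
  by apply/funext => t; exact: mulrC.
exact: (is_diff_comp da df).
Qed.

Lemma smooth_closure_diff f : smooth_closure f -> forall x, differentiable f x.
Proof.
elim => {f} [f fs|c|n c d i|c h f _ IH|f g _ IHf _ IHg|f g _ IHf _ IHg] x.
- exact: (fs [::]).
- exact: differentiable_cst.
- by case: (is_diff_flat n c d i x).
- apply: (@differentiable_comp _ _ _ _ (fun y => c *: y + h) f); last exact: IH.
  by case: (is_diff_affine c h x).
- exact: differentiableD.
- exact: differentiableM.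
Qed.

Lemma partial_affine f (c : R) h i x : differentiable f (c *: x + h) ->
  partial i (fun y => f (c *: y + h)) x = c * partial i f (c *: x + h).
Proof.
move=> df; have [da dE] := is_diff_affine c h x.
rewrite /partial deriveE; last exact: (@differentiable_comp _ _ _ _ (fun y => c *: y + h)).
rewrite (@diff_comp _ _ _ _ (fun y => c *: y + h) f)//= dE linearZ/=.
by rewrite deriveE.
Qed.

Lemma partialD f g i x : differentiable f x -> differentiable g x ->
  partial i (fun y => f y + g y) x = partial i f x + partial i g x.
Proof. by move=> df dg; apply: deriveD; exact: diff_derivable. Qed.

Lemma partialM f g i x : differentiable f x -> differentiable g x ->
  partial i (fun y => f y * g y) x = f x * partial i g x + partial i f x * g x.
Proof.
move=> df dg; rewrite /partial (mulrC _ (g x)).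
by apply: deriveM; exact: diff_derivable.
Qed.

Lemma smooth_closure_partial f i : smooth_closure f -> smooth_closure (partial i f).
Proof.
move=> fs; elim: fs i => {f} [f fs|c|n c d j|c h f fs IH|f g fs IHf gs IHg|f g fs IHf gs IHg] i.
- apply: SCsmooth => s; rewrite -foldr_rcons; exact: fs.
- rewrite (_ : partial i _ = cst 0); first exact: SCcst.
  by apply/funext => x; exact: derive_cst.
- rewrite (_ : partial i _ = fun x => cst (c * e i ord0 j) x *
    (flat n.+2 (c * x ord0 j + d) + cst (- n%:R) x * flat n.+1 (c * x ord0 j + d))).
    by do ?[exact: SCcst|exact: SCflat|apply: SCM|apply: SCD].
  apply/funext => x; have [df dE] := is_diff_flat n c d j x.
  by rewrite /partial deriveE// dE derive1_flat /cst; ring.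
- rewrite (_ : partial i _ = fun x => cst c x * partial i f (c *: x + h)).
    by apply: SCM; [exact: SCcst|exact: (SCcomp _ _ (IH i))].
  by apply/funext => x; rewrite partial_affine//; exact: smooth_closure_diff.
- rewrite (_ : partial i _ = fun x => partial i f x + partial i g x).
    by apply: SCD.
  by apply/funext => x; rewrite partialD//; exact: smooth_closure_diff.
- rewrite (_ : partial i _ = fun x => f x * partial i g x + partial i f x * g x).
    by apply: SCD; apply: SCM.
  by apply/funext => x; rewrite partialM//; exact: smooth_closure_diff.
Qed.

Lemma smooth_closureP f : smooth_closure f -> smooth f.
Proof.
move=> fs s; suff : smooth_closure (foldr partial f s).
  by move=> /smooth_closure_diff.
by elim: s => [|i s IH] //=; exact: smooth_closure_partial.
Qed.

Lemma smooth_partial f i : smooth f -> smooth (partial i f).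
Proof. by move=> fs s; rewrite -foldr_rcons; exact: fs. Qed.

Lemma smooth_continuous f : smooth f -> continuous f.
Proof. by move=> fs x; apply: differentiable_continuous; exact: (fs [::]). Qed.

Lemma smooth_measurable f : smooth f -> measurable_fun setT f.
Proof. by move=> fs; apply: continuous_measurable_rV; exact: smooth_continuous. Qed.

Lemma closed_norm_le (K : R) : closed [set x : 'rV[R]_N | `|x| <= K].
Proof.
apply: (@closed_comp _ _ (fun x : 'rV[R]_N => `|x|) [set t : R | t <= K]).
  by move=> x _; exact: norm_continuous.
exact: closed_le.
Qed.

Lemma compact_norm_le (K : R) : compact [set x : 'rV[R]_N | `|x| <= K].
Proof.
apply: bounded_closed_compact; last exact: closed_norm_le.
by exists K; split; [exact: num_real|] => M KM x /= xK; rewrite (le_trans xK)// ltW.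
Qed.

Lemma test_functionP phi : test_function phi <->
  smooth phi /\ exists K : R, forall x, K < `|x| -> phi x = 0.
Proof.
split=> [[sphi cphi]|[sphi [K HK]]]; split => //.
  have [M [Mr HM]] := compact_bounded cphi.
  exists (M + 1) => x Mx; apply/eqP; apply: contraT => phix.
  have M1 : M < M + 1 by rewrite ltrDl.
  have := HM _ M1 x (@subset_closure _ [set x | phi x != 0] x phix).
  by rewrite /= leNgt Mx.
apply: (@subclosed_compact _ _ [set x : 'rV[R]_N | `|x| <= K]).
- exact: closed_closure.
- exact: compact_norm_le.
- rewrite [X in _ `<=` X](_ : _ = closure [set x | `|x| <= K]); last first.
    by rewrite -(closure_id _).1//; exact: closed_norm_le.
  apply: closure_subset => x /= phix; rewrite leNgt; apply/negP => /HK /eqP.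
  by rewrite (negbTE phix).
Qed.

Lemma partial_vanish phi i (K : R) : (forall x, K < `|x| -> phi x = 0) ->
  forall x, K < `|x| -> partial i phi x = 0.
Proof.
move=> HK x Kx; rewrite /partial.
rewrite -(@derive_cst R _ _ (0 : R) x (e i)).
apply: near_eq_derive; near=> y; rewrite /cst; apply: HK.
near: y; exact: (cvgr_gt _ (@norm_continuous R 'rV[R]_N x)).
Unshelve. all: by end_near. Qed.

Lemma test_partial phi i : test_function phi -> test_function (partial i phi).
Proof.
move=> /test_functionP[sphi [K HK]]; apply/test_functionP; split.
  exact: smooth_partial.
by exists K; exact: partial_vanish.
Qed.

Lemma test_bounded phi : test_function phi ->
  exists M K : R, [/\ 0 <= M, 0 <= K, forall x, `|phi x| <= M &
    forall x, K < `|x| -> phi x = 0].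
Proof.
move=> /test_functionP[sphi [K HK]].
pose A := [set x : 'rV[R]_N | `|x| <= `|K|].
have cA : compact A by exact: compact_norm_le.
have cphi : {within A, continuous (fun x => `|phi x|)}.
  apply: continuous_subspaceT => x.
  by apply: continuous_comp; [exact: smooth_continuous|exact: norm_continuous].
have A0 : A !=set0 by exists 0; rewrite /A /= normr0.
have [c _ cP] := EVT_max_rV A0 cA cphi.
exists `|phi c|, `|K|; split => // x.
  have [xK|xK] := leP `|x| `|K|; first by apply: cP; rewrite inE.
  by rewrite HK ?normr0// (le_lt_trans _ xK)// ler_norm.
by move=> xK; apply: HK; rewrite (le_lt_trans _ xK)// ler_norm.
Qed.

Lemma test_comp phi (c : R) h : c != 0 -> test_function phi ->
  test_function (fun x => phi (c *: x + h)).
Proof.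
move=> c0 /test_functionP[sphi [K HK]]; apply/test_functionP; split.
  by apply: smooth_closureP; apply: SCcomp; exact: SCsmooth.
exists ((`|K| + `|h|) / `|c|) => x; rewrite ltr_pdivrMr ?normr_gt0// => xK.
apply: HK; apply: (@le_lt_trans _ _ `|K|); first exact: ler_norm.
have : `|c *: x| <= `|c *: x + h| + `|h|.
  by rewrite -{1}(addrK h (c *: x)) (le_trans (ler_normB _ _)).
by rewrite normrZ; lra.
Qed.

Lemma testM f phi : smooth f -> test_function phi ->
  test_function (fun x => f x * phi x).
Proof.
move=> sf /test_functionP[sphi [K HK]]; apply/test_functionP; split.
  by apply: smooth_closureP; apply: SCM; exact: SCsmooth.
by exists K => x /HK ->; rewrite mulr0.
Qed.

Lemma testD f phi : test_function f -> test_function phi ->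
  test_function (fun x => f x + phi x).
Proof.
move=> /test_functionP[sf [K HK]] /test_functionP[sphi [L HL]].
apply/test_functionP; split.
  by apply: smooth_closureP; apply: SCD; exact: SCsmooth.
by exists (Num.max K L) => x; rewrite gt_max => /andP[/HK -> /HL ->]; rewrite addr0.
Qed.

Lemma test_cst (c : R) : smooth (cst c : 'rV[R]_N -> R).
Proof. by apply: smooth_closureP; exact: SCcst. Qed.

(** A smooth substitute, for large [k], of the indicator of the open box with
    corners [a] and [b]. *)
Definition bump (a b : 'rV[R]_N) (k : R) x : R :=
  \prod_i (flat 0 (k * x ord0 i - k * a ord0 i) * flat 0 (- k * x ord0 i + k * b ord0 i)).

Lemma smooth_prod (s : seq 'I_N) (F : 'I_N -> 'rV[R]_N -> R) :
  (forall i, smooth_closure (F i)) -> smooth_closure (fun x => \prod_(i <- s) F i x).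
Proof.
move=> FS; elim: s => [|i s IH].
  rewrite (_ : (fun x => _) = cst 1); first exact: SCcst.
  by apply/funext => x; rewrite big_nil.
rewrite (_ : (fun x => _) = fun x => F i x * \prod_(j <- s) F j x).
  exact: SCM.
by apply/funext => x; rewrite big_cons.
Qed.

Lemma flat0_le1 (t : R) : flat 0 t <= 1.
Proof. exact: (flat_le 0). Qed.

Lemma flat_le0 n (t : R) : t <= 0 -> flat n t = 0.
Proof. by move=> t0; rewrite /flat ltNge t0. Qed.

Lemma bump_ge0 a b k x : 0 <= bump a b k x.
Proof. by apply: prodr_ge0 => i _; rewrite mulr_ge0// flat_ge0. Qed.

Lemma bump_le1 a b k x : bump a b k x <= 1.
Proof.
apply: prodr_ile1 => i _; rewrite mulr_ge0 ?flat_ge0//=.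
by rewrite mulr_ile1 ?flat_ge0 ?flat0_le1.
Qed.

Lemma box_out (a b : 'rV[R]_N) x : ~ (forall i, a ord0 i < x ord0 i < b ord0 i) ->
  exists i, ~~ (a ord0 i < x ord0 i < b ord0 i).
Proof.
by move=> H; apply/existsP; rewrite -negb_forall; apply/negP => /forallP.
Qed.

Lemma bump_out (a b : 'rV[R]_N) (k : R) x i : 0 < k -> ~~ (a ord0 i < x ord0 i < b ord0 i) ->
  bump a b k x = 0.
Proof.
move=> k0; rewrite negb_and -!leNgt /bump => H.
rewrite (bigD1 i)//=; apply/eqP; rewrite !mulf_eq0 -orbA; apply/or3P.
by case/orP: H => H; [apply: Or31|apply: Or32]; apply/eqP; apply: flat_le0; nra.
Qed.

Lemma bump_test (a b : 'rV[R]_N) (k : R) : (0 < N)%N -> 0 < k -> test_function (bump a b k).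
Proof.
move=> N0 k0; apply/test_functionP; split.
  apply: smooth_closureP; apply: smooth_prod => i.
  by apply: SCM; exact: SCflat.
exists (`|a| + `|b|) => x xab.
have [|i xi] := @box_out a b x.
  move=> H; suff : `|x| <= `|a| + `|b| by rewrite leNgt xab.
  apply: norm_rV_le => [|i]; first by rewrite addr_ge0.
  have := H i; have := coord_le_norm a i; have := coord_le_norm b i.
  by rewrite !ler_norml; lra.
exact: bump_out xi.
Qed.

End test_functions.

(** * Density of the test functions *)

Section L2_limits.
Context d (T : measurableType d) (R : realType).
Variable mu : {measure set T -> \bar R}.

Lemma L2_dct (F : nat -> T -> R) (f G : T -> R) :
  (forall n, measurable_fun setT (F n)) ->
  (forall x, F ^~ x @ \oo --> f x) -> L2 mu G ->
  (forall n x, `|F n x - f x| <= G x) ->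
  ip mu (fun x => F n x - f x) (fun x => F n x - f x) @[n --> \oo] --> 0.
Proof.
move=> mF Ff [mG GG] FG.
have mf : measurable_fun setT f.
  by apply: (@measurable_fun_cvg _ _ _ setT F f) => // x _; exact: Ff.
have [|||_] := @Rdct _ _ _ mu
    (fun n x => (F n x - f x) * (F n x - f x)) (cst 0) (fun x => G x ^+ 2) _ _ GG.
- by move=> n; apply: measurable_funM; exact: measurable_funB.
- move=> x; have : (F n x - f x) * (F n x - f x) @[n --> \oo] --> (f x - f x) * (f x - f x).
    by apply: cvgM; (apply: cvgB; [exact: Ff|exact: cvg_cst]).
  by rewrite subrr mulr0.
- move=> n x; rewrite normrM -expr2 lerXn2r// ?nnegrE//; exact: le_trans (FG n x).
- by rewrite (Rintegral_cst _ measurableT) mul0r.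
Qed.

(** A triangle inequality for squared norms, with a factor 2 instead of roots. *)
Lemma ip_sqr_triangle (f g h : T -> R) : L2 mu f -> L2 mu g -> L2 mu h ->
  ip mu (fun x => f x - h x) (fun x => f x - h x) <=
  2 * ip mu (fun x => f x - g x) (fun x => f x - g x) +
  2 * ip mu (fun x => g x - h x) (fun x => g x - h x).
Proof.
move=> lf lg lh; have fg := L2B lf lg; have gh := L2B lg lh.
have := ip_ge0 mu (fun x => (f x - g x) - (g x - h x)).
rewrite (ip_sqrB fg gh) => H.
rewrite (eq_ip (f' := fun x => (f x - g x) + (g x - h x)) _
               (g' := fun x => (f x - g x) + (g x - h x))) => [|x|x].
- by rewrite (ip_sqrD fg gh); lra.
- by ring.
- by ring.
Qed.

End L2_limits.

Section density.
Context {R : realType} {N : nat}.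
Hypothesis N_gt0 : (0 < N)%N.
Local Notation mu := (@lebesgue_rV R N).
Implicit Types (f g phi : 'rV[R]_N -> R) (x h : 'rV[R]_N) (i j : 'I_N).

Lemma L2_bounded_support f (M K : R) : measurable_fun setT f ->
  (forall x, `|f x| <= M) -> (forall x, K < `|x| -> f x = 0) ->
  L2 mu f /\ rint mu f.
Proof.
move=> mf fM fK.
pose B := [set x : 'rV[R]_N | forall i, `|x ord0 i| <= K].
have mB : measurable B.
  apply: (@measurable_box _ _ (fun=> [set t : R | `|t| <= K])) => _.
  rewrite (_ : mkset _ = `[- K, K]%classic); first exact: measurable_itv.
  by apply/seteqP; split => t /=; rewrite in_itv/= ler_norml.
have iB : rint mu (\1_B : 'rV[R]_N -> R).
  apply: ge0_rint => //.
  by rewrite integral_indic// setIT; exact: lebesgue_box_ltoo.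
have M0 : 0 <= M by exact: le_trans (fM 0).
have fB x : x \notin B -> f x = 0.
  move=> /negP xB; apply: fK; rewrite ltNge; apply/negP => xK; apply: xB.
  by apply/mem_set => i; exact: le_trans (coord_le_norm x i) xK.
split; last first.
  apply: (le_rint mf _ (rintZ M iB)) => x; rewrite indicE.
  have [xB|/fB ->] := boolP (x \in B); first by rewrite mulr1.
  by rewrite normr0 mulr0.
split=> //; apply: (le_rint _ _ (rintZ (M ^+ 2) iB)).
  exact: measurable_funX.
move=> x; rewrite indicE.
have [xB|/fB ->] := boolP (x \in B); last by rewrite expr0n normr0 mulr0.
by rewrite mulr1 normrX lerXn2r.
Qed.

Definition ballI (M : R) : 'rV[R]_N -> R := \1_[set x | `|x| <= M].

Lemma measurable_ballI M : measurable_fun setT (ballI M).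
Proof.
apply: measurable_indic; rewrite -[X in measurable X]setCK.
apply: measurableC; apply: open_measurable_rV; exact/closed_openC/closed_norm_le.
Qed.

Lemma ballI_in M x : `|x| <= M -> ballI M x = 1.
Proof. by move=> xM; rewrite /ballI indicE mem_set. Qed.

Lemma ballI_out M x : M < `|x| -> ballI M x = 0.
Proof. by move=> xM; rewrite /ballI indicE memNset// /= leNgt xM. Qed.

Lemma ballI_ge0 M x : 0 <= ballI M x. Proof. by []. Qed.

Lemma ballI_le1 M x : ballI M x <= 1.
Proof. by have [h|h] := leP `|x| M; [rewrite ballI_in|rewrite ballI_out]. Qed.

Lemma L2_rint_ballI M : L2 mu (ballI M) /\ rint mu (ballI M).
Proof.
apply: (@L2_bounded_support (ballI M) 1 M).
- exact: measurable_ballI.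
- by move=> x; rewrite ger0_norm ?ballI_ge0// ballI_le1.
- exact: ballI_out.
Qed.

Lemma rint_ballI M : rint mu (ballI M).
Proof. by case: (L2_rint_ballI M). Qed.

Lemma test_L2 phi : test_function phi -> L2 mu phi.
Proof.
move=> /[dup] [[sphi _]] /test_bounded[M [K [_ _ HM HK]]].
have [] // := L2_bounded_support (smooth_measurable sphi) HM HK.
Qed.

(** Membership in the closure of the test functions. *)
Definition approximable f := L2 mu f /\ forall eps : R, 0 < eps ->
  exists2 phi, test_function phi &
    ip mu (fun x => f x - phi x) (fun x => f x - phi x) <= eps.

Lemma approximable_dct (F : nat -> 'rV[R]_N -> R) f G :
  (forall n, approximable (F n)) -> (forall x, F ^~ x @ \oo --> f x) ->
  L2 mu f -> L2 mu G -> (forall n x, `|F n x - f x| <= G x) -> approximable f.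
Proof.
move=> Fa Ff lf lG FG; split => // eps eps0.
have := L2_dct (fun n => L2_meas (Fa n).1) Ff lG FG.
move=> /cvgrPdist_le /(_ (eps / 4)) [|n _ /(_ n (leqnn n))] /=; first by lra.
rewrite sub0r normrN (ger0_norm (ip_ge0 _ _)) => Hn.
have [lF /(_ (eps / 4))[|phi tphi Hphi]] := Fa n; first by lra.
exists phi => //; apply: le_trans (ip_sqr_triangle lf lF (test_L2 tphi)) _.
rewrite (eq_ip (f' := fun x => - 1 * (F n x - f x)) _
               (g' := fun x => - 1 * (F n x - f x))) => [|x|x]; last 2 first.
- by ring.
- by ring.
have lFf : L2 mu (fun x => F n x - f x) by exact: L2B.
by rewrite ipZl ?ipZr//; [lra|exact: L2Z].
Qed.

Lemma approximableZ (c : R) f : approximable f -> approximable (fun x => c * f x).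
Proof.
move=> [lf fa]; split; first exact: L2Z.
move=> eps eps0; have [phi tphi Hphi] := fa (eps / (c ^+ 2 + 1)) (divr_gt0 eps0 (ltr_wpDl (sqr_ge0 c) ltr01)).
exists (fun x => cst c x * phi x); first by apply: testM => //; exact: test_cst.
have ld := L2B lf (test_L2 tphi).
rewrite (eq_ip (f' := fun x => c * (f x - phi x)) _
               (g' := fun x => c * (f x - phi x))) => [|x|x]; last 2 first.
- by rewrite /cst; ring.
- by rewrite /cst; ring.
rewrite ipZl ?ipZr//; last exact: L2Z.
move: Hphi; rewrite ler_pdivlMr; last by have := sqr_ge0 c; lra.
by have := ip_ge0 mu (fun x => f x - phi x); rewrite expr2; lra.
Qed.

Lemma approximableD f g : approximable f -> approximable g ->
  approximable (fun x => f x + g x).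
Proof.
move=> [lf fa] [lg ga]; split; first exact: L2D.
move=> eps eps0; have e4 : 0 < eps / 4 by lra.
have [phi tphi Hphi] := fa _ e4; have [psi tpsi Hpsi] := ga _ e4.
exists (fun x => phi x + psi x); first exact: testD.
have lu := L2B lf (test_L2 tphi); have lv := L2B lg (test_L2 tpsi).
rewrite (eq_ip (f' := fun x => (f x - phi x) + (g x - psi x)) _
               (g' := fun x => (f x - phi x) + (g x - psi x))) => [|x|x]; last 2 first.
- by ring.
- by ring.
have := ip_ge0 mu (fun x => (f x - phi x) - (g x - psi x)).
by rewrite (ip_sqrB lu lv) (ip_sqrD lu lv); lra.
Qed.

Lemma approximable_test phi : test_function phi -> approximable phi.
Proof.
move=> tphi; split; first exact: test_L2.
move=> eps eps0; exists phi => //.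
rewrite (eq_ip (f' := cst 0) _ (g' := cst 0)) => [|x|x]; rewrite ?subrr//.
by rewrite /ip /cst mulr0 (Rintegral_cst _ measurableT) mul0r ltW.
Qed.

Lemma approximable0 : approximable (cst 0).
Proof.
apply: approximable_test; apply/test_functionP; split; first exact: test_cst.
by exists 0.
Qed.

Definition obox (a b : 'rV[R]_N) : set 'rV[R]_N :=
  [set x | forall i, x ord0 i \in `]a ord0 i, b ord0 i[].

Lemma measurable_obox a b : measurable (obox a b).
Proof.
apply: (@measurable_box _ _ (fun i => `]a ord0 i, b ord0 i[%classic)) => i.
exact: measurable_itv.
Qed.

Lemma obox_bounded a b x : `|a| + `|b| < `|x| -> ~ obox a b x.
Proof.
move=> xab H; suff : `|x| <= `|a| + `|b| by rewrite leNgt xab.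
apply: norm_rV_le => [|i]; first by rewrite addr_ge0.
have := H i; have := coord_le_norm a i; have := coord_le_norm b i.
by rewrite in_itv/= !ler_norml; lra.
Qed.

Lemma L2_indic_obox a b A : measurable A -> L2 mu (\1_(A `&` obox a b) : _ -> R).
Proof.
move=> mA; have mAB : measurable (A `&` obox a b).
  by apply: measurableI => //; exact: measurable_obox.
have [] // := @L2_bounded_support (\1_(A `&` obox a b)) 1 (`|a| + `|b|).
- by move=> x; rewrite indicE; case: (_ \in _); rewrite ?normr1 ?normr0.
- move=> x /obox_bounded xab; rewrite indicE memNset// => -[_]; exact: xab.
Qed.

Lemma flat0_cvg1 (t : R) : 0 < t -> flat 0 (n.+1%:R * t) @[n --> \oo] --> (1 : R).
Proof.
move=> t0.
rewrite (_ : (fun n => _) = fun n => expR (- (t^-1 * (n.+1%:R)^-1))); last first.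
  by apply/funext => n; rewrite /flat pmulr_rgt0// t0 expr0 mul1r invfM mulrC.
rewrite -[X in _ --> X]expR0; apply: continuous_cvg; first exact: continuous_expR.
rewrite -[X in _ --> X]oppr0; apply: cvgN.
by rewrite -[X in _ --> X](mulr0 t^-1); apply: cvgMr; exact: cvg_harmonic.
Qed.

Lemma cvg_prod (s : seq 'I_N) (F : nat -> 'I_N -> R) :
  (forall i, F n i @[n --> \oo] --> (1 : R)) ->
  \prod_(i <- s) F n i @[n --> \oo] --> (1 : R).
Proof.
move=> F1; elim: s => [|i s IH].
  rewrite (_ : (fun n => _) = cst 1); first exact: cvg_cst.
  by apply/funext => n; rewrite big_nil.
rewrite (_ : (fun n => _) = fun n => F n i * \prod_(j <- s) F n j).
  by rewrite -[X in _ --> X](mulr1 1); exact: cvgM.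
by apply/funext => n; rewrite big_cons.
Qed.

(** The steeper the sides of a bump, the closer it is to the indicator of the
    box that supports it. *)
Lemma approximable_obox a b : approximable (\1_(obox a b)).
Proof.
have lI : L2 mu (\1_(obox a b) : _ -> R).
  by have := L2_indic_obox a b measurableT; rewrite setTI.
apply: (@approximable_dct (fun n => bump a b n.+1%:R) _ (\1_(obox a b))) => //.
- by move=> n; apply: approximable_test; exact: bump_test.
- move=> x; rewrite indicE; have [/set_mem xab|/negP xab] := boolP (x \in obox a b).
    apply: cvg_prod => i; rewrite -[X in _ --> X](mulr1 1).
    have := xab i; rewrite in_itv/= => /andP[ax xb].
    apply: cvgM.
      rewrite (_ : (fun n => _) = fun n => flat 0 (n.+1%:R * (x ord0 i - a ord0 i))).
        by apply: flat0_cvg1; rewrite subr_gt0.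
      by apply/funext => n; rewrite mulrBr.
    rewrite (_ : (fun n => _) = fun n => flat 0 (n.+1%:R * (b ord0 i - x ord0 i))).
      by apply: flat0_cvg1; rewrite subr_gt0.
    by apply/funext => n; congr flat; ring.
  have [|i xi] := @box_out _ _ a b x.
    by move=> H; apply: xab; apply/mem_set => i; rewrite in_itv/=; exact: H.
  rewrite (_ : (fun n => _) = cst 0); first exact: cvg_cst.
  by apply/funext => n; exact: bump_out xi.
- move=> n x; rewrite indicE; have [xab|/negP xab] := boolP (x \in obox a b).
    rewrite ler_norml; have := bump_ge0 a b n.+1%:R x; have := bump_le1 a b n.+1%:R x.
    by rewrite /=; lra.
  have [|i xi] := @box_out _ _ a b x.
    by move=> H; apply: xab; apply/mem_set => i; rewrite in_itv/=; exact: H.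
  by rewrite (bump_out _ xi)// subr0 normr0.
Qed.

Let boxes : set (set 'rV[R]_N) := [set A | exists a b, A = obox a b].

Lemma oboxI a b a' b' : obox a b `&` obox a' b' =
  obox (\row_i Num.max (a ord0 i) (a' ord0 i)) (\row_i Num.min (b ord0 i) (b' ord0 i)).
Proof.
apply/seteqP; split => x /=.
  move=> [xab xab'] i; have := xab i; have := xab' i.
  by rewrite !in_itv/= !mxE gt_max lt_min; lra.
move=> H; split => i; have := H i; rewrite !in_itv/= !mxE gt_max lt_min; lra.
Qed.

Lemma obox_cover x : exists n, forall m, (n <= m)%N -> obox (const_mx (- m%:R)) (const_mx m%:R) x.
Proof.
have [n nx] : exists n : nat, `|x| < n%:R.
  by exists (Num.bound `|x|); exact: archi_boundP.
exists n => m nm i; rewrite !mxE in_itv/= -ltr_norml.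
apply: le_lt_trans (coord_le_norm x i) _; apply: lt_le_trans nx _.
by rewrite ler_nat.
Qed.

(** A slab in one coordinate is a countable union of boxes, and slabs generate
    the sigma-algebra. *)
Lemma measurable_sigma_boxes : (measurable : set (set 'rV[R]_N)) `<=` <<s boxes >>.
Proof.
apply: smallest_sub; first exact: smallest_sigma_algebra.
rewrite -bigcup_seq => B [/= i _] [C mC <-]; rewrite setTI.
have sA : sigma_algebra setT (<<s boxes >> : set (set 'rV[R]_N)) by exact: smallest_sigma_algebra.
have [sA0 sAC sAU] := sA.
have H : (measurable : set (set (measurableTypeR R))) `<=`
    [set D | <<s boxes >> ((fun x : 'rV[R]_N => x ord0 i) @^-1` D)].
  rewrite RGenOpens.measurableE; apply: smallest_sub.
    split => /= [|D mD|F mF].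
    - by rewrite preimage_set0.
    - have := sAC _ mD; rewrite !setTD preimage_setC; exact.
    - by rewrite preimage_bigcup; exact: sAU.
  move=> _ [u [v ->]] /=.
  rewrite (_ : _ @^-1` _ = \bigcup_n obox
     (\row_j if j == i then u else - n%:R) (\row_j if j == i then v else n%:R)).
    by apply: sAU => n; apply: sub_sigma_algebra; eexists; eexists; reflexivity.
  apply/seteqP; split => x /=.
    have [n /(_ n (leqnn n)) xn] := obox_cover x.
    move=> xi; exists n => // j; rewrite !mxE; case: eqP => [->//|_].
    by have := xn j; rewrite !mxE.
  by move=> [n _ /(_ i)]; rewrite !mxE eqxx.
exact: H.
Qed.

(** Monotone class argument: the open boxes form a pi-system, and dominated
    convergence handles increasing unions because of the fixed bounded box. *)
Lemma approximable_indic A m : measurable A ->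
  approximable (\1_(A `&` obox (const_mx (- m%:R)) (const_mx m%:R))).
Proof.
move=> mA; set K := obox _ _.
pose H : set (set 'rV[R]_N) := [set A | measurable A /\ approximable (\1_(A `&` K))].
suff : H A by case.
have mK : measurable K by exact: measurable_obox.
have sH : <<s boxes >> `<=` H.
  apply: lambda_system_subset => //.
  - by move=> _ _ [a [b ->]] [a' [b' ->]]; rewrite oboxI; eexists; eexists; reflexivity.
  - split => //.
    + by split; [exact: measurableT|rewrite setTI; exact: approximable_obox].
    + move=> B C CB [mB aB] [mC aC]; split; first exact: measurableD.
      rewrite (_ : \1_(_) = fun x => \1_(B `&` K) x + -1 * \1_(C `&` K) x).
        by apply: approximableD => //; exact: approximableZ.
      have -> : (B `\` C) `&` K = (B `&` K) `&` ~` C by rewrite setDE setIAC.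
      have CBK : C `&` K `<=` B `&` K by exact: setSI.
      apply/funext => x; rewrite !indicE.
      have [xC|xC] := pselect (C x).
        rewrite (@memNset _ (_ `&` ~` C)); last by case.
        have [xK|xK] := pselect (K x).
          have CKx : (C `&` K) x by split.
          by rewrite (mem_set CKx) (mem_set (CBK _ CKx)) mulr1 subrr.
        by rewrite !memNset ?mulr0 ?addr0//; case.
      rewrite (@memNset _ (C `&` K)) ?mulr0 ?addr0; last by case.
      by congr (_%:R); congr nat_of_bool; apply: asbool_equiv_eq; split => [[]|].
    + move=> F ndF HF; have mU : measurable (\bigcup_i F i).
        by apply: bigcupT_measurable => i; case: (HF i).
      split => //.
      apply: (@approximable_dct (fun n => \1_(F n `&` K)) _ (\1_K)).
      * by move=> n; case: (HF n).
      * move=> x; have [[n _ Fnx]|xF] := pselect ((\bigcup_i F i) x).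
          apply: cvg_near_cst; exists n => // k /= nk.
          have Fkx : F k x by have /subsetPset := ndF _ _ nk; exact.
          have UFx : (\bigcup_i F i) x by exists n.
          by rewrite !indicE !in_setI (mem_set Fkx) (mem_set UFx).
        apply: cvg_near_cst; apply: nearW => k.
        have Fkx : ~ F k x by move=> Fkx; apply: xF; exists k.
        by rewrite !indicE !in_setI (memNset Fkx) (memNset xF).
      * exact: L2_indic_obox.
      * by have := L2_indic_obox (const_mx (- m%:R)) (const_mx m%:R) measurableT; rewrite setTI.
      * move=> n x; rewrite !indicE !in_setI; case: (x \in K); rewrite ?andbT ?andbF ?subrr ?normr0//.
        by case: (_ \in _); case: (_ \in _); rewrite /= ?subrr ?subr0 ?sub0r ?normrN ?normr1 ?normr0.
  - move=> _ [a [b ->]]; split; first exact: measurable_obox.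
    by rewrite oboxI; exact: approximable_obox.
by apply: sH; exact: (measurable_sigma_boxes mA).
Qed.

Import HBNNSimple.

Lemma approximable_ge0 f : L2 mu f -> (forall x, 0 <= f x) -> approximable f.
Proof.
move=> lf f0; have mf : measurable_fun setT (EFin \o f) by apply/measurable_EFinP; case: lf.
pose K n := obox (const_mx (- n%:R)) (const_mx n%:R).
pose g := nnsfun_approx measurableT mf.
have gcv x : g n x @[n --> \oo] --> f x.
  have := @cvg_nnsfun_approx _ _ _ setT measurableT _ mf (fun x _ => f0 x) x I.
  by move=> /fine_cvg; exact.
have gle n x : g n x <= f x.
  rewrite -(cvg_lim (@Rhausdorff R) (gcv x)); apply: nondecreasing_cvgn_le.
    by move=> k l kl; have /lefP := @nd_nnsfun_approx _ _ _ setT measurableT _ mf _ _ kl; exact.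
  by apply/cvg_ex; exists (f x); exact: gcv.
have labs : L2 mu (fun x => `|f x|).
  apply: (le_L2 _ _ lf); first by apply: measurableT_comp => //; case: lf.
  by move=> x; rewrite normr_id.
apply: (@approximable_dct (fun n x => g n x * \1_(K n) x) _ (fun x => `|f x|)) => //.
- move=> n.
  rewrite (_ : (fun x => _) = fun x => \sum_(y <- finmap.enum_fset (fset_set (range (g n))))
      y * \1_(g n @^-1` [set y] `&` K n) x); last first.
    apply/funext => x; rewrite [in LHS]fimfunE fsbig_finite//=.
    rewrite big_distrl/=; apply: eq_bigr => y _.
    by rewrite -mulrA !indicE in_setI -natrM mulnb.
  elim: (finmap.enum_fset _) => [|y s IH].
    rewrite (_ : (fun x => _) = cst 0); first exact: approximable0.
    by apply/funext => x; rewrite big_nil.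
  rewrite (_ : (fun x => _) = fun x => y * \1_(g n @^-1` [set y] `&` K n) x +
     \sum_(y <- s) y * \1_(g n @^-1` [set y] `&` K n) x).
    apply: approximableD => //; apply: approximableZ; apply: approximable_indic.
    exact: measurable_sfunP.
  by apply/funext => x; rewrite big_cons.
- move=> x; rewrite -[X in _ --> X]mulr1; apply: cvgM; first exact: gcv.
  have [n xn] := obox_cover x; apply: cvg_near_cst; exists n => // k /= /xn xk.
  by rewrite indicE mem_set.
- move=> n x; rewrite (ger0_norm (f0 x)) ler_norml.
  have := gle n x; have : 0 <= g n x by []. have := f0 x.
  rewrite indicE; case: (_ \in _); rewrite ?mulr1 ?mulr0; lra.
Qed.

(** The positive and negative parts are limits of simple functions cut off
    outside large boxes, and these are combinations of indicators of bounded
    measurable sets. *)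
Lemma test_dense f : L2 mu f -> approximable f.
Proof.
move=> lf; have mf := L2_meas lf.
have lp : L2 mu (fun x => Num.max (f x) 0).
  apply: (le_L2 _ _ lf); first exact: measurable_maxr.
  by move=> x; have [h|h] := leP 0 (f x); rewrite ?normr0.
have ln : L2 mu (fun x => Num.max (- f x) 0).
  apply: (le_L2 _ _ lf); first by apply: measurable_maxr => //; exact: measurableT_comp.
  by move=> x; have [h|h] := leP 0 (- f x); rewrite ?normr0 ?normrN.
rewrite (_ : f = fun x => Num.max (f x) 0 + -1 * Num.max (- f x) 0).
  apply: approximableD; last apply: approximableZ; apply: approximable_ge0 => // x.
    by rewrite le_max lexx orbT.
  by rewrite le_max lexx orbT.
by apply/funext => x; have [h|h] := leP 0 (f x); have [h'|h'] := leP 0 (- f x); lra.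
Qed.

(** The fundamental lemma of the calculus of variations: by density, such an
    [f] is orthogonal to itself. *)
Lemma test_separates f : L2 mu f ->
  (forall phi, test_function phi -> ip mu f phi = 0) -> {ae mu, forall x, f x = 0}.
Proof.
move=> lf f0; apply: ip_eq0 => //.
apply/eqP; rewrite eq_le ip_ge0 andbT leNgt; apply/negP => ff0.
have [_ /(_ (ip mu f f / 2))[|phi tphi]] := test_dense lf; first by lra.
rewrite ip_sqrB//; last exact: test_L2.
by rewrite (f0 _ tphi); have := ip_ge0 mu phi; lra.
Qed.

End density.

(** * Difference quotients and weak derivatives *)

Lemma cvg_ext (R : realType) (f g : nat -> R) (l : R) :
  f =1 g -> f n @[n --> \oo] --> l -> g n @[n --> \oo] --> l.
Proof. by move=> /funext ->. Qed.

Section L2_norm.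
Context d (T : measurableType d) (R : realType).
Variable mu : {measure set T -> \bar R}.
Implicit Types f g h : T -> R.

Definition nrm f := Num.sqrt (ip mu f f).

Lemma nrm_ge0 f : 0 <= nrm f. Proof. exact: sqrtr_ge0. Qed.

Lemma nrm_sqr f : nrm f ^+ 2 = ip mu f f.
Proof. by rewrite sqr_sqrtr// ip_ge0. Qed.

Lemma eq_nrm f g : f =1 g -> nrm f = nrm g.
Proof. by move=> fg; rewrite /nrm (eq_ip mu fg fg). Qed.

Lemma nrmD f g : L2 mu f -> L2 mu g -> nrm (fun x => f x + g x) <= nrm f + nrm g.
Proof.
move=> lf lg; rewrite -(@ler_pXn2r _ 2)// ?nnegrE ?addr_ge0 ?nrm_ge0//.
rewrite nrm_sqr ip_sqrD// sqrrD !nrm_sqr.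
have := ip_bound lf lg; rewrite -/(nrm f) -/(nrm g) ler_norml => /andP[_ H].
by rewrite -mulr_natl; lra.
Qed.

Lemma ip_le f g : L2 mu g -> measurable_fun setT f ->
  (forall x, `|f x| <= `|g x|) -> ip mu f f <= ip mu g g.
Proof.
move=> lg mf fg; have lf := le_L2 mf fg lg.
apply: le_Rintegral => //; [exact: L2M|exact: L2M|].
move=> x _; rewrite -!expr2 -(real_normK (num_real (f x))) -(real_normK (num_real (g x))).
by rewrite lerXn2r ?nnegrE.
Qed.

Lemma cvg_ip (F : nat -> T -> R) f g : (forall n, L2 mu (F n)) -> L2 mu f -> L2 mu g ->
  ip mu (fun x => F n x - f x) (fun x => F n x - f x) @[n --> \oo] --> 0 ->
  ip mu (F n) g @[n --> \oo] --> ip mu f g.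
Proof.
move=> lF lf lg F0.
have H n : `|ip mu (F n) g - ip mu f g| <=
    nrm (fun x => F n x - f x) * nrm g.
  by rewrite -ipBl//; apply: ip_bound => //; exact: L2B.
apply/subr_cvg0; apply/norm_cvg0P; apply: (squeeze_cvgr (f := cst 0)
    (h := fun n => nrm (fun x => F n x - f x) * nrm g)).
- by near=> n; rewrite normr_ge0 H.
- exact: cvg_cst.
- rewrite -(mul0r (nrm g)); apply: cvgMl; rewrite -sqrtr0.
  by apply: continuous_cvg; [exact: sqrt_continuous|exact: F0].
Unshelve. all: by end_near. Qed.

Lemma cvg_ip2 (F G : nat -> T -> R) f g : (forall n, L2 mu (F n)) ->
  (forall n, L2 mu (G n)) -> L2 mu f -> L2 mu g ->
  ip mu (fun x => F n x - f x) (fun x => F n x - f x) @[n --> \oo] --> 0 ->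
  ip mu (fun x => G n x - g x) (fun x => G n x - g x) @[n --> \oo] --> 0 ->
  ip mu (F n) (G n) @[n --> \oo] --> ip mu f g.
Proof.
move=> lF lG lf lg F0 G0.
have c1 := cvg_ip lF lf lg F0.
have c2 := cvg_ip lG lg lf G0.
have c3 : ip mu (fun x => F n x - f x) (fun x => G n x - g x) @[n --> \oo] --> 0.
  apply/norm_cvg0P; apply: (squeeze_cvgr (f := cst 0)
    (h := fun n => nrm (fun x => F n x - f x) * nrm (fun x => G n x - g x))).
  - by near=> n; rewrite normr_ge0 ip_bound//; exact: L2B.
  - exact: cvg_cst.
  - rewrite -(mul0r (0 : R)) -sqrtr0; apply: cvgM.
    + by apply: continuous_cvg; [exact: sqrt_continuous|exact: F0].
    + by apply: continuous_cvg; [exact: sqrt_continuous|exact: G0].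
have c4 : ip mu (F n) g + ip mu (G n) f +
    (ip mu (fun x => F n x - f x) (fun x => G n x - g x) + - ip mu f g)
    @[n --> \oo] --> ip mu f g + ip mu g f + (0 + - ip mu f g).
  by apply: cvgD; [exact: cvgD|apply: cvgD => //; exact: cvg_cst].
rewrite (_ : _ + (0 - _) = ip mu f g) in c4; last by rewrite (ipC mu g f); ring.
apply: cvg_ext c4 => n.
have lFn := L2B (lF n) lf; have lGn := L2B (lG n) lg.
rewrite ipBl// !ipBr// (ipC mu (G n) f); ring.
Unshelve. all: by end_near. Qed.

End L2_norm.

Section difference_quotients.
Context {R : realType} {N : nat}.
Hypothesis N_gt0 : (0 < N)%N.
Local Notation mu := (@lebesgue_rV R N).
Local Notation e i := (delta_mx ord0 i : 'rV[R]_N).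
Implicit Types (f g u phi : 'rV[R]_N -> R) (x h : 'rV[R]_N) (i j : 'I_N).

Definition tr h f x := f (x + h).

Lemma measurable_tr h f : measurable_fun setT f -> measurable_fun setT (tr h f).
Proof. by move=> mf; exact: (measurableT_comp mf (measurable_translation h)). Qed.

Lemma Rintegral_tr h f : measurable_fun setT f ->
  \int[mu]_x tr h f x = \int[mu]_x f x.
Proof.
move=> mf; have mEf : measurable_fun setT (EFin \o f) by exact/measurable_EFinP.
have H1 := ge0_integral_translation h (measurable_funepos mEf) (funepos_ge0 _).
have H2 := ge0_integral_translation h (measurable_funeneg mEf) (funeneg_ge0 _).
rewrite /Rintegral; congr fine; rewrite integralE [RHS]integralE.
congr (_ - _)%E; [apply: etrans H1|apply: etrans H2];
  by apply: eq_integral => x _; rewrite ?funeposE ?funenegE.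
Qed.

Lemma rint_tr h f : rint mu f -> rint mu (tr h f).
Proof.
move=> fi; have mf := rint_meas fi.
have mn : measurable_fun setT (fun x => `|f x|%:E).
  by apply/measurable_EFinP; exact: measurableT_comp.
apply/integrableP; split; first by apply/measurable_EFinP; exact: measurable_tr.
have := @ge0_integral_translation R N (fun x => `|f x|%:E) h mn.
rewrite /tr /= => -> //; first by case/integrableP : fi.
Qed.

Lemma L2_tr h f : L2 mu f -> L2 mu (tr h f).
Proof.
move=> [mf fi]; split; first exact: measurable_tr.
exact: (@rint_tr h (fun x => f x ^+ 2)).
Qed.

Lemma ip_tr h f g : measurable_fun setT f -> measurable_fun setT g ->
  ip mu (tr h f) (tr h g) = ip mu f g.
Proof.
move=> mf mg; exact: (@Rintegral_tr h (fun x => f x * g x) (measurable_funM mf mg)).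
Qed.

Lemma trK h f : tr h (tr (- h) f) = f.
Proof. by apply/funext => x; rewrite /tr addrK. Qed.

Lemma test_tr h phi : test_function phi -> test_function (tr h phi).
Proof.
move=> tphi; rewrite (_ : tr h phi = fun x => phi (1 *: x + h)).
  by apply: test_comp => //; exact: oner_neq0.
by apply/funext => x; rewrite scale1r.
Qed.

Lemma partial_tr h phi i : smooth phi -> partial i (tr h phi) = tr h (partial i phi).
Proof.
move=> sphi; apply/funext => x.
have := @partial_affine R N phi 1 h i x (sphi [::] _).
rewrite mul1r scale1r /tr => <-; congr (partial i _ x).
by apply/funext => y; rewrite scale1r.
Qed.

Definition dq (s : R) i f x := (f (x + s *: e i) - f x) / s.

Lemma L2_dq s i f : L2 mu f -> L2 mu (dq s i f).
Proof.
move=> lf; have := L2Z s^-1 (L2B (L2_tr (s *: e i) lf) lf); congr L2.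
by apply/funext => x; rewrite mulrC.
Qed.

(** Discrete integration by parts, from the translation invariance of the
    measure. *)
Lemma dq_adj s i f g : L2 mu f -> L2 mu g ->
  ip mu (dq s i f) g = - ip mu f (dq (- s) i g).
Proof.
move=> lf lg; set h := s *: e i.
have lfh := L2_tr h lf; have lgh := L2_tr (- h) lg.
rewrite (@eq_ip _ _ _ mu (dq s i f) (fun x => s^-1 * (tr h f x - f x)) g g)//; last first.
  by move=> x; rewrite mulrC.
rewrite (@eq_ip _ _ _ mu f f (dq (- s) i g) (fun x => - (s^-1 * (tr (- h) g x - g x))))//; last first.
  by move=> x; rewrite /dq scaleNr invrN mulrN mulrC.
have l1 := L2B lfh lf; have l2 := L2B lgh lg.
rewrite ipZl// ipNr//; last exact: L2Z.
rewrite ipZr// opprK ipBl// ipBr//; congr (_ * (_ - _)).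
transitivity (ip mu (tr h f) (tr h (tr (- h) g))); first by rewrite trK.
exact: ip_tr (L2_meas lf) (L2_meas lgh).
Qed.

Lemma dq_cvg phi i x (s : nat -> R) : smooth phi -> (forall n, s n != 0) ->
  s n @[n --> \oo] --> 0 -> dq (s n) i phi x @[n --> \oo] --> partial i phi x.
Proof.
move=> sphi s0 scv.
have dphi : derivable phi x (e i) by apply: diff_derivable; exact: (sphi [::]).
have := dphi; rewrite /derivable => /cvg_ex[l lP].
have lE : partial i phi x = l by apply: cvg_lim.
rewrite lE; move/cvgr_dnbhsP : lP => /(_ s (conj s0 scv)) lP.
apply: cvg_ext lP => n /=.
by rewrite /dq /GRing.scale /= mulrC (addrC x).
Qed.

Lemma is_derive_line phi i x (t : R) : smooth phi ->
  is_derive t (1 : R) (fun s : R => phi (x + s *: e i)) (partial i phi (x + t *: e i)).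
Proof.
move=> sphi; apply: is_derive_seq => s s0 scv.
have := @dq_cvg phi i (x + t *: e i) s sphi s0 scv.
by apply: cvg_ext => n; rewrite /dq scalerDl addrA.
Qed.

Lemma dq_le phi i (M s : R) x : smooth phi -> (forall y, `|partial i phi y| <= M) ->
  s != 0 -> `|dq s i phi x| <= M.
Proof.
move=> sphi HM s0.
have := @lipschitz_of_derive R (fun s => phi (x + s *: e i)) _ M
  (fun t => is_derive_line i x t sphi) (fun t => HM _) 0 s.
by rewrite scale0r addr0 subr0 /dq normrM normfV ler_pdivrMr ?normr_gt0.
Qed.

Lemma norm_delta i : `|e i| <= 1.
Proof.
apply: norm_rV_le => // j; rewrite mxE eqxx/=.
by case: (j == i); rewrite ?normr1 ?normr0.
Qed.

(** The difference quotients of a test function are bounded by its derivative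
    and, for small steps, supported in a common ball. *)
Lemma ip_dq_test f phi i (s : nat -> R) : L2 mu f -> test_function phi ->
  (forall n, s n != 0) -> s n @[n --> \oo] --> 0 ->
  ip mu f (dq (s n) i phi) @[n --> \oo] --> ip mu f (partial i phi).
Proof.
move=> lf tphi s0 scv; have sphi := tphi.1.
have [M [K [M0 K0 HM HK]]] := test_bounded (test_partial i tphi).
have [M' [K' [M'0 K'0 HM' HK']]] := test_bounded tphi.
have [S S0 HS] : exists2 S : R, 0 <= S & forall n, `|s n| <= S.
  have /cvg_seq_bounded[A [_ HA]] : cvgn s by apply/cvg_ex; exists 0.
  have A1 : A < `|A| + 1 by rewrite (le_lt_trans (ler_norm A))// ltrDl.
  by exists (`|A| + 1) => [|n]; [rewrite addr_ge0|exact: (HA _ A1)].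
have lchi : L2 mu (ballI (K' + S)) by case: (@L2_rint_ballI R N (K' + S)).
have H n x : `|dq (s n) i phi x| <= M * ballI (K' + S) x.
  have [xK|xK] := leP `|x| (K' + S); first by rewrite (ballI_in xK) mulr1; exact: dq_le.
  rewrite (ballI_out xK) mulr0 /dq !HK' ?subrr ?mul0r ?normr0//.
    by apply: le_lt_trans xK; rewrite lerDl.
  have : `|x| <= `|x + s n *: e i| + `|s n *: e i|.
    by rewrite -{1}(addrK (s n *: e i) x) (le_trans (ler_normB _ _)).
  have : `|s n *: e i| <= S.
    rewrite normrZ; apply: le_trans (HS n); rewrite -[leRHS]mulr1.
    by apply: ler_wpM2l => //; exact: norm_delta.
  by move: xK; lra.
have [||||_] // := @Rdct _ _ _ mu (fun n x => f x * dq (s n) i phi x)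
   (fun x => f x * partial i phi x) (fun x => `|f x| * (M * ballI (K' + S) x)).
- move=> n; apply: measurable_funM; first exact: (L2_meas lf).
  exact: (L2_meas (L2_dq _ _ (test_L2 tphi))).
- by move=> x; apply: cvgMr; exact: dq_cvg.
- apply: L2M; last exact: L2Z.
  apply: (le_L2 _ _ lf); first by apply: measurableT_comp => //; exact: (L2_meas lf).
  by move=> x; rewrite normr_id.
- by move=> n x; rewrite normrM ler_wpM2l.
Qed.

Lemma ip_dq_weak f phi i (s : nat -> R) : L2 mu f -> test_function phi ->
  (forall n, s n != 0) -> s n @[n --> \oo] --> 0 ->
  ip mu (dq (s n) i f) phi @[n --> \oo] --> - ip mu f (partial i phi).
Proof.
move=> lf tphi s0 scv.
rewrite (_ : (fun n => _) = fun n => - ip mu f (dq (- s n) i phi)); last first.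
  by apply/funext => n; apply: dq_adj => //; exact: test_L2.
apply: cvgN; apply: ip_dq_test => //; first by move=> n; rewrite oppr_eq0.
by rewrite -oppr0; exact: cvgN.
Qed.

Lemma weak_partialP i u g : weak_partial i u g <->
  forall phi, test_function phi -> ip mu u (partial i phi) = - ip mu g phi.
Proof. by []. Qed.

Lemma weak_partial_unique i u g g' : L2 mu g -> L2 mu g' ->
  weak_partial i u g -> weak_partial i u g' -> {ae mu, forall x, g x = g' x}.
Proof.
move=> lg lg' /weak_partialP wg /weak_partialP wg'.
have : {ae mu, forall x, g x - g' x = 0}.
  apply: (@test_separates R N N_gt0 _ (L2B lg lg')) => phi tphi.
  have lphi := test_L2 tphi.
  by rewrite ipBl// -[ip mu g phi]opprK -wg// wg'// opprK subrr.
by apply: filterS => x /eqP; rewrite subr_eq0 => /eqP.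
Qed.

(** The norm in [L^2] is a dual norm, which a dense subspace determines. *)
Lemma nrm_of_test (q : 'rV[R]_N -> R) (C : R) : L2 mu q -> 0 <= C ->
  (forall phi, test_function phi -> `|ip mu q phi| <= C * nrm mu phi) ->
  ip mu q q <= C ^+ 2.
Proof.
move=> lq C0 H; set a := nrm mu q; have a0 : 0 <= a := nrm_ge0 _ _.
suff : a <= C by rewrite -nrm_sqr -/a; move=> aC; rewrite lerXn2r.
rewrite leNgt; apply/negP => Ca.
pose eps := a * (a - C) / (2 * (C + a + 1)).
have eps0 : 0 < eps.
  have ap : 0 < a by exact: le_lt_trans Ca.
  by rewrite divr_gt0 ?mulr_gt0 ?subr_gt0//; lra.
have [_ /(_ (eps ^+ 2) (exprn_gt0 2 eps0))[phi tphi Hphi]] := test_dense N_gt0 lq.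
have lphi := test_L2 tphi; have ld := L2B lq lphi.
have nd : nrm mu (fun x => q x - phi x) <= eps.
  by rewrite -(@ler_pXn2r _ 2)// ?nnegrE ?nrm_ge0 ?(ltW eps0)// nrm_sqr.
have h1 : ip mu q q = ip mu q phi + ip mu q (fun x => q x - phi x).
  by rewrite ipBr//; lra.
have h2 : `|ip mu q phi| <= C * (a + eps).
  apply: le_trans (H _ tphi) _; apply: ler_wpM2l => //.
  rewrite (@eq_nrm _ _ _ mu phi (fun x => q x + - (q x - phi x))); last by move=> x; ring.
  apply: le_trans (nrmD lq (L2N ld)) _; rewrite lerD2l.
  by rewrite /nrm ipNl ?ipNr ?opprK//; exact: L2N.
have h3 : `|ip mu q (fun x => q x - phi x)| <= a * eps.
  by apply: le_trans (ip_bound lq ld) _; apply: ler_wpM2l.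
have h4 : a ^+ 2 <= C * (a + eps) + a * eps.
  rewrite nrm_sqr h1; apply: lerD.
    exact: le_trans (ler_norm _) h2.
  exact: le_trans (ler_norm _) h3.
have h5 : eps * (2 * (C + a + 1)) = a * (a - C).
  by rewrite /eps divfK//; apply: lt0r_neq0; lra.
nra.
Qed.

(** The difference quotients of a Sobolev function are bounded by its weak
    derivative: differentiate the correlation with a test function along the
    line, where the weak derivative appears. *)
Lemma dq_bound i u g s : L2 mu u -> L2 mu g -> weak_partial i u g -> s != 0 ->
  ip mu (dq s i u) (dq s i u) <= ip mu g g.
Proof.
move=> lu lg /weak_partialP wg s0; rewrite -(nrm_sqr mu g).
apply: nrm_of_test; [exact: L2_dq|exact: nrm_ge0|] => phi tphi.
have lphi := test_L2 tphi; have sphi := tphi.1.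
pose z (t : R) := ip mu u (tr (- t *: e i) phi).
pose dz (t : R) := ip mu g (tr (- t *: e i) phi).
have zd t : is_derive t (1 : R) z (dz t).
  apply: is_derive_seq => r r0 rcv.
  have := @ip_dq_test u (tr (- t *: e i) phi) i (fun n => - r n) lu (test_tr _ tphi).
  have -> : ip mu u (partial i (tr (- t *: e i) phi)) = - dz t.
    by rewrite wg//; exact: test_tr.
  move=> H; have {}H : - ip mu u (dq (- r n) i (tr (- t *: e i) phi)) @[n --> \oo] --> dz t.
    rewrite -[X in _ --> X]opprK; apply: cvgN; apply: H.
      by move=> n; rewrite oppr_eq0.
    by rewrite -oppr0; exact: cvgN.
  apply: cvg_ext H => n; rewrite /z.
  have lt := test_L2 (test_tr (- t *: e i) tphi).
  have ltr := test_L2 (test_tr (- (t + r n) *: e i) tphi).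
  rewrite -ipBr// mulrC -ipZr//; last exact: L2B.
  rewrite -ipNr//; last exact: L2_dq.
  apply: eq_ip => // x; rewrite /dq /tr invrN mulrN opprK mulrC.
  by rewrite -addrA -scalerDl -opprD (addrC (r n)).
have dzM t : `|dz t| <= nrm mu g * nrm mu phi.
  have ltphi := test_L2 (test_tr (- t *: e i) tphi).
  apply: le_trans (ip_bound lg ltphi) _.
  by rewrite /nrm (ip_tr _ (L2_meas lphi) (L2_meas lphi)).
have := lipschitz_of_derive zd dzM 0 s.
rewrite subr0 -ler_pdivrMr ?normr_gt0// -normfV -normrM => H.
rewrite dq_adj// (_ : - _ = (z s - z 0) / s)//.
have lts := test_L2 (test_tr (- s *: e i) tphi).
rewrite /z oppr0 scale0r mulrC.
rewrite -[in RHS]ipBr//; last first.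
  by apply: test_L2; exact: test_tr.
rewrite -ipZr//; last by apply: L2B => //; apply: test_L2; exact: test_tr.
rewrite -ipNr//; last exact: L2_dq.
by apply: eq_ip => // x; rewrite /dq /tr invrN mulrN opprK mulrC addr0.
Qed.

(** Weak convergence and the previous bound on the norms imply strong
    convergence. *)
Lemma dq_cvg_weak_partial i u g (s : nat -> R) : L2 mu u -> L2 mu g ->
  weak_partial i u g -> (forall n, s n != 0) -> s n @[n --> \oo] --> 0 ->
  ip mu (fun x => dq (s n) i u x - g x) (fun x => dq (s n) i u x - g x)
    @[n --> \oo] --> 0.
Proof.
move=> lu lg wg s0 scv.
have lq n : L2 mu (dq (s n) i u) by exact: L2_dq.
have qb n := dq_bound lu lg wg (s0 n).
have qn n : nrm mu (dq (s n) i u) <= nrm mu g.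
  by rewrite /nrm ler_wsqrtr.
(* weak convergence, tested against the limit itself, by density *)
have weak : ip mu (dq (s n) i u) g @[n --> \oo] --> ip mu g g.
  apply/cvgrPdist_le => eps eps0.
  pose dl := eps / (2 * (2 * nrm mu g + 1)).
  have ng := nrm_ge0 mu g.
  have dl0 : 0 < dl by apply: divr_gt0 => //; lra.
  have [_ /(_ (dl ^+ 2) (exprn_gt0 2 dl0))[phi tphi Hphi]] := test_dense N_gt0 lg.
  have lphi := test_L2 tphi; have ld := L2B lg lphi.
  have nd : nrm mu (fun x => g x - phi x) <= dl.
    by rewrite -(@ler_pXn2r _ 2)// ?nnegrE ?nrm_ge0 ?(ltW dl0)// nrm_sqr.
  have := ip_dq_weak (i := i) lu tphi s0 scv.
  have -> : - ip mu u (partial i phi) = ip mu g phi.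
    by have /weak_partialP -> := wg; rewrite ?opprK.
  have e2 : 0 < eps / 2 by lra.
  move=> /cvgrPdist_le /(_ _ e2); apply: filterS => n Hn.
  have -> : ip mu g g - ip mu (dq (s n) i u) g =
     (ip mu g phi - ip mu (dq (s n) i u) phi) +
     (ip mu g (fun x => g x - phi x) - ip mu (dq (s n) i u) (fun x => g x - phi x)).
    by rewrite !ipBr//; ring.
  have h1 : `|ip mu g (fun x => g x - phi x)| <= nrm mu g * dl.
    by apply: le_trans (ip_bound lg ld) _; apply: ler_wpM2l.
  have h2 : `|ip mu (dq (s n) i u) (fun x => g x - phi x)| <= nrm mu g * dl.
    by apply: le_trans (ip_bound (lq n) ld) _; apply: ler_pM; [exact: nrm_ge0|exact: nrm_ge0|exact: qn|exact: nd].
  have h3 : dl * (2 * (2 * nrm mu g + 1)) = eps.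
    by rewrite /dl divfK//; apply: lt0r_neq0; lra.
  apply: le_trans (ler_normD _ _) _.
  have := ler_normB (ip mu g (fun x => g x - phi x)) (ip mu (dq (s n) i u) (fun x => g x - phi x)).
  by move: Hn h1 h2 => /=; lra.
apply: (squeeze_cvgr (f := cst 0) (h := fun n => 2 * (ip mu g g - ip mu (dq (s n) i u) g))).
- near=> n; rewrite ip_ge0/= ip_sqrB//.
  by have := qb n; lra.
- exact: cvg_cst.
- rewrite -[X in _ --> X](mulr0 2) -(subrr (ip mu g g)); apply: cvgMr.
  by apply: cvgB => //; exact: cvg_cst.
Unshelve. all: by end_near. Qed.

Local Notation pos t := (Num.max t 0).

Lemma pos_lip (a b : R) : `|pos a - pos b| <= `|a - b|.
Proof.
have [ha|ha] := leP 0 a; have [hb|hb] := leP 0 b; rewrite ?subrr ?normr0 ?subr0 ?sub0r ?normrN//.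
- by rewrite !ger0_norm//; lra.
- by rewrite distrC !ger0_norm//; lra.
Qed.

(** The one-sided derivative of [t |-> pos (u + t * g)] at 0, in the direction
    of the sign [sg]. *)
Let pos_dq (sg u g : R) := if 0 < u then g else if u < 0 then 0 else sg * pos (sg * g).

Let cvg_pos_dq (sg u g : R) (s : nat -> R) : `|sg| = 1 ->
  (forall n, 0 < s n) -> s n @[n --> \oo] --> 0 ->
  (pos (u + sg * s n * g) - pos u) / (sg * s n) @[n --> \oo] --> pos_dq sg u g.
Proof.
move=> sg1 s0 scv; have sgn0 : sg != 0 by rewrite -normr_eq0 sg1 oner_neq0.
have ucv : u + sg * s n * g @[n --> \oo] --> u.
  rewrite -[X in _ --> X]addr0; apply: cvgD; first exact: cvg_cst.
  rewrite -[X in _ --> X](mul0r g); apply: cvgMl.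
  by rewrite -[X in _ --> X](mulr0 sg); exact: cvgMr.
have ss n : sg * s n != 0 by rewrite mulf_neq0// lt0r_neq0.
rewrite /pos_dq; case: (ltgtP 0 u) => u0.
- apply: cvg_near_cst; near=> n.
  have h : 0 < u + sg * s n * g by near: n; exact: (cvgr_gt _ ucv).
  rewrite (max_l (ltW h)) addrAC subrr add0r mulrC mulKf//.
- apply: cvg_near_cst; near=> n.
  have h : u + sg * s n * g < 0 by near: n; exact: (cvgr_lt _ ucv).
  by rewrite (max_r (ltW h)) subrr mul0r.
- apply: cvg_near_cst; near=> n.
  rewrite -u0 add0r subr0 (mulrAC sg) -{1}(mul0r (s n)).
  rewrite -maxr_pMl ?ltW// invfM (mulrC sg^-1) mulrA mulfK ?lt0r_neq0// mulrC; congr (_ * _).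
  have : sg ^+ 2 = 1 by rewrite -(real_normK (num_real sg)) sg1 expr1n.
  by move=> sg2; apply: (mulfI sgn0); rewrite mulfV// -sg2 expr2.
Unshelve. all: by end_near. Qed.

Lemma measurable_pos u : measurable_fun setT u -> measurable_fun setT (fun x => pos (u x)).
Proof. by move=> mu_; exact: measurable_maxr. Qed.

Lemma L2_pos u : L2 mu u -> L2 mu (fun x => pos (u x)).
Proof.
move=> lu; apply: (le_L2 _ _ lu); first exact: measurable_pos (L2_meas lu).
by move=> x; have [h|h] := leP 0 (u x); rewrite ?normr0.
Qed.

(** The difference quotients of the positive part of [u] are as close to [Q n] as
    those of [u] are to [g], since the positive part is a contraction; and [Q n]
    has a pointwise limit. *)
Let weak_partial_pos_dq (sg : R) i u g : `|sg| = 1 -> L2 mu u -> L2 mu g ->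
  weak_partial i u g -> L2 mu (fun x => pos_dq sg (u x) (g x)) /\
  weak_partial i (fun x => pos (u x)) (fun x => pos_dq sg (u x) (g x)).
Proof.
move=> sg1 lu lg wg.
have mu_ := L2_meas lu; have mg := L2_meas lg.
have sgn0 : sg != 0 by rewrite -normr_eq0 sg1 oner_neq0.
pose s n : R := n.+1%:R^-1; pose r n := sg * s n.
have s0 n : 0 < s n by rewrite invr_gt0 ltr0n.
have scv : s n @[n --> \oo] --> 0 by exact: cvg_harmonic.
have r0 n : r n != 0 by rewrite mulf_neq0// lt0r_neq0.
have rcv : r n @[n --> \oo] --> 0.
  by rewrite -[X in _ --> X](mulr0 sg); exact: cvgMr.
pose Q n x := (pos (u x + r n * g x) - pos (u x)) / r n.
have mQ n : measurable_fun setT (Q n).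
  apply: measurable_funM => //; apply: measurable_funB; last exact: measurable_pos.
  by apply: measurable_pos; apply: measurable_funD => //; exact: measurable_funM.
have Qg n x : `|Q n x| <= `|g x|.
  rewrite /Q normrM normfV ler_pdivrMr ?normr_gt0//.
  by apply: le_trans (pos_lip _ _) _; rewrite addrAC subrr add0r normrM mulrC.
have Qcv x : Q n x @[n --> \oo] --> pos_dq sg (u x) (g x).
  exact: cvg_pos_dq.
have mL : measurable_fun setT (fun x => pos_dq sg (u x) (g x)).
  by apply: (@measurable_fun_cvg _ _ _ setT Q) => // x _; exact: Qcv.
have lL : L2 mu (fun x => pos_dq sg (u x) (g x)).
  apply: (le_L2 mL _ lg) => x; rewrite /pos_dq; case: ifP => // _; case: ifP => _; rewrite ?normr0//.
  rewrite normrM sg1 mul1r; apply: (@le_trans _ _ `|sg * g x|); last by rewrite normrM sg1 mul1r.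
  by have [h|h] := leP 0 (sg * g x); rewrite ?normr0.
split => //; apply/weak_partialP => phi tphi.
have lphi := test_L2 tphi; have lpu := L2_pos lu.
have lQ n : L2 mu (Q n) by exact: le_L2 (mQ n) (Qg n) lg.
have c1 : ip mu (Q n) phi @[n --> \oo] --> ip mu (fun x => pos_dq sg (u x) (g x)) phi.
  have [||||_] // := @Rdct _ _ _ mu (fun n x => Q n x * phi x)
      (fun x => pos_dq sg (u x) (g x) * phi x) (fun x => `|g x| * `|phi x|).
  - by move=> n; apply: measurable_funM => //; exact: L2_meas lphi.
  - by move=> x; apply: cvgMl; exact: Qcv.
  - have := integrable_norm (L2M lg lphi); congr (_.-integrable _ _).
    by apply/funext => x /=; rewrite normrM.
  - by move=> n x; rewrite normrM ler_wpM2r.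
have c2 := ip_dq_weak (i := i) lpu tphi r0 rcv.
have c3 : ip mu (dq (r n) i (fun x => pos (u x))) phi - ip mu (Q n) phi
    @[n --> \oo] --> 0.
  have qc := dq_cvg_weak_partial lu lg wg r0 rcv.
  apply/norm_cvg0P; apply: (squeeze_cvgr (f := cst 0)
    (h := fun n => nrm mu (fun x => dq (r n) i u x - g x) * nrm mu phi)).
  - near=> n; rewrite normr_ge0/=.
    have lqp := L2_dq (r n) i lpu; have lqu := L2_dq (r n) i lu.
    have lD := L2B lqp (lQ n); have lE := L2B lqu lg.
    rewrite -ipBl//; apply: le_trans (ip_bound lD lphi) _.
    apply: ler_wpM2r; first exact: nrm_ge0.
    rewrite ler_wsqrtr//; apply: ip_le => //; first exact: L2_meas lD.
    move=> x; rewrite /dq /Q -mulrBl opprB addrA subrK normrM normfV.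
    rewrite ler_pdivrMr ?normr_gt0// -normrM.
    apply: le_trans (pos_lip _ _) _.
    by rewrite mulrBl divfK// opprD addrA (mulrC (g x)).
  - exact: cvg_cst.
  - rewrite -(mul0r (nrm mu phi)); apply: cvgMl; rewrite -sqrtr0.
    by apply: continuous_cvg; [exact: sqrt_continuous|exact: qc].
have c4 : ip mu (dq (r n) i (fun x => pos (u x))) phi @[n --> \oo] -->
    ip mu (fun x => pos_dq sg (u x) (g x)) phi.
  rewrite -[X in _ --> X]add0r.
  have c5 : ip mu (dq (r n) i (fun x => pos (u x))) phi - ip mu (Q n) phi +
      ip mu (Q n) phi @[n --> \oo] --> 0 + ip mu (fun x => pos_dq sg (u x) (g x)) phi.
    exact: cvgD.
  by apply: cvg_ext c5 => n; exact: subrK.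
have := cvg_unique _ c4 c2; move=> /(_ _)/= ->; rewrite ?opprK//.
Unshelve. all: by end_near. Qed.

(** Comparing the right and the left difference quotients of the positive part
    shows that the weak derivative vanishes almost everywhere on [u = 0], so
    the value chosen there is immaterial. *)
Lemma weak_partial_pos i u g : L2 mu u -> L2 mu g -> weak_partial i u g ->
  let g' x := if 0 < u x then g x else 0 in
  L2 mu g' /\ weak_partial i (fun x => pos (u x)) g'.
Proof.
move=> lu lg wg g'; have n1 : `|1 : R| = 1 by rewrite normr1.
have nN1 : `|-1 : R| = 1 by rewrite normrN1.
have [l1 w1] := weak_partial_pos_dq n1 lu lg wg.
have [l2 w2] := weak_partial_pos_dq nN1 lu lg wg.
have ae := weak_partial_unique l1 l2 w1 w2.
have lg' : L2 mu g'.
  apply: (le_L2 _ _ lg); last by move=> x; rewrite /g'; case: ifP; rewrite ?normr0.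
  apply: measurable_fun_ifT; [|exact: L2_meas lg|exact: measurable_cst].
  by apply: measurable_fun_ltr; [exact: measurable_cst|exact: L2_meas lu].
split => //; apply/weak_partialP => phi tphi.
move/weak_partialP : w1 => ->//; congr (- _).
have mphi := L2_meas (test_L2 tphi).
apply: ae_Rintegral_eq; [exact: measurable_funM (L2_meas l1) mphi|exact: measurable_funM (L2_meas lg') mphi|].
apply: filterS ae => x; rewrite /pos_dq /g'; case: ifP => // _; case: ifP => // _.
rewrite !mul1r !mulN1r => H; congr (_ * _).
by move: H; have [h|h] := leP 0 (g x); have [h'|h'] := leP 0 (- g x); lra.
Qed.

End difference_quotients.

(** * The Sobolev space *)

Section sobolev_space.
Context {R : realType} {N : nat}.
Hypothesis N_gt0 : (0 < N)%N.
Local Notation mu := (@lebesgue_rV R N).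
Implicit Types (f g u v phi eta : 'rV[R]_N -> R) (x h : 'rV[R]_N) (i j : 'I_N).
Implicit Types (U V : 'I_N -> 'rV[R]_N -> R).

(** Unlike [wpartial], the gradient [U] is here at the choice of the user: it is
    explicit for positive parts, products and translates. *)
Definition sob u U := L2 mu u /\ forall i, L2 mu (U i) /\ weak_partial i u (U i).

Lemma H1_sob u : H1 u -> sob u (fun i => wpartial i u).
Proof.
move=> [/Lfun2P lu Hu]; split => // i.
have [g lg wg] := Hu i.
by have [/Lfun2P] := @xgetPex _ (cst 0) [set g | g \in Lfun mu 2%:E /\ weak_partial i u g]
  (ex_intro _ g (conj lg wg)).
Qed.

Lemma sob_H1 u U : sob u U -> H1 u.
Proof.
move=> [lu HU]; split; first exact/Lfun2P.
by move=> i; have [lU wU] := HU i; exists (U i) => //; exact/Lfun2P.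
Qed.

Lemma H1_L2 u : H1 u -> L2 mu u. Proof. by move=> /H1_sob[]. Qed.

Lemma H1_measurable u : H1 u -> measurable_fun setT u.
Proof. by move=> /H1_L2[]. Qed.

Lemma wpartial_ae u U i : sob u U -> {ae mu, forall x, wpartial i u x = U i x}.
Proof.
move=> su; have [_ HU] := su; have [_ HW] := H1_sob (sob_H1 su).
have [lU wU] := HU i; have [lW wW] := HW i.
exact: (weak_partial_unique N_gt0 lW lU wW wU).
Qed.

(** The inner product of [H^1]. *)
Definition dot u v := \int[mu]_x (grad_dot u v x + u x * v x).

Lemma dotE u v U V : sob u U -> sob v V ->
  dot u v = \sum_i ip mu (U i) (V i) + ip mu u v.
Proof.
move=> su sv; have [lu HU] := su; have [lv HV] := sv.
have [_ HU'] := H1_sob (sob_H1 su); have [_ HV'] := H1_sob (sob_H1 sv).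
have ig i : rint mu (fun x => wpartial i u x * wpartial i v x).
  by have [? _] := HU' i; have [? _] := HV' i; exact: L2M.
rewrite /dot /grad_dot RintegralD//; last 2 first.
- exact: rint_sum.
- exact: L2M.
rewrite Rintegral_sum//; congr (_ + _); apply: eq_bigr => i _.
have [lU _] := HU i; have [lV _] := HV i.
apply: ae_Rintegral_eq.
- exact: rint_meas (ig i).
- exact: rint_meas (L2M lU lV).
- have := wpartial_ae i su; have := wpartial_ae i sv.
  by apply: filterS2 => x -> ->.
Qed.

Lemma weak_partialZ i u g c : L2 mu u -> L2 mu g -> weak_partial i u g ->
  weak_partial i (fun x => c * u x) (fun x => c * g x).
Proof.
move=> lu lg /weak_partialP wg; apply/weak_partialP => phi tphi.
have lphi := test_L2 tphi; have lphi' := test_L2 (test_partial i tphi).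
by rewrite !ipZl// wg// mulrN.
Qed.

Lemma sobZ c u U : sob u U -> sob (fun x => c * u x) (fun i x => c * U i x).
Proof.
move=> [lu HU]; split; first exact: L2Z.
by move=> i; have [lU wU] := HU i; split; [exact: L2Z|exact: weak_partialZ].
Qed.

Lemma sobD u v U V : sob u U -> sob v V ->
  sob (fun x => u x + v x) (fun i x => U i x + V i x).
Proof.
move=> [lu HU] [lv HV]; split; first exact: L2D.
move=> i; have [lU /weak_partialP wU] := HU i; have [lV /weak_partialP wV] := HV i.
split; first exact: L2D.
apply/weak_partialP => phi tphi.
have lphi := test_L2 tphi; have lphi' := test_L2 (test_partial i tphi).
by rewrite !ipDl// wU// wV// opprD.
Qed.

Lemma eq_sob u u' U U' : u =1 u' -> (forall i, U i =1 U' i) -> sob u U -> sob u' U'.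
Proof.
move=> /funext -> E; rewrite (_ : U = U')//.
by apply/funext => i; exact/funext.
Qed.

Lemma sobB u v U V : sob u U -> sob v V ->
  sob (fun x => u x - v x) (fun i x => U i x - V i x).
Proof.
move=> su sv; have := sobD su (sobZ (-1) sv).
by apply: eq_sob => [x|i x]; rewrite mulN1r.
Qed.

Lemma sob_pos u U : sob u U ->
  sob (pos_part u) (fun i x => if 0 < u x then U i x else 0).
Proof.
move=> [lu HU]; split; first exact: L2_pos.
by move=> i; have [lU wU] := HU i; exact: weak_partial_pos.
Qed.

Lemma pos_neg_partE u x : neg_part u x = u x - pos_part u x.
Proof. by rewrite /neg_part /pos_part; case: (leP (u x) 0); lra. Qed.

Lemma sob_neg u U : sob u U ->
  sob (neg_part u) (fun i x => if 0 < u x then 0 else U i x).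
Proof.
move=> su; have := sobB su (sob_pos su).
apply: eq_sob => [x|i x]; first by rewrite pos_neg_partE.
by case: ifP; rewrite ?subrr ?subr0.
Qed.

(** Pass to the limit in the discrete integration by parts. *)
Lemma sob_test phi : test_function phi -> sob phi (fun i => partial i phi).
Proof.
move=> tphi; have lphi := test_L2 tphi; split => // i.
have tphi' := test_partial i tphi; split; first exact: test_L2.
apply/weak_partialP => psi tpsi; have lpsi := test_L2 tpsi.
pose s n : R := n.+1%:R^-1.
have s0 n : s n != 0 by rewrite invr_neq0.
have scv : s n @[n --> \oo] --> 0 by exact: cvg_harmonic.
have c1 := ip_dq_weak (i := i) lphi tpsi s0 scv.
have c2 := ip_dq_test (i := i) lpsi tphi s0 scv.
have c3 : ip mu (dq (s n) i phi) psi @[n --> \oo] --> ip mu psi (partial i phi).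
  by apply: cvg_ext c2 => n; rewrite ipC.
have := cvg_unique _ c1 c3; move=> /(_ _) H.
by rewrite -[LHS]opprK H// ipC.
Qed.

Lemma sob_mul eta u U : test_function eta -> sob u U ->
  sob (fun x => eta x * u x) (fun i x => eta x * U i x + partial i eta x * u x).
Proof.
move=> te [lu HU]; have se := te.1.
have bnd f v : test_function f -> L2 mu v -> L2 mu (fun x => f x * v x).
  move=> tf lv; have [M [K [_ _ HM _]]] := test_bounded tf.
  by apply: (@L2_bnd _ _ _ _ v f M) => //; exact: smooth_measurable tf.1.
split; first exact: bnd.
move=> i; have [lU /weak_partialP wU] := HU i.
have te' := test_partial i te.
have l1 := bnd _ _ te lU; have l2 := bnd _ _ te' lu.
split; first exact: L2D.
apply/weak_partialP => phi tphi.
have lphi := test_L2 tphi; have lphi' := test_L2 (test_partial i tphi).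
have tep := testM se tphi.
rewrite ipDl//.
have -> : ip mu (fun x => eta x * U i x) phi = ip mu (U i) (fun x => eta x * phi x).
  by apply: eq_Rintegral => x _; rewrite mulrCA mulrA.
rewrite opprD -wU//.
have -> : ip mu (fun x => partial i eta x * u x) phi = ip mu u (fun x => partial i eta x * phi x).
  by apply: eq_Rintegral => x _; rewrite mulrCA mulrA.
rewrite -ipBr//; last 2 first.
- exact: test_L2 (test_partial i tep).
- exact: bnd.
apply: eq_Rintegral => x _.
rewrite partialM; [ring|exact: (se [::])|exact: (tphi.1 [::])].
Qed.

Lemma sob_tr h u U : sob u U -> sob (tr h u) (fun i => tr h (U i)).
Proof.
move=> [lu HU]; split; first exact: L2_tr.
move=> i; have [lU /weak_partialP wU] := HU i; split; first exact: L2_tr.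
apply/weak_partialP => phi tphi.
have tp := test_tr (- h) tphi; have lp := test_L2 tp.
have adj v psi : L2 mu v -> L2 mu psi -> ip mu (tr h v) psi = ip mu v (tr (- h) psi).
  move=> lv lpsi; rewrite -[in LHS](trK h psi) ip_tr//; first exact: L2_meas lv.
  exact: L2_meas (L2_tr _ lpsi).
rewrite !adj//; [|exact: test_L2|exact: test_L2 (test_partial i tphi)].
by rewrite -partial_tr ?wU//; exact: tphi.1.
Qed.

Lemma H1Z c u : H1 u -> H1 (fun x => c * u x).
Proof. by move=> /H1_sob/(sobZ c)/sob_H1. Qed.

Lemma H1D u v : H1 u -> H1 v -> H1 (fun x => u x + v x).
Proof. by move=> /H1_sob su /H1_sob /(sobD su)/sob_H1. Qed.

Lemma H1B u v : H1 u -> H1 v -> H1 (fun x => u x - v x).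
Proof. by move=> /H1_sob su /H1_sob /(sobB su)/sob_H1. Qed.

Lemma H1_pos u : H1 u -> H1 (pos_part u).
Proof. by move=> /H1_sob/sob_pos/sob_H1. Qed.

Lemma H1_neg u : H1 u -> H1 (neg_part u).
Proof. by move=> /H1_sob/sob_neg/sob_H1. Qed.

Lemma H1_test phi : test_function phi -> H1 phi.
Proof. by move=> /sob_test/sob_H1. Qed.

Lemma H1_tr h u : H1 u -> H1 (tr h u).
Proof. by move=> /H1_sob/(sob_tr h)/sob_H1. Qed.

Lemma H1_mul eta u : test_function eta -> H1 u -> H1 (fun x => eta x * u x).
Proof. by move=> te /H1_sob/(sob_mul te)/sob_H1. Qed.

Lemma dotC u v : dot u v = dot v u.
Proof.
apply: eq_Rintegral => x _; rewrite /grad_dot (mulrC (u x)); congr (_ + _).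
by apply: eq_bigr => i _; rewrite mulrC.
Qed.

Lemma eq_dot u u' v v' : u =1 u' -> v =1 v' -> dot u v = dot u' v'.
Proof. by move=> /funext -> /funext ->. Qed.

Lemma dotDl u v w : H1 u -> H1 v -> H1 w ->
  dot (fun x => u x + v x) w = dot u w + dot v w.
Proof.
move=> /H1_sob su /H1_sob sv /H1_sob sw.
rewrite (dotE (sobD su sv) sw) (dotE su sw) (dotE sv sw).
have [lu HU] := su; have [lv HV] := sv; have [lw HW] := sw.
rewrite ipDl// addrACA -big_split/=; congr (_ + _); apply: eq_bigr => i _.
by rewrite ipDl//; [case: (HU i)|case: (HV i)|case: (HW i)].
Qed.

Lemma dotZl c u v : H1 u -> H1 v -> dot (fun x => c * u x) v = c * dot u v.
Proof.
move=> /H1_sob su /H1_sob sv; rewrite (dotE (sobZ c su) sv) (dotE su sv).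
have [lu HU] := su; have [lv HV] := sv.
rewrite ipZl// mulrDr mulr_sumr; congr (_ + _); apply: eq_bigr => i _.
by rewrite ipZl//; [case: (HU i)|case: (HV i)].
Qed.

Lemma dotBl u v w : H1 u -> H1 v -> H1 w ->
  dot (fun x => u x - v x) w = dot u w - dot v w.
Proof.
move=> hu hv hw; rewrite -mulN1r -dotZl// -dotDl//; last exact: H1Z.
by apply: eq_dot => // x; rewrite mulN1r.
Qed.

Lemma dotDr u v w : H1 u -> H1 v -> H1 w ->
  dot w (fun x => u x + v x) = dot w u + dot w v.
Proof. by move=> *; rewrite dotC dotDl// !(dotC w). Qed.

Lemma dotZr c u v : H1 u -> H1 v -> dot v (fun x => c * u x) = c * dot v u.
Proof. by move=> *; rewrite dotC dotZl// (dotC v). Qed.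

Lemma dotBr u v w : H1 u -> H1 v -> H1 w ->
  dot w (fun x => u x - v x) = dot w u - dot w v.
Proof. by move=> *; rewrite dotC dotBl// !(dotC w). Qed.

Lemma dot_sqrD u v : H1 u -> H1 v ->
  dot (fun x => u x + v x) (fun x => u x + v x) = dot u u + 2 * dot u v + dot v v.
Proof.
move=> hu hv; have huv := H1D hu hv.
by rewrite dotDl// !dotDr// (dotC v u); ring.
Qed.

Lemma dot_sqrB u v : H1 u -> H1 v ->
  dot (fun x => u x - v x) (fun x => u x - v x) = dot u u - 2 * dot u v + dot v v.
Proof.
move=> hu hv; have huv := H1B hu hv.
by rewrite dotBl// !dotBr// (dotC v u); ring.
Qed.

Lemma ip_le_dot u : H1 u -> ip mu u u <= dot u u.
Proof.
move=> /H1_sob su; rewrite (dotE su su) lerDr; apply: sumr_ge0 => i _.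
exact: ip_ge0.
Qed.

Lemma dot_ge0 u : H1 u -> 0 <= dot u u.
Proof. by move=> /ip_le_dot; apply: le_trans; exact: ip_ge0. Qed.

Lemma dot_gt0 u : H1 u -> ~ ae_zero u -> 0 < dot u u.
Proof.
move=> hu u0; rewrite lt_neqAle dot_ge0// andbT; apply/negP => /eqP u00.
apply: u0; apply: ip_eq0; first exact: H1_L2.
by apply/eqP; rewrite eq_le ip_ge0 andbT u00 ip_le_dot.
Qed.

Lemma dot_tr h u v : H1 u -> H1 v -> dot (tr h u) (tr h v) = dot u v.
Proof.
move=> /H1_sob su /H1_sob sv; rewrite (dotE (sob_tr h su) (sob_tr h sv)) (dotE su sv).
have [lu HU] := su; have [lv HV] := sv.
rewrite (ip_tr _ (L2_meas lu) (L2_meas lv)); congr (_ + _); apply: eq_bigr => i _.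
by have [lU _] := HU i; have [lV _] := HV i; rewrite (ip_tr _ (L2_meas lU) (L2_meas lV)).
Qed.

Lemma pos_negM u x : pos_part u x * neg_part u x = 0.
Proof. by rewrite /pos_part /neg_part; case: (leP (u x) 0); rewrite ?mul0r ?mulr0. Qed.

(** The gradient of the positive part vanishes almost everywhere off the set
    where the function is positive. *)
Lemma dot_pos_neg u : H1 u -> dot (pos_part u) (neg_part u) = 0.
Proof.
move=> /H1_sob su; rewrite (dotE (sob_pos su) (sob_neg su)).
have z f g : (forall x, f x * g x = 0) -> ip mu f g = 0.
  move=> fg; rewrite /ip (@eq_Rintegral _ _ _ mu setT (cst 0)); last by move=> x _; exact: fg.
  by rewrite (Rintegral_cst _ measurableT) mul0r.
rewrite z; last exact: pos_negM.
rewrite addr0 big1// => i _; rewrite z// => x.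
by case: ifP; rewrite ?mul0r ?mulr0.
Qed.

Lemma pos_add_neg u : u = fun x => pos_part u x + neg_part u x.
Proof. by apply/funext => x; rewrite pos_neg_partE addrC subrK. Qed.

Lemma dot_pos u : H1 u -> dot u (pos_part u) = dot (pos_part u) (pos_part u).
Proof.
move=> hu; have hp := H1_pos hu; have hn := H1_neg hu.
by rewrite {1}(pos_add_neg u) dotDl// (dotC (neg_part u)) dot_pos_neg// addr0.
Qed.

Lemma dot_neg u : H1 u -> dot u (neg_part u) = dot (neg_part u) (neg_part u).
Proof.
move=> hu; have hp := H1_pos hu; have hn := H1_neg hu.
by rewrite {1}(pos_add_neg u) dotDl// dot_pos_neg// add0r.
Qed.

Lemma H1_max a b : H1 a -> H1 b -> H1 (fun x => Num.max (a x) (b x)).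
Proof.
move=> ha hb; have := H1D hb (H1_pos (H1B ha hb)); congr H1; apply/funext => x.
by rewrite /pos_part; case: (leP (a x) (b x)); case: (leP (a x - b x) 0); lra.
Qed.

(** The maximum and the minimum are [b + d^+] and [a - d^+], where [d = a - b],
    and [d^+] is orthogonal to the other part of [d]. *)
Lemma dot_max_min a b : H1 a -> H1 b ->
  H1 (fun x => Num.min (a x) (b x)) /\
  dot (fun x => Num.max (a x) (b x)) (fun x => Num.max (a x) (b x)) +
  dot (fun x => Num.min (a x) (b x)) (fun x => Num.min (a x) (b x)) =
  dot a a + dot b b.
Proof.
move=> ha hb; pose d x := a x - b x.
have hd : H1 d := H1B ha hb; have hp := H1_pos hd; have hn := H1_neg hd.
have Emax : (fun x => Num.max (a x) (b x)) = fun x => b x + pos_part d x.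
  apply/funext => x; rewrite /pos_part /d.
  by case: (leP (a x) (b x)); case: (leP (a x - b x) 0); lra.
have Emin : (fun x => Num.min (a x) (b x)) = fun x => a x - pos_part d x.
  apply/funext => x; rewrite /pos_part /d.
  by case: (leP (a x) (b x)); case: (leP (a x - b x) 0); lra.
rewrite Emax Emin; split; first exact: H1B.
rewrite dot_sqrD// dot_sqrB//.
have := dot_pos hd; rewrite {1}/d dotBl//; lra.
Qed.

(** In the product rule the cross terms are absorbed by Young's inequality, so
    that cutting off costs little if the cut-off function varies slowly. *)
Lemma dot_cut eta (c : R) u : test_function eta -> 0 <= c -> H1 u ->
  (forall x, `|eta x| <= 1) -> (forall i x, `|partial i eta x| <= c) ->
  dot (fun x => eta x * u x) (fun x => eta x * u x) <=
  (1 + c + N%:R * (c + c ^+ 2)) * dot u u.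
Proof.
move=> te c0 hu eta1 etac; have su := H1_sob hu.
rewrite (dotE (sob_mul te su) (sob_mul te su)) (dotE su su).
have [lu HU] := su; have [leu HeU] := sob_mul te su.
have me := smooth_measurable te.1.
set A := \sum_i ip mu (wpartial i u) (wpartial i u).
set B := ip mu u u.
have A0 : 0 <= A by apply: sumr_ge0 => i _; exact: ip_ge0.
have B0 : 0 <= B by exact: ip_ge0.
have h1 : ip mu (fun x => eta x * u x) (fun x => eta x * u x) <= B.
  apply: ip_le => //; first exact: L2_meas leu.
  by move=> x; rewrite normrM ler_piMl.
have h2 : \sum_i ip mu (fun x => eta x * wpartial i u x + partial i eta x * u x)
    (fun x => eta x * wpartial i u x + partial i eta x * u x) <=
    \sum_i ((1 + c) * ip mu (wpartial i u) (wpartial i u) + (c + c ^+ 2) * B).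
  apply: ler_sum => i _; have [lU _] := HU i; have [leU _] := HeU i.
  rewrite -(RintegralZl _ measurableT (L2M lU lU)) -(RintegralZl _ measurableT (L2M lu lu)).
  rewrite -RintegralD//; [|exact: rintZ (L2M lU lU)|exact: rintZ (L2M lu lu)].
  apply: le_Rintegral => //; first exact: L2M.
    by apply: rintD; [exact: rintZ (L2M lU lU)|exact: rintZ (L2M lu lu)].
  move=> x _; set p := wpartial i u x; set q := u x.
  have : `|eta x * p + partial i eta x * q| <= `|p| + c * `|q|.
    apply: le_trans (ler_normD _ _) _; rewrite !normrM; apply: lerD.
      by rewrite ler_piMl.
    by rewrite ler_wpM2r.
  move=> H; have : `|eta x * p + partial i eta x * q| ^+ 2 <= (`|p| + c * `|q|) ^+ 2.
    by rewrite lerXn2r// nnegrE addr_ge0// mulr_ge0.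
  rewrite (real_normK (num_real _)).
  have pp := real_normK (num_real p); have qq := real_normK (num_real q).
  rewrite -!expr2 -pp -qq => /le_trans; apply.
  have : 0 <= c * (`|p| - `|q|) ^+ 2 by rewrite mulr_ge0// sqr_ge0.
  nra.
rewrite big_split/= -mulr_sumr sumr_const card_ord -mulr_natl -/A in h2.
have N0 : 0 <= N%:R :> R by exact: ler0n.
apply: le_trans (lerD h2 h1) _.
have c2 : 0 <= c ^+ 2 by exact: sqr_ge0.
have : 0 <= N%:R * (c + c ^+ 2) * A by rewrite !mulr_ge0// addr_ge0.
have : 0 <= c * B by rewrite mulr_ge0.
rewrite mulrA; lra.
Qed.

End sobolev_space.

(** * The Riesz kernel *)

Section singular_power.
Context {R : realType}.
Local Notation leb := (@lebesgue_measure R).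

Definition unit_power (b t : R) : R := if 0 < t <= 1 then t `^ (- b) else 0.

Lemma unit_power_ge0 b t : 0 <= unit_power b t.
Proof. by rewrite /unit_power; case: ifP => // _; exact: powR_ge0. Qed.

Lemma measurable_unit_power b : measurable_fun setT (unit_power b).
Proof.
apply: measurable_fun_ifT; last exact: measurable_cst.
  apply: measurable_and.
    by apply: measurable_fun_ltr; [exact: measurable_cst|exact: measurable_id].
  by apply: measurable_fun_ler; [exact: measurable_id|exact: measurable_cst].
exact: measurable_powR.
Qed.

(** The antiderivative of [t ^ (- b)] is bounded at the origin because [b < 1];
    the bound is uniform in [a]. *)
Lemma integral_power_le (b a : R) : 0 < b < 1 -> 0 < a < 1 ->
  (\int[leb]_(t in `[a, 1%R]) (t `^ (- b))%:E <= ((1 - b)^-1)%:E)%E.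
Proof.
move=> /andP[b0 b1] /andP[a0 a1].
have cb : 0 < 1 - b by rewrite subr_gt0.
pose F t : R := (1 - b)^-1 * t `^ (1 - b).
have dF (t : R) : 0 < t -> is_derive t (1 : R) F (t `^ (- b)).
  move=> t0; have dp := is_derive1_powR (1 - b) t0.
  have := @is_deriveZ R _ _ _ (1 - b)^-1 t 1 _ dp.
  rewrite /GRing.scale /= mulrA mulVf ?lt0r_neq0// mul1r.
  by rewrite (_ : 1 - b - 1 = - b)//; ring.
have cF (t : R) : 0 < t -> {for t, continuous F}.
  by move=> t0; apply/differentiable_continuous/derivable1_diffP; case: (dF t t0).
have cp (t : R) : 0 < t -> {for t, continuous (fun t : R => t `^ (- b))}.
  move=> t0; apply/differentiable_continuous/derivable1_diffP.
  by case: (is_derive1_powR (- b) t0).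
rewrite (@continuous_FTC2 R _ F)//.
- rewrite -EFinB lee_fin /F powR1 mulr1 gerBl.
  by rewrite mulr_ge0 ?powR_ge0// invr_ge0 ltW.
- apply: continuous_in_subspaceT => t; rewrite inE/= in_itv/= => /andP[at_ _].
  by apply: cp; exact: lt_le_trans at_.
- split.
  + move=> t; rewrite in_itv/= => /andP[at_ _].
    by case: (dF t (lt_trans a0 at_)).
  + by apply: cvg_at_right_filter; exact: cF.
  + by apply: cvg_at_left_filter; exact: cF.
- move=> t; rewrite in_itv/= => /andP[at_ _].
  by rewrite derive1E; case: (dF t (lt_trans a0 at_)).
Qed.

Lemma integral_unit_power_ltoo b : 0 < b < 1 ->
  (\int[leb]_t (unit_power b t)%:E < +oo)%E.
Proof.
move=> hb; pose I n := `[(n.+2%:R^-1 : R), 1]%classic.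
have mI n : measurable (I n) by exact: measurable_itv.
have EU : \bigcup_n I n = `]0, 1]%classic.
  apply/seteqP; split => t.
    by move=> [n _]; rewrite /I /= !in_itv/= => /andP[nt ->]; rewrite (lt_le_trans _ nt).
  rewrite /= in_itv/= => /andP[t0 t1].
  have [n nt] : exists n : nat, t^-1 < n%:R by exists (Num.bound t^-1); apply: archi_boundP; rewrite invr_ge0 ltW.
  exists n => //; rewrite /I/= in_itv/= t1 andbT.
  rewrite invf_ple ?posrE//; apply: (le_trans (ltW nt)).
  by rewrite ler_nat -addn2 leq_addr.
have nd : nondecreasing_seq I.
  move=> m n mn; apply/subsetPset => t; rewrite /I /= !in_itv/= => /andP[mt ->].
  rewrite andbT; apply: le_trans mt; rewrite lef_pV2 ?posrE// ler_nat.
  by rewrite !ltnS.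
have E : (\int[leb]_t (unit_power b t)%:E = \int[leb]_(t in `]0%R, 1%R]) (t `^ (- b))%:E)%E.
  rewrite [RHS]integral_mkcond; apply: eq_integral => t _.
  rewrite /unit_power patchE; case: ifPn => ht.
    by rewrite mem_set//= in_itv.
  by rewrite memNset//= in_itv/=; exact/negP.
rewrite E -EU.
have mp n : measurable_fun (I n) (fun t : R => (t `^ (- b))%:E).
  by apply/measurable_EFinP; apply: measurable_funTS; exact: measurable_powR.
have : (\int[leb]_(t in I n) (t `^ (- b))%:E @[n --> \oo] -->
    \int[leb]_(t in \bigcup_n I n) (t `^ (- b))%:E)%E.
  apply: ge0_nondecreasing_set_cvg_integral => //.
  by move=> i x _; rewrite lee_fin powR_ge0.
move=> /(cvg_lim (@ereal_hausdorff R)) <-.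
apply: (@le_lt_trans _ _ ((1 - b)^-1)%:E); last exact: ltry.
apply: lime_le.
  apply: ereal_nondecreasing_is_cvgn.
  apply: ge0_nondecreasing_set_nondecreasing_integral => //.
  by move=> i x _; rewrite lee_fin powR_ge0.
apply: nearW => n; apply: integral_power_le => //.
by rewrite invr_gt0 ltr0n/= invf_lt1 ?ltr1n.
Qed.

Lemma integral_reflection (f : R -> \bar R) : measurable_fun setT f ->
  (forall t, 0 <= f t)%E -> (\int[leb]_t f (- t)%R = \int[leb]_t f t)%E.
Proof.
move=> mf f0.
have mN : measurable_fun setT (-%R : measurableTypeR R -> measurableTypeR R).
  exact: oppr_measurable.
have := @ge0_integral_pushforward _ _ _ _ R _ mN leb setT f measurableT mf (fun x _ => f0 x).
rewrite preimage_setT => <-.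
by apply: eq_measure_integral => A mA _; exact: lebesgue_measureN.
Qed.

Lemma integral_unit_power2_ltoo b : 0 < b < 1 ->
  (\int[leb]_t (unit_power b t + unit_power b (- t))%:E < +oo)%E.
Proof.
move=> hb; have mu_ := measurable_unit_power b.
have mu2 : measurable_fun setT (fun t : R => unit_power b (- t)).
  by apply: (measurableT_comp mu_); exact: oppr_measurable.
under eq_integral do rewrite EFinD.
rewrite ge0_integralD//=; try exact/measurable_EFinP.
- rewrite (integral_reflection (f := fun t => (unit_power b t)%:E)).
  + by rewrite lte_add_pinfty// integral_unit_power_ltoo.
  + exact/measurable_EFinP.
  + by move=> t; rewrite lee_fin unit_power_ge0.
- by move=> t _; rewrite lee_fin unit_power_ge0.
- by move=> t _; rewrite lee_fin unit_power_ge0.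
Qed.

Lemma unit_power2_ge b t : t != 0 -> `|t| <= 1 ->
  `|t| `^ (- b) <= unit_power b t + unit_power b (- t).
Proof.
move=> t0 t1; rewrite /unit_power; case: (ltgtP 0 t) t0 => // ht _.
- by move: t1; rewrite gtr0_norm// => ->; rewrite oppr_gt0 ltNge (ltW ht)/= addr0.
- by move: t1; rewrite ltr0_norm// oppr_gt0 ht => ->/=; rewrite add0r.
Qed.

End singular_power.

Section euclidean_norm.
Context {R : realType} {N : nat}.
Implicit Types (x y h : 'rV[R]_N).

Lemma enorm_ge0 x : 0 <= enorm x. Proof. exact: sqrtr_ge0. Qed.

Lemma coord_le_enorm x i : `|x ord0 i| <= enorm x.
Proof.
rewrite /enorm -sqrtr_sqr ler_wsqrtr// (bigD1 i)//= lerDl.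
by apply: sumr_ge0 => j _; exact: sqr_ge0.
Qed.

Lemma norm_le_enorm x : `|x| <= enorm x.
Proof. by apply: norm_rV_le; [exact: enorm_ge0|exact: coord_le_enorm]. Qed.

Lemma enorm_le_norm x : enorm x <= N%:R * `|x|.
Proof.
rewrite -[leRHS]ger0_norm ?mulr_ge0// -sqrtr_sqr /enorm ler_wsqrtr//.
apply: (@le_trans _ _ (\sum_(i < N) `|x| ^+ 2)).
  apply: ler_sum => i _; rewrite -(real_normK (num_real _)) lerXn2r ?nnegrE//.
  exact: coord_le_norm.
rewrite sumr_const card_ord exprMn -[leLHS]mulr_natl.
apply: ler_wpM2r; first exact: sqr_ge0.
have sq m : (m <= m ^ 2)%N by case: m => // m; rewrite expnS expn1 leq_pmulr.
by rewrite -natrX ler_nat sq.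
Qed.

Lemma enormN x : enorm (- x) = enorm x.
Proof. by congr Num.sqrt; apply: eq_bigr => i _; rewrite mxE sqrrN. Qed.

Lemma measurable_enorm : measurable_fun setT (@enorm R N).
Proof.
apply: (measurableT_comp (f := @Num.sqrt R)).
  by apply: continuous_measurable_fun; exact: sqrt_continuous.
apply: measurable_sum => i; apply: measurable_funX; exact: measurable_coord.
Qed.

Lemma lebesgue_hyperplane n (i : 'I_n) (c : R) :
  @lebesgue_rV R n [set x | x ord0 i = c] = 0%E.
Proof.
have mH k (j : 'I_k) : measurable [set x : 'rV[R]_k | x ord0 j = c].
  by have := measurable_coord j measurableT (measurable_set1 c); rewrite setTI.
have mE k (E : set 'rV[R]_k) : measurable E ->
    (lebesgue_rV k E = \int[lebesgue_rV k]_x (\1_E x)%:E)%E.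
  by move=> mE; rewrite integral_indic// setIT.
elim: n i => [[]//|n IH i].
rewrite mE//; last exact: mH.
rewrite ge0_integral_rVS; last 2 first.
- by apply/measurable_EFinP; apply: measurable_indic; exact: mH.
- by move=> x; rewrite lee_fin.
case: (unliftP ord0 i) => [j ij|i0].
  apply: integral0_eq => t _.
  transitivity (\int[lebesgue_rV n]_y (\1_[set y : 'rV[R]_n | y ord0 j = c] y)%:E)%E.
    apply: eq_integral => y _; rewrite !indicE; congr (_%:R%:E); congr nat_of_bool.
    by apply: asbool_equiv_eq => /=; rewrite ij mxE liftK.
  by rewrite -mE ?IH//; exact: mH.
pose F (t : R) := (\int[lebesgue_rV n]_y
  (\1_[set x : 'rV[R]_n.+1 | x ord0 i = c] (rV_cons (t, y)))%:E)%E.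
transitivity (\int[@lebesgue_measure R]_(t in [set c]) F t)%E; last exact: integral_set1.
rewrite [RHS]integral_mkcond; apply: eq_integral => t _; rewrite patchE.
case: ifPn => // /negP tc; apply: integral0_eq => y _.
rewrite indicE memNset//= i0 mxE unlift_none/= => E; apply: tc.
by apply/mem_set.
Qed.

End euclidean_norm.

Section riesz_kernel.
Context {R : realType} {N : nat}.
Hypothesis N_gt0 : (0 < N)%N.
Variable alpha : R.
Hypothesis alpha_gt0 : 0 < alpha.
Hypothesis alpha_ltN : alpha < N%:R.
Local Notation mu := (@lebesgue_rV R N).
Local Notation K := (@riesz R N alpha).
Local Notation A := (@riesz_const R N alpha).
Implicit Types (x y h : 'rV[R]_N) (f g : 'rV[R]_N -> R).

Let gam_gt0 : 0 < N%:R - alpha. Proof. by rewrite subr_gt0. Qed.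

Lemma riesz_const_ge0 : 0 <= A.
Proof.
have G (a : R) : 0 <= Gamma a.
  by apply: Rintegral_ge0 => t _; rewrite mulr_ge0 ?powR_ge0 ?expR_ge0.
by rewrite divr_ge0// !mulr_ge0// powR_ge0.
Qed.

Lemma rieszE x : K x = A * enorm x `^ (- (N%:R - alpha)).
Proof. by rewrite /riesz powRN. Qed.

Lemma riesz_ge0 x : 0 <= K x.
Proof. by rewrite rieszE mulr_ge0 ?riesz_const_ge0// powR_ge0. Qed.

Lemma rieszN x : K (- x) = K x.
Proof. by rewrite /riesz enormN. Qed.

Lemma riesz_sym x y : K (x - y) = K (y - x).
Proof. by rewrite -rieszN opprB. Qed.

Lemma measurable_riesz : measurable_fun setT K.
Proof.
rewrite (_ : K = fun x => A * enorm x `^ (- (N%:R - alpha))).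
  apply: measurable_funM; first exact: measurable_cst.
  apply: (measurableT_comp (f := fun t : R => t `^ (- (N%:R - alpha)))).
    exact: measurable_powR.
  exact: measurable_enorm.
by apply/funext => x; rewrite rieszE.
Qed.

Lemma riesz_le (t : R) x : 0 < t -> t <= enorm x -> K x <= A * t `^ (- (N%:R - alpha)).
Proof.
move=> t0 tx; rewrite rieszE ler_wpM2l ?riesz_const_ge0// !powRN.
rewrite lef_pV2 ?posrE ?powR_gt0//; last exact: lt_le_trans tx.
by apply: ge0_ler_powR; [exact: ltW|rewrite nnegrE ltW|rewrite nnegrE enorm_ge0|].
Qed.

(** The Euclidean norm dominates the geometric mean of the coordinates, which
    reduces local integrability of the Riesz kernel to the integrability of
    [t^-b] with [b < 1] in each variable. *)
Lemma riesz_unit_ball_ltoo : (\int[mu]_x (K x * ballI 1 x)%:E < +oo)%E.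
Proof.
pose b := (N%:R - alpha) / N%:R.
have NR : 0 < N%:R :> R by rewrite ltr0n.
have hb : 0 < b < 1 by rewrite divr_gt0//= ltr_pdivrMr// mul1r gtrBl.
pose w t : R := unit_power b t + unit_power b (- t).
have mw : measurable_fun setT w.
  apply: measurable_funD; first exact: measurable_unit_power.
  by apply: (measurableT_comp (measurable_unit_power b)); exact: oppr_measurable.
have w0 t : 0 <= w t by rewrite addr_ge0// unit_power_ge0.
have H := @ge0_integral_prod_ltoo R N w mw w0 (integral_unit_power2_ltoo hb).
have mP : measurable_fun setT (fun x : 'rV[R]_N => \prod_(i < N) w (x ord0 i)).
  by apply: measurable_prod => i _; exact: (measurableT_comp mw (measurable_coord i)).
have mK := measurable_riesz; have mb := @measurable_ballI R N 1.
apply: (@le_lt_trans _ _ (\int[mu]_x (A%:E * (\prod_(i < N) w (x ord0 i))%:E))%E).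
  apply: ae_ge0_le_integral => //.
  - by move=> x _; rewrite lee_fin mulr_ge0 ?riesz_ge0 ?ballI_ge0.
  - by apply/measurable_EFinP; exact: measurable_funM.
  - by move=> x _; rewrite -EFinM lee_fin mulr_ge0 ?riesz_const_ge0// prodr_ge0.
  - under eq_fun do rewrite -EFinM.
    by apply/measurable_EFinP; exact: measurable_funM.
  - pose H0 i := [set x : 'rV[R]_N | x ord0 i = 0].
    have nH : mu.-negligible (\big[setU/set0]_(i <- index_enum 'I_N) H0 i).
      elim: (index_enum _) => [|i s IH]; first by rewrite big_nil; exact: negligible_set0.
      rewrite big_cons; apply: negligibleU => //; apply/negligibleP.
        rewrite -[X in measurable X]setTI.
        exact: (measurable_coord i measurableT (measurable_set1 0)).
      exact: lebesgue_hyperplane.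
    apply: negligibleS nH => x /= Hx.
    apply: contrapT => xH; apply: Hx => _; rewrite -EFinM lee_fin.
    have xi i : x ord0 i != 0.
      by apply/negP => /eqP xi; apply: xH; rewrite -bigcup_seq; exists i => //=; rewrite mem_index_enum.
    have [x1|x1] := leP `|x| 1; last first.
      by rewrite ballI_out// mulr0 mulr_ge0 ?riesz_const_ge0// prodr_ge0.
    rewrite ballI_in// mulr1 rieszE ler_wpM2l ?riesz_const_ge0//.
    have e0 : 0 < enorm x.
      by apply: lt_le_trans (coord_le_enorm x (Ordinal N_gt0)); rewrite normr_gt0.
    have -> : enorm x `^ (- (N%:R - alpha)) = \prod_(i < N) enorm x `^ (- b).
      rewrite prodr_const card_ord -powR_mulrn ?powR_ge0// -powRrM; congr powR.
      by rewrite /b mulNr divfK ?lt0r_neq0.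
    apply: ler_prod => i _; rewrite powR_ge0/=.
    apply: le_trans (unit_power2_ge b (xi i) _); last first.
      exact: le_trans (coord_le_norm x i) x1.
    rewrite !powRN lef_pV2 ?posrE ?powR_gt0 ?normr_gt0//.
    case/andP: hb => b0 _.
    by apply: ge0_ler_powR; rewrite ?nnegrE ?enorm_ge0 ?(ltW b0)//; exact: coord_le_enorm.
rewrite ge0_integralZl_EFin//.
- by rewrite lte_mul_pinfty// lee_fin riesz_const_ge0.
- by move=> x _; rewrite lee_fin prodr_ge0.
- exact/measurable_EFinP.
- exact: riesz_const_ge0.
Qed.

Lemma measurable_subr x : measurable_fun setT (fun y : 'rV[R]_N => y - x).
Proof. exact: measurable_translation. Qed.

Lemma measurable_riesz_shift x : measurable_fun setT (fun y => K (x - y)).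
Proof.
rewrite (_ : (fun y => _) = fun y => K (y - x)).
  exact: (measurableT_comp measurable_riesz (measurable_subr x)).
by apply/funext => y; rewrite riesz_sym.
Qed.

(** The kernel is integrable near its pole and at most its constant elsewhere. *)
Lemma potential_ballI_bounded M :
  exists2 C : R, 0 <= C & forall x, (\int[mu]_y (K (x - y) * ballI M y)%:E <= C%:E)%E.
Proof.
have A0 := riesz_const_ge0.
have mb r := @measurable_ballI R N r.
have mKb : measurable_fun setT (fun z => K z * ballI 1 z).
  by apply: measurable_funM => //; exact: measurable_riesz.
pose L := \int[mu]_x (K x * ballI 1 x); pose B := \int[mu]_x ballI M x.
have iL : rint mu (fun z => K z * ballI 1 z).
  apply: ge0_rint => //; last exact: riesz_unit_ball_ltoo.
  by move=> x; rewrite mulr_ge0 ?riesz_ge0 ?ballI_ge0.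
exists (L + A * B).
  rewrite addr_ge0//; first by apply: Rintegral_ge0 => x _; rewrite mulr_ge0 ?riesz_ge0 ?ballI_ge0.
  by rewrite mulr_ge0// Rintegral_ge0// => x _; exact: ballI_ge0.
move=> x; pose F1 := tr (- x) (fun z => K z * ballI 1 z); pose F2 y := A * ballI M y.
have iF1 : rint mu F1 by exact: rint_tr.
have iF2 : rint mu F2 by apply: rintZ; exact: rint_ballI.
have mF : measurable_fun setT (fun y => K (x - y) * ballI M y).
  by apply: measurable_funM => //; exact: measurable_riesz_shift.
have F0 y : 0 <= K (x - y) * ballI M y by rewrite mulr_ge0 ?riesz_ge0 ?ballI_ge0.
have le y : K (x - y) * ballI M y <= F1 y + F2 y.
  rewrite /F1 /F2 /tr riesz_sym.
  have [h|h] := leP `|y - x| 1.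
    rewrite (ballI_in h) mulr1; apply: (@le_trans _ _ (K (y - x))).
      by rewrite ler_piMr ?riesz_ge0 ?ballI_le1.
    by rewrite lerDl mulr_ge0 ?ballI_ge0.
  rewrite (ballI_out h) mulr0 add0r; apply: ler_wpM2r; first exact: ballI_ge0.
  have := @riesz_le 1 (y - x) ltr01; rewrite powR1 mulr1; apply.
  by apply: le_trans (norm_le_enorm _); exact: ltW.
have iF : rint mu (fun y => K (x - y) * ballI M y).
  by apply: (le_rint mF _ (rintD iF1 iF2)) => y; rewrite ger0_norm.
rewrite -EFin_Rintegral// lee_fin.
apply: (@le_trans _ _ (\int[mu]_y (F1 y + F2 y))).
  by apply: le_Rintegral => //; exact: rintD.
rewrite RintegralD// /F1 Rintegral_tr// /F2 RintegralZl//; exact: rint_ballI.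
Qed.

End riesz_kernel.

(** * The Riesz energy *)

Section riesz_energy.
Context {R : realType} {N : nat}.
Hypothesis N_gt0 : (0 < N)%N.
Variable alpha : R.
Hypothesis alpha_gt0 : 0 < alpha.
Hypothesis alpha_ltN : alpha < N%:R.
Local Notation mu := (@lebesgue_rV R N).
Local Notation K := (@riesz R N alpha).
Local Notation A := (@riesz_const R N alpha).
Implicit Types (x y h : 'rV[R]_N) (f g : 'rV[R]_N -> R).

(** The densities between which energies are taken; by nonnegativity, Tonelli's
    theorem applies throughout, to infinite values as well. *)
Definition nn f := measurable_fun setT f /\ forall x, 0 <= f x.

Definition potential f x : \bar R := (\int[mu]_y (K (x - y) * f y)%:E)%E.

Definition energy f g : \bar R := (\int[mu]_x (potential f x * (g x)%:E))%E.

Local Opaque riesz riesz_const.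

Let K0 := @riesz_ge0 R N alpha.

Lemma measurable_kernel :
  measurable_fun setT (fun z : 'rV[R]_N * 'rV[R]_N => K (z.1 - z.2)).
Proof.
apply: (measurableT_comp (measurable_riesz alpha)).
apply: measurable_fun_rV => i.
rewrite (_ : (fun _ => _) = fun z : 'rV[R]_N * 'rV[R]_N =>
   (z.1 ord0 i : measurableTypeR R) - z.2 ord0 i); last first.
  by apply/funext => z; rewrite !mxE.
by apply: measurable_funB;
  [exact: (measurableT_comp (measurable_coord i) measurable_fst)
  |exact: (measurableT_comp (measurable_coord i) measurable_snd)].
Qed.

Let m_fst f : measurable_fun setT f ->
  measurable_fun setT (fun z : 'rV[R]_N * 'rV[R]_N => f z.1).
Proof. by move=> mf; exact: (measurableT_comp mf measurable_fst). Qed.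

Let m_snd f : measurable_fun setT f ->
  measurable_fun setT (fun z : 'rV[R]_N * 'rV[R]_N => f z.2).
Proof. by move=> mf; exact: (measurableT_comp mf measurable_snd). Qed.

Lemma measurable_potential f : nn f -> measurable_fun setT (potential f).
Proof.
move=> [mf f0].
apply: (measurable_fun_fubini_tonelli_F
  (fun z : 'rV[R]_N * 'rV[R]_N => (K (z.1 - z.2) * f z.2)%:E)).
  apply/measurable_EFinP; apply: measurable_funM; first exact: measurable_kernel.
  exact: m_snd.
by move=> z; rewrite lee_fin mulr_ge0.
Qed.

Lemma potential_ge0 f x : nn f -> (0 <= potential f x)%E.
Proof. by move=> [mf f0]; apply: integral_ge0 => y _; rewrite lee_fin mulr_ge0. Qed.

Lemma energy_ge0 f g : nn f -> nn g -> (0 <= energy f g)%E.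
Proof.
by move=> hf [_ g0]; apply: integral_ge0 => x _; rewrite mule_ge0 ?potential_ge0 ?lee_fin.
Qed.

Lemma measurable_slice f x : nn f -> measurable_fun setT (fun y => K (x - y) * f y).
Proof. by move=> [mf _]; apply: measurable_funM => //; exact: measurable_riesz_shift. Qed.

Lemma measurable_density f g : nn f -> nn g ->
  measurable_fun setT (fun z : 'rV[R]_N * 'rV[R]_N => K (z.1 - z.2) * f z.2 * g z.1).
Proof.
move=> [mf _] [mg _]; apply: measurable_funM; last exact: m_fst.
by apply: measurable_funM; [exact: measurable_kernel|exact: m_snd].
Qed.

Lemma density_ge0 f g (z : 'rV[R]_N * 'rV[R]_N) : nn f -> nn g ->
  0 <= K (z.1 - z.2) * f z.2 * g z.1.
Proof.
by move=> [_ f0] [_ g0]; apply: mulr_ge0; [apply: mulr_ge0; [exact: K0|exact: f0]|exact: g0].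
Qed.

Lemma energy_iter f g : nn f -> nn g ->
  energy f g = (\int[mu]_x \int[mu]_y (K (x - y) * f y * g x)%:E)%E.
Proof.
move=> hf hg; apply: eq_integral => x _.
rewrite /potential -ge0_integralZr//.
- by apply/measurable_EFinP; exact: measurable_slice.
- by move=> y _; rewrite lee_fin mulr_ge0//; case: hf.
- by rewrite lee_fin; case: hg.
Qed.

Lemma energy_prod f g : nn f -> nn g ->
  energy f g = (\int[mu \x mu]_z (K (z.1 - z.2) * f z.2 * g z.1)%:E)%E.
Proof.
move=> hf hg; rewrite energy_iter// fubini_tonelli1//.
  by apply/measurable_EFinP; exact: measurable_density.
by move=> z; rewrite lee_fin density_ge0.
Qed.

Lemma energyC f g : nn f -> nn g -> energy f g = energy g f.
Proof.
move=> hf hg; rewrite energy_prod// fubini_tonelli2//; last 2 first.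
- by apply/measurable_EFinP; exact: measurable_density.
- by move=> z; rewrite lee_fin density_ge0.
rewrite (energy_iter hg hf); apply: eq_integral => y _; apply: eq_integral => x _ /=.
by rewrite [in LHS](riesz_sym alpha) mulrAC.
Qed.

Lemma potential_le f f' x : nn f -> nn f' -> (forall y, f y <= f' y) ->
  (potential f x <= potential f' x)%E.
Proof.
move=> hf hf' le; apply: ge0_le_integral => //.
- by move=> y _; rewrite lee_fin mulr_ge0//; case: hf.
- by apply/measurable_EFinP; exact: measurable_slice.
- by apply/measurable_EFinP; exact: measurable_slice.
- by move=> y _; rewrite lee_fin ler_wpM2l.
Qed.

Let m_integrand f g : nn f -> nn g ->
  measurable_fun setT (fun x => (potential f x * (g x)%:E)%E).
Proof.
move=> hf [mg _]; apply: emeasurable_funM; first exact: measurable_potential.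
exact/measurable_EFinP.
Qed.

Lemma energy_le f f' g g' : nn f -> nn f' -> nn g -> nn g' ->
  (forall y, f y <= f' y) -> (forall y, g y <= g' y) ->
  (energy f g <= energy f' g')%E.
Proof.
move=> hf hf' hg hg' lf lg; apply: ge0_le_integral => //.
- by move=> x _; rewrite mule_ge0 ?potential_ge0// lee_fin; case: hg.
- exact: m_integrand.
- exact: m_integrand.
- move=> x _; apply: lee_pmul; rewrite ?potential_ge0 ?lee_fin//; first by case: hg.
  exact: potential_le.
Qed.

Lemma nnD f g : nn f -> nn g -> nn (fun x => f x + g x).
Proof.
by move=> [mf f0] [mg g0]; split=> [|x]; [exact: measurable_funD|rewrite addr_ge0].
Qed.

Lemma nnZ (c : R) f : 0 <= c -> nn f -> nn (fun x => c * f x).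
Proof.
by move=> c0 [mf f0]; split=> [|x]; [exact: measurable_funM|rewrite mulr_ge0].
Qed.

Lemma nn_tr h f : nn f -> nn (tr h f).
Proof. by move=> [mf f0]; split=> [|x]; [exact: measurable_tr|exact: f0]. Qed.

Lemma energyDr f g g' : nn f -> nn g -> nn g' ->
  energy f (fun x => g x + g' x) = (energy f g + energy f g')%E.
Proof.
move=> hf hg hg'; rewrite -ge0_integralD//; last 4 first.
- by move=> x _; rewrite mule_ge0 ?potential_ge0// lee_fin; case: hg.
- exact: m_integrand.
- by move=> x _; rewrite mule_ge0 ?potential_ge0// lee_fin; case: hg'.
- exact: m_integrand.
apply: eq_integral => x _; rewrite EFinD ge0_muleDr// lee_fin; [by case: hg|by case: hg'].
Qed.

Lemma energyDl f f' g : nn f -> nn f' -> nn g ->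
  energy (fun x => f x + f' x) g = (energy f g + energy f' g)%E.
Proof.
move=> hf hf' hg; rewrite (energyC (nnD hf hf') hg) (energyDr hg hf hf').
by rewrite (energyC hg hf) (energyC hg hf').
Qed.

Lemma energyZr c f g : 0 <= c -> nn f -> nn g ->
  energy f (fun x => c * g x) = (c%:E * energy f g)%E.
Proof.
move=> c0 hf hg; rewrite -ge0_integralZl_EFin//; last 2 first.
- by move=> x _; rewrite mule_ge0 ?potential_ge0// lee_fin; case: hg.
- exact: m_integrand.
by apply: eq_integral => x _; rewrite EFinM muleCA.
Qed.

Lemma energyZl c f g : 0 <= c -> nn f -> nn g ->
  energy (fun x => c * f x) g = (c%:E * energy f g)%E.
Proof.
move=> c0 hf hg; rewrite (energyC (nnZ c0 hf) hg) (energyZr c0 hg hf).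
by rewrite (energyC hg hf).
Qed.

Lemma eq_energy f f' g g' : f =1 f' -> g =1 g' -> energy f g = energy f' g'.
Proof. by move=> /funext -> /funext ->. Qed.

Lemma potential_tr h f x : nn f -> potential (tr h f) x = potential f (x + h).
Proof.
move=> hf; rewrite /potential.
rewrite -(@ge0_integral_translation R N (fun y => (K (x + h - y) * f y)%:E) h).
- by apply: eq_integral => y _; rewrite opprD addrACA subrr addr0.
- by apply/measurable_EFinP; exact: measurable_slice.
- by move=> y; rewrite lee_fin mulr_ge0//; case: hf.
Qed.

Lemma energy_tr h f g : nn f -> nn g -> energy (tr h f) (tr h g) = energy f g.
Proof.
move=> hf hg; rewrite /energy.
rewrite -[RHS](@ge0_integral_translation R N (fun x => potential f x * (g x)%:E)%E h).
- by apply: eq_integral => x _; rewrite potential_tr.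
- exact: m_integrand.
- by move=> x; rewrite mule_ge0 ?potential_ge0// lee_fin; case: hg.
Qed.

Lemma enorm_gt0 x : x != 0 -> 0 < enorm x.
Proof. by move=> x0; apply: lt_le_trans (norm_le_enorm x); rewrite normr_gt0. Qed.

(** Points are null, so the value of the kernel at the origin is irrelevant. *)
Lemma energy_gt0 f g : A != 0 -> nn f -> nn g -> ~ ae_zero f -> ~ ae_zero g ->
  (0 < energy f g)%E.
Proof.
move=> A0 hf hg f0 g0; have [mf fge] := hf; have [mg gge] := hg.
rewrite lt0e energy_ge0// andbT; apply/negP => /eqP E0.
have aeE : {ae mu, forall x, (potential f x * (g x)%:E)%E = 0%E}.
  have : (\int[mu]_x `|potential f x * (g x)%:E| = 0)%E.
    by rewrite -[RHS]E0; apply: eq_integral => x _; rewrite gee0_abs// mule_ge0 ?potential_ge0 ?lee_fin.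
  move/(ae_eq_integral_abs mu measurableT (m_integrand hf hg)).
  by apply: filterS => x /(_ I).
apply: g0; apply: filterS aeE => x; move=> /eqP; rewrite mule_eq0 => /orP[/eqP Vx|/eqP[]//].
exfalso; apply: f0.
have : {ae mu, forall y, K (x - y) * f y = 0}.
  have mKf := measurable_slice x hf.
  have : (\int[mu]_y `|(K (x - y) * f y)%:E| = 0)%E.
    by rewrite -[RHS]Vx; apply: eq_integral => y _; rewrite gee0_abs// lee_fin mulr_ge0.
  move/(ae_eq_integral_abs mu measurableT ((measurable_EFinP _ _).2 mKf)).
  by apply: filterS => y /(_ I) [].
have nx : {ae mu, forall y, y ord0 (Ordinal N_gt0) <> x ord0 (Ordinal N_gt0)}.
  exists [set y : 'rV[R]_N | y ord0 (Ordinal N_gt0) = x ord0 (Ordinal N_gt0)]; split.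
  - rewrite -[X in measurable X]setTI.
    exact: (measurable_coord (Ordinal N_gt0) measurableT (measurable_set1 _)).
  - exact: lebesgue_hyperplane.
  - by move=> y /= /contrapT.
apply: filterS2 nx => y yx /eqP; rewrite mulf_eq0 => /orP[|/eqP//].
rewrite (rieszE alpha) mulf_eq0 (negbTE A0)/= powR_eq0 => /andP[/eqP e0 _].
have : 0 < enorm (x - y) by apply: enorm_gt0; rewrite subr_eq0; apply/eqP => xy; apply: yx; rewrite xy.
by rewrite e0 ltxx.
Qed.

(** Otherwise the energy would be infinite. *)
Lemma potential_finite f : nn f -> ~ ae_zero f -> (energy f f < +oo)%E ->
  exists x0, (potential f x0 < +oo)%E.
Proof.
move=> hf f0 E; apply: contrapT => /forallNP H; apply: f0.
have Voo x : potential f x = +oo%E.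
  by apply/eqP; rewrite -leye_eq leNgt; apply/negP; exact: H.
have [mf fge] := hf.
have iE : mu.-integrable setT (fun x => potential f x * (f x)%:E)%E.
  apply/integrableP; split; first exact: m_integrand.
  rewrite (_ : \int[mu]_x _ = energy f f)%E//.
  by apply: eq_integral => x _; rewrite gee0_abs// mule_ge0 ?potential_ge0 ?lee_fin.
have := integrable_ae measurableT iE; apply: filterS => x /(_ I).
rewrite Voo; have [->//|fx] := eqVneq (f x) 0.
by rewrite gt0_mulye// lte_fin lt_neqAle eq_sym fx fge.
Qed.

Definition locally_finite f := forall M, (\int[mu]_x (f x * ballI M x)%:E < +oo)%E.

Let nn_bb M : nn (ballI M). Proof. by split; [exact: measurable_ballI|move=> x; exact: ballI_ge0]. Qed.

(** A density of finite energy has finite energy with balls: far away the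
    potential of a ball is comparable with the kernel based at a point where
    the potential of the density is finite. *)
Lemma energy_ball_finite f M : nn f -> ~ ae_zero f -> (energy f f < +oo)%E ->
  locally_finite f -> (energy f (ballI M) < +oo)%E.
Proof.
move=> hf f0 E lf; have [mf fge] := hf.
have [x0 Vx0] := potential_finite hf f0 E.
have A0 := @riesz_const_ge0 R N alpha.
have gam : 0 < N%:R - alpha by rewrite subr_gt0.
have [C C0 HC] := potential_ballI_bounded N_gt0 alpha_gt0 alpha_ltN M.
pose M' : R := `|M| + 1 + `|x0|; pose L : R := N%:R * (1 + `|M| + `|x0|).
have NR : 1 <= N%:R :> R by rewrite ler1n.
have n0 : 0 <= `|M| := normr_ge0 M; have n1 : 0 <= `|x0| := normr_ge0 x0.
have L0 : 0 < L by rewrite mulr_gt0//; lra.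
pose B := \int[mu]_x ballI M x.
have B0 : 0 <= B by apply: Rintegral_ge0 => x _; exact: ballI_ge0.
pose E' := L `^ (N%:R - alpha) * B.
have E'0 : 0 <= E' by rewrite mulr_ge0// powR_ge0.
have J y : (potential (ballI M) y <= (C * ballI M' y + E' * K (x0 - y))%:E)%E.
  have [yM|yM] := leP `|y| M'.
    apply: le_trans (HC y) _; rewrite lee_fin (ballI_in yM) mulr1 lerDl.
    by rewrite mulr_ge0.
  rewrite (ballI_out yM) mulr0 add0r /E' mulrAC EFinM EFin_Rintegral; last exact: rint_ballI.
  rewrite -ge0_integralZl_EFin//; last 3 first.
  - by move=> x _; rewrite lee_fin ballI_ge0.
  - by apply/measurable_EFinP; exact: measurable_ballI.
  - by rewrite mulr_ge0// powR_ge0.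
  apply: ge0_le_integral => //.
  - by move=> x _; rewrite lee_fin mulr_ge0 ?ballI_ge0.
  - by apply/measurable_EFinP; exact: measurable_slice.
  - rewrite (_ : (fun x => _) = fun x => (L `^ (N%:R - alpha) * K (x0 - y) * ballI M x)%:E)//.
    by apply/measurable_EFinP; apply: measurable_funM => //; exact: measurable_ballI.
  move=> x _; rewrite -EFinM lee_fin.
  have [xM|xM] := leP `|x| M; last by rewrite (ballI_out xM) !mulr0.
  rewrite (ballI_in xM) !mulr1.
  have hM : M <= `|M| by exact: ler_norm.
  have yx : 1 <= `|y - x|.
    have : `|y| <= `|y - x| + `|x| by rewrite -{1}(subrK x y) ler_normD.
    by move: yM; rewrite /M'; lra.
  have yx0 : y - x0 != 0.
    by rewrite subr_eq0; apply/eqP => yx0; move: yM; rewrite yx0 /M'; lra.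
  have e0 := enorm_gt0 yx0.
  rewrite (riesz_sym alpha x0).
  have -> : L `^ (N%:R - alpha) * K (y - x0) = A * (enorm (y - x0) / L) `^ (- (N%:R - alpha)).
    rewrite (rieszE alpha) mulrCA; congr (_ * _); rewrite !powRN.
    rewrite powRM ?enorm_ge0 ?invr_ge0 ?(ltW L0)// invfM mulrC; congr (_ * _).
    by rewrite -powR_inv1 ?(ltW L0)// -powRrM mulN1r powRN invrK.
  apply: riesz_le => //; first by rewrite divr_gt0.
  rewrite ler_pdivrMr//; apply: le_trans (enorm_le_norm _) _.
  have h1 : `|y - x0| <= `|y - x| + (`|x| + `|x0|).
    rewrite (_ : y - x0 = (y - x) + (x - x0)); last by rewrite addrA subrK.
    by apply: le_trans (ler_normD _ _) _; rewrite lerD2l ler_normB.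
  have h2 : `|y - x0| <= (1 + `|M| + `|x0|) * `|y - x| by nra.
  apply: (@le_trans _ _ (N%:R * ((1 + `|M| + `|x0|) * `|y - x|))).
    by apply: ler_wpM2l.
  rewrite mulrA -/L mulrC; apply: ler_wpM2r; first exact: ltW.
  exact: norm_le_enorm.
have mb : measurable_fun setT (ballI M' : 'rV[R]_N -> R) := measurable_ballI M'; have mK := measurable_riesz_shift alpha x0.
have mX : measurable_fun setT (fun y => C * (f y * ballI M' y)).
  by apply: measurable_funM => //; exact: measurable_funM.
have mY : measurable_fun setT (fun y => E' * (K (x0 - y) * f y)).
  by apply: measurable_funM => //; exact: measurable_slice.
rewrite (energyC hf (nn_bb M)).
apply: (@le_lt_trans _ _ (\int[mu]_y (C * (f y * ballI M' y) + E' * (K (x0 - y) * f y))%:E)%E).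
  apply: ge0_le_integral => //.
  - by move=> x _; rewrite mule_ge0 ?potential_ge0 ?lee_fin.
  - exact: m_integrand.
  - by apply/measurable_EFinP; exact: measurable_funD.
  move=> y _; apply: (@le_trans _ _ ((C * ballI M' y + E' * K (x0 - y))%:E * (f y)%:E)%E).
    by apply: lee_wpmul2r; [rewrite lee_fin|exact: J].
  by rewrite -EFinM lee_fin le_eqVlt; apply/orP; left; apply/eqP; ring.
under eq_integral do rewrite EFinD.
rewrite ge0_integralD//; last 4 first.
- by move=> y _; rewrite lee_fin !mulr_ge0// ballI_ge0.
- exact/measurable_EFinP.
- by move=> y _; rewrite lee_fin mulr_ge0// mulr_ge0.
- exact/measurable_EFinP.
rewrite lte_add_pinfty//.
- under eq_integral do rewrite EFinM.
  rewrite ge0_integralZl_EFin//.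
  + by rewrite lte_mul_pinfty// lee_fin.
  + by move=> y _; rewrite lee_fin !mulr_ge0// ballI_ge0.
  + by apply/measurable_EFinP; exact: measurable_funM.
- under eq_integral do rewrite EFinM.
  rewrite ge0_integralZl_EFin//.
  + by rewrite lte_mul_pinfty// lee_fin.
  + by move=> y _; rewrite lee_fin mulr_ge0.
  + by apply/measurable_EFinP; exact: measurable_slice.
Qed.

(** The kernel decays at infinity: at distance [T] between the supports it is at
    most [A / Q], and [Q] is chosen to beat the two masses and [eps]. *)
Lemma energy_far f g (M eps : R) : nn f -> nn g -> rint mu f -> rint mu g ->
  0 <= M -> (forall x, M < `|x| -> f x = 0) -> (forall x, M < `|x| -> g x = 0) ->
  0 < eps -> exists h, 2 * M < `|h| /\ (energy f (tr h g) <= eps%:E)%E.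
Proof.
move=> hf hg fi gi M0 fM gM eps0.
have A0 := @riesz_const_ge0 R N alpha.
have gam : 0 < N%:R - alpha by rewrite subr_gt0.
pose F := \int[mu]_x f x; pose G := \int[mu]_x g x.
have F0 : 0 <= F by apply: Rintegral_ge0 => x _; case: hf.
have G0 : 0 <= G by apply: Rintegral_ge0 => x _; case: hg.
pose Q := A * F * G / eps + 1.
have Q0 : 0 < Q.
  by rewrite /Q ltr_wpDl// divr_ge0 ?(ltW eps0)// mulr_ge0// mulr_ge0.
pose T := Q `^ (N%:R - alpha)^-1.
have T0 : 0 < T by exact: powR_gt0.
have TQ : T `^ (- (N%:R - alpha)) = Q^-1.
  by rewrite powRN -powRrM mulVf ?lt0r_neq0// powRr1 ?ltW.
pose h : 'rV[R]_N := (2 * M + T) *: delta_mx ord0 (Ordinal N_gt0).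
have hT : 2 * M + T <= `|h|.
  apply: le_trans (coord_le_norm h (Ordinal N_gt0)).
  by rewrite !mxE !eqxx mulr1 ler_norm.
exists h; split; first by apply: lt_le_trans hT; rewrite ltrDl.
have c0 : 0 <= A / Q * F by rewrite mulr_ge0// divr_ge0// ltW.
have pot x : g (x + h) != 0 -> (potential f x <= (A / Q * F)%:E)%E.
  move=> gx; rewrite EFinM EFin_Rintegral//.
  rewrite -ge0_integralZl_EFin//; last 3 first.
  - by move=> y _; rewrite lee_fin; case: hf.
  - by apply/measurable_EFinP; case: hf.
  - by rewrite mulr_ge0// invr_ge0 ltW.
  apply: ge0_le_integral => //.
  - by move=> y _; rewrite lee_fin mulr_ge0//; case: hf.
  - by apply/measurable_EFinP; exact: measurable_slice.
  - rewrite (_ : (fun y => _) = fun y => (A / Q * f y)%:E)//.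
    by apply/measurable_EFinP; apply: measurable_funM => //; case: hf.
  move=> y _; rewrite -EFinM lee_fin.
  have [->|fy] := eqVneq (f y) 0; first by rewrite !mulr0.
  apply: ler_wpM2r; first by case: hf.
  rewrite -TQ; apply: riesz_le => //; apply: le_trans (norm_le_enorm _).
  have yM : `|y| <= M by rewrite leNgt; apply/negP => /fM /eqP; rewrite (negbTE fy).
  have xM : `|x + h| <= M by rewrite leNgt; apply/negP => /gM /eqP; rewrite (negbTE gx).
  have : `|h| <= `|x + h| + (`|y| + `|x - y|).
    rewrite {1}(_ : h = (x + h) - (y + (x - y))); last by rewrite (addrC y) subrK (addrC x) addrK.
    by apply: le_trans (ler_normB _ _) _; rewrite lerD2l ler_normD.
  by move: hT yM xM; lra.
have hgt := nn_tr h hg.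
apply: (@le_trans _ _ (\int[mu]_x ((A / Q * F) * tr h g x)%:E)%E).
  apply: ge0_le_integral => //.
  - by move=> x _; rewrite mule_ge0 ?potential_ge0 ?lee_fin//; case: hgt.
  - exact: m_integrand.
  - by apply/measurable_EFinP; apply: measurable_funM => //; case: hgt.
  move=> x _; rewrite EFinM; have [->|gx] := eqVneq (tr h g x) 0; first by rewrite !mule0.
  by apply: lee_wpmul2r; [rewrite lee_fin; case: hgt|exact: pot].
rewrite -EFin_Rintegral; last by apply: rintZ; exact: rint_tr.
rewrite lee_fin RintegralZl//; last exact: rint_tr.
rewrite Rintegral_tr; last by case: hg.
rewrite -/G (_ : A / Q * F * G = (A * F * G) / Q); last by field; exact: lt0r_neq0.
rewrite ler_pdivrMr// (_ : eps * Q = A * F * G + eps) ?lerDl ?(ltW eps0)//.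
by rewrite /Q; field; exact: lt0r_neq0.
Qed.

(** Dominated convergence on the product space. *)
Lemma energy_cut_cvg f (e : nat -> 'rV[R]_N -> R) : nn f -> (energy f f < +oo)%E ->
  (forall n, nn (e n)) -> (forall n x, e n x <= 1) ->
  (forall x, e n x @[n --> \oo] --> (1 : R)) ->
  fine (energy (fun x => e n x * f x) (fun x => e n x * f x)) @[n --> \oo] -->
  fine (energy f f).
Proof.
move=> hf E he e1 ecv; have [mf f0] := hf.
have hef n : nn (fun x => e n x * f x).
  by have [me e0] := he n; split=> [|x]; [exact: measurable_funM|rewrite mulr_ge0].
have i0 : rint (mu \x mu)%E (fun z : 'rV[R]_N * 'rV[R]_N => K (z.1 - z.2) * f z.2 * f z.1).
  apply: ge0_rint; first exact: measurable_density.
    by move=> z; exact: density_ge0.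
  by rewrite -energy_prod.
have [|||_] := @Rdct _ _ _ (mu \x mu)%E
    (fun n (z : 'rV[R]_N * 'rV[R]_N) => K (z.1 - z.2) * (e n z.2 * f z.2) * (e n z.1 * f z.1))
    (fun z => K (z.1 - z.2) * f z.2 * f z.1) _ _ _ i0.
- by move=> n; exact: (measurable_density (hef n) (hef n)).
- move=> z; rewrite -[X in _ --> X](_ : K (z.1 - z.2) * (1 * f z.2) * (1 * f z.1) = _).
    by apply: cvgM; [apply: cvgMr; apply: cvgMl; exact: ecv|apply: cvgMl; exact: ecv].
  by rewrite !mul1r.
- move=> n z; have dz := density_ge0 z (hef n) (hef n).
  rewrite ger0_norm//; have [me e0] := he n.
  apply: ler_pM; [by apply: mulr_ge0 => //; exact: mulr_ge0|exact: mulr_ge0| |by rewrite ler_piMl].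
  by apply: ler_wpM2l => //; rewrite ler_piMl.
rewrite /Rintegral -(energy_prod hf hf) => H.
by apply: cvg_ext H => n; rewrite -(energy_prod (hef n) (hef n)).
Qed.

End riesz_energy.

(** * The Nehari set and the nodal set *)

Section nehari_sets.
Context {R : realType} {N : nat}.
Hypothesis N_gt0 : (0 < N)%N.
Variables alpha p : R.
Hypothesis p1 : 1 < p.
Local Notation mu := (@lebesgue_rV R N).
Local Notation A := (@riesz_const R N alpha).
Local Notation E := (@energy R N alpha).
Implicit Types (u v w f g : 'rV[R]_N -> R) (x h : 'rV[R]_N).

Let p0 : 0 < p. Proof. exact: lt_trans p1. Qed.
Let pneq0 : p != 0. Proof. by rewrite lt0r_neq0. Qed.

Definition dens u x : R := `|u x| `^ p.

Lemma nn_dens u : measurable_fun setT u -> nn (dens u).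
Proof.
move=> mu'; split=> [|x]; last exact: powR_ge0.
exact: (measurableT_comp (measurable_powR p) (measurableT_comp (@normr_measurable R setT) mu')).
Qed.

Lemma H1_nn u : H1 u -> nn (dens u).
Proof. by move=> /H1_measurable; exact: nn_dens. Qed.

Lemma dens_eq0 u x : (dens u x = 0) <-> (u x = 0).
Proof.
split; last by move=> ux; rewrite /dens ux normr0 powR0.
by move/eqP; rewrite powR_eq0 normr_eq0 => /andP[/eqP].
Qed.

Lemma dens_ae0 u : ~ ae_zero u -> ~ ae_zero (dens u).
Proof. by move=> u0 d0; apply: u0; apply: filterS d0 => x /dens_eq0. Qed.

Lemma densZ (c : R) u x : 0 <= c -> dens (fun x => c * u x) x = c `^ p * dens u x.
Proof. by move=> c0; rewrite /dens normrM powRM// ger0_norm. Qed.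

Lemma dens_pos_neg u x : dens u x = dens (pos_part u) x + dens (neg_part u) x.
Proof.
rewrite /dens /pos_part /neg_part.
by case: (leP (u x) 0) => _; rewrite normr0 powR0// ?add0r ?addr0.
Qed.

Lemma dens_le u v x : `|u x| <= `|v x| -> dens u x <= dens v x.
Proof. by move=> uv; apply: ge0_ler_powR => //; rewrite ?nnegrE ?normr_ge0// ltW. Qed.

Lemma powR_sqr (a : R) : `|a| `^ (p - 2) * a * a = `|a| `^ p.
Proof.
have [->|a0] := eqVneq a 0; first by rewrite mulr0 normr0 powR0.
rewrite -mulrA -expr2 -(real_normK (num_real a)) -powR_mulrn ?normr_ge0//.
by rewrite -powRD ?subrK// normr_eq0 a0 implybT.
Qed.

Lemma dactionE u : daction alpha p u u = dot u u - fine (E (dens u) (dens u)).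
Proof.
congr (_ - fine _); apply: eq_integral => x _; congr (_ * _%:E)%E.
exact: powR_sqr.
Qed.

Lemma daction_posE u : daction alpha p u (pos_part u) =
  dot u (pos_part u) - fine (E (dens u) (dens (pos_part u))).
Proof.
congr (_ - fine _); apply: eq_integral => x _; congr (_ * _%:E)%E.
rewrite /dens /pos_part; case: (leP (u x) 0) => _; last exact: powR_sqr.
by rewrite mulr0 normr0 powR0.
Qed.

Lemma daction_negE u : daction alpha p u (neg_part u) =
  dot u (neg_part u) - fine (E (dens u) (dens (neg_part u))).
Proof.
congr (_ - fine _); apply: eq_integral => x _; congr (_ * _%:E)%E.
rewrite /dens /neg_part; case: (leP (u x) 0) => _; first exact: powR_sqr.
by rewrite mulr0 normr0 powR0.
Qed.

Lemma actionE u : action alpha p u =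
  2^-1 * dot u u - (2 * p)^-1 * fine (E (dens u) (dens u)).
Proof.
congr (_ * _ - _); apply: eq_Rintegral => x _; congr (_ + _).
by rewrite (real_normK (num_real _)) expr2.
Qed.

(** On the Nehari set the action is this multiple of the squared norm. *)
Definition kappa : R := 2^-1 - (2 * p)^-1.

Lemma kappa_gt0 : 0 < kappa.
Proof. by rewrite /kappa subr_gt0 ltf_pV2 ?posrE// ?mulr_gt0//; have := p1; lra. Qed.

(** [fine] sends infinite values to 0, so that a positive value certifies
    finiteness. *)
Lemma fine_gt0_fin (e : \bar R) : 0 < fine e -> e = (fine e)%:E.
Proof. by case: e => //=; rewrite ltxx. Qed.

Lemma energy_ae_zero f v : nn f -> H1 v -> ae_zero v -> E f (dens v) = 0%E.
Proof.
move=> hf hv z; have [md _] := H1_nn hv.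
rewrite /energy (@ae_eq_integral _ _ _ mu setT (cst 0%E))// ?integral0//.
  apply: emeasurable_funM; first exact: measurable_potential hf.
  exact/measurable_EFinP.
by apply: filterS z => x vx _ /=; rewrite /dens vx normr0 powR0// mule0.
Qed.

Lemma nehariP u : nehari alpha p u <->
  [/\ H1 u, 0 < dot u u & E (dens u) (dens u) = (dot u u)%:E].
Proof.
split=> [[hu u0]|[hu u0 Eu]].
  rewrite dactionE => /eqP; rewrite subr_eq0 => /eqP Eu.
  have dpos := dot_gt0 N_gt0 hu u0.
  by split => //; rewrite Eu; apply: fine_gt0_fin; rewrite -Eu.
split=> //; last by rewrite dactionE Eu subrr.
move=> z; have : E (dens u) (dens u) = 0%E; last first.
  by rewrite Eu => -[] h; move: u0; rewrite h ltxx.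
exact: energy_ae_zero (H1_nn hu) hu z.
Qed.

Lemma action_nehari u : nehari alpha p u -> action alpha p u = kappa * dot u u.
Proof. by move=> /nehariP[_ _ Eu]; rewrite actionE Eu /kappa /=; ring. Qed.

Lemma riesz_const_neq0 f g : (0 < E f g)%E -> A != 0.
Proof.
move=> Efg; apply/eqP => A0; move: Efg; rewrite /energy.
rewrite (eq_integral (fun=> 0%E)) ?integral0 ?ltxx// => x _.
rewrite /potential (eq_integral (fun=> 0%E)) ?integral0 ?mul0e// => y _.
by rewrite rieszE A0 !mul0r.
Qed.

(** The two constraints of the nodal set in terms of the two parts; that the
    energies are finite is part of the constraints, because the squared norms
    of the parts are positive. *)
Lemma nehari_nodP u : nehari_nod alpha p u <->
  [/\ H1 u, 0 < dot (pos_part u) (pos_part u), 0 < dot (neg_part u) (neg_part u),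
    E (dens u) (dens (pos_part u)) = (dot (pos_part u) (pos_part u))%:E &
    E (dens u) (dens (neg_part u)) = (dot (neg_part u) (neg_part u))%:E].
Proof.
split=> [[hu up un]|[hu up un Ep En]].
  rewrite daction_posE daction_negE => /eqP; rewrite subr_eq0 dot_pos// => /eqP Ep.
  move=> /eqP; rewrite subr_eq0 dot_neg// => /eqP En.
  have dp := dot_gt0 N_gt0 (H1_pos N_gt0 hu) up.
  have dn := dot_gt0 N_gt0 (H1_neg N_gt0 hu) un.
  split=> //; first by rewrite Ep; apply: fine_gt0_fin; rewrite -Ep.
  by rewrite En; apply: fine_gt0_fin; rewrite -En.
have H v : H1 v -> E (dens u) (dens v) = (dot v v)%:E -> 0 < dot v v -> ~ ae_zero v.
  move=> hv Ev v0 z; have : E (dens u) (dens v) = 0%E; last first.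
    by rewrite Ev => -[] h; move: v0; rewrite h ltxx.
  exact: energy_ae_zero (H1_nn hu) hv z.
have hp := H1_pos N_gt0 hu; have hn := H1_neg N_gt0 hu.
split=> //; [exact: H Ep up|exact: H En un| |].
  by rewrite daction_posE dot_pos// Ep subrr.
by rewrite daction_negE dot_neg// En subrr.
Qed.

Lemma dot_split u : H1 u ->
  dot u u = dot (pos_part u) (pos_part u) + dot (neg_part u) (neg_part u).
Proof.
move=> hu; have hp := H1_pos N_gt0 hu; have hn := H1_neg N_gt0 hu.
by rewrite {1 2}(pos_add_neg u) dot_sqrD// dot_pos_neg// mulr0 addr0.
Qed.

(** The two constraints add up, once the energies are known to be finite. *)
Lemma nehari_nod_sub u : nehari_nod alpha p u -> nehari alpha p u.
Proof.
move=> /nehari_nodP[hu up un Ep En]; apply/nehariP; split=> //.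
  by rewrite dot_split// addr_gt0.
have hp := H1_pos N_gt0 hu; have hn := H1_neg N_gt0 hu.
rewrite (eq_energy alpha (frefl _) (dens_pos_neg u)).
by rewrite (energyDr alpha (H1_nn hu) (H1_nn hp) (H1_nn hn)) Ep En -EFinD (dot_split hu).
Qed.

Lemma c_0_le_c_nod : (c_0 N alpha p <= c_nod N alpha p)%E.
Proof.
apply: ereal_inf_le_tmp => _ [u /nehari_nod_sub hu <-]; by exists u.
Qed.

Lemma energy_densZ (c c' : R) u v : H1 u -> H1 v -> 0 <= c -> 0 <= c' ->
  E (dens (fun x => c * u x)) (dens (fun x => c' * v x)) =
  ((c `^ p * c' `^ p)%:E * E (dens u) (dens v))%E.
Proof.
move=> hu hv c0 c'0.
rewrite (eq_energy alpha (fun x => densZ u x c0) (fun x => densZ v x c'0)).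
have cp := powR_ge0 c p; have cp' := powR_ge0 c' p.
rewrite (energyZl alpha cp (H1_nn hu) (nnZ cp' (H1_nn hv))).
by rewrite (energyZr alpha cp' (H1_nn hu) (H1_nn hv)) muleA.
Qed.

(** The norm scales with the power 2 and the energy with the power [2 * p]. *)
Lemma scaling_exists (S d : R) : 0 < S -> 0 < d -> exists t : R,
  [/\ 0 < t, t ^+ 2 = (S / d) `^ (p - 1)^-1 & t `^ p * t `^ p * d = t ^+ 2 * S].
Proof.
move=> S0 d0; have q0 : 0 < p - 1 by rewrite subr_gt0.
have Sd0 : 0 < S / d by rewrite divr_gt0.
pose t := (S / d) `^ (2 * (p - 1))^-1; exists t.
have t0 : 0 < t by exact: powR_gt0.
split=> //.
  rewrite -powR_mulrn ?ltW// -powRrM; congr (_ `^ _); field.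
  exact: lt0r_neq0.
have -> : t `^ p * t `^ p = t ^+ 2 * (S / d).
  rewrite -powRD; last by rewrite lt0r_neq0// implybT.
  rewrite (_ : p + p = 2%:R + 2 * (p - 1)); last by ring.
  rewrite powRD; last by rewrite (lt0r_neq0 t0) implybT.
  rewrite powR_mulrn ?ltW//; congr (_ * _).
  by rewrite /t -powRrM mulVf ?powRr1 ?ltW// mulf_neq0// lt0r_neq0.
by rewrite -mulrA divfK// lt0r_neq0.
Qed.

(** The right-hand side is the action of the multiple of [w] that lies in the
    Nehari set. *)
Lemma c_0_le w (d : R) : H1 w -> 0 < dot w w -> 0 < d ->
  E (dens w) (dens w) = d%:E ->
  (c_0 N alpha p <= (kappa * (dot w w / d) `^ (p - 1)^-1 * dot w w)%:E)%E.
Proof.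
move=> hw w0 d0 Ew; set S := dot w w.
have [t [t0 t2 tp]] := scaling_exists w0 d0.
have dt : dot (fun x => t * w x) (fun x => t * w x) = t ^+ 2 * S.
  by have htw := H1Z t hw; rewrite dotZl// dotZr// mulrA -expr2.
have nt : nehari alpha p (fun x => t * w x).
  apply/nehariP; split; first exact: H1Z.
    by rewrite dt mulr_gt0// exprn_gt0.
  by rewrite energy_densZ ?ltW// Ew -EFinM tp dt.
have -> : kappa * (S / d) `^ (p - 1)^-1 * S = action alpha p (fun x => t * w x).
  by rewrite action_nehari// dt t2 mulrA.
by apply: ereal_inf_lbound; exists (fun x => t * w x).
Qed.

(** Two functions with disjoint supports and the same norms and energies yield
    a nodal competitor [t (f - r w)] as soon as [r] balances the two nodal
    constraints; [t] is then found by scaling. *)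
Lemma c_nod_le f w (S a b r : R) : H1 f -> H1 w -> (forall x, 0 <= f x) ->
  (forall x, 0 <= w x) -> (forall x, f x * w x = 0) ->
  dot f f = S -> dot w w = S -> 0 < S -> 0 < a -> 0 <= b -> 0 < r ->
  E (dens f) (dens f) = a%:E -> E (dens w) (dens w) = a%:E ->
  E (dens f) (dens w) = b%:E ->
  r `^ (2 - p) * a + r ^+ 2 * b = r `^ p * a + b ->
  (c_nod N alpha p <=
    (kappa * (S / (a + r `^ p * b)) `^ (p - 1)^-1 * S * (1 + r ^+ 2))%:E)%E.
Proof.
move=> hf hw f0 w0 fw Sf Sw S0 a0 b0 r0 Ef Ew Efw bal.
set Q := r `^ p; have Q0 : 0 < Q by exact: powR_gt0.
have bal2 : r ^+ 2 * (a + Q * b) = Q * (Q * a + b).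
  rewrite -bal mulrDr [in RHS]mulrDr; congr (_ + _); last by ring.
  rewrite mulrA /Q -powRD; last by rewrite (lt0r_neq0 r0) implybT.
  by rewrite addrC subrK powR_mulrn// ltW.
have d0 : 0 < a + Q * b by rewrite ltr_wpDr// mulr_ge0// ltW.
have [t [t0 t2 tp]] := scaling_exists S0 d0.
pose s := t * r; have s0 : 0 < s by rewrite mulr_gt0.
have sp : s `^ p = t `^ p * Q by rewrite powRM ?ltW.
pose v x := t * f x - s * w x.
have htf := H1Z t hf; have hsw := H1Z s hw; have hv : H1 v := H1B htf hsw.
have H x : pos_part v x = t * f x /\ neg_part v x = - (s * w x).
  rewrite /pos_part /neg_part /v.
  have tf0 : 0 <= t * f x by rewrite mulr_ge0// ltW.
  have sw0 : 0 <= s * w x by rewrite mulr_ge0// ltW.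
  have /eqP := fw x; rewrite mulf_eq0 => /orP[/eqP fx|/eqP wx].
    move: sw0; rewrite fx mulr0 sub0r => sw0.
    by rewrite max_r ?min_l// oppr_le0.
  by move: tf0; rewrite wx mulr0 subr0 oppr0 => tf0; rewrite max_l ?min_r.
have dp : dens (pos_part v) =1 dens (fun x => t * f x).
  by move=> x; rewrite /dens (H x).1.
have dn : dens (neg_part v) =1 dens (fun x => s * w x).
  by move=> x; rewrite /dens (H x).2 normrN.
have dv : dens v =1 fun x => dens (fun x => t * f x) x + dens (fun x => s * w x) x.
  by move=> x; rewrite dens_pos_neg dp dn.
have Sp : dot (pos_part v) (pos_part v) = t ^+ 2 * S.
  rewrite (eq_dot (fun x => (H x).1) (fun x => (H x).1)).
  by rewrite dotZl// dotZr// mulrA -expr2 Sf.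
have Sn : dot (neg_part v) (neg_part v) = s ^+ 2 * S.
  have En x : neg_part v x = (- s) * w x by rewrite (H x).2 mulNr.
  rewrite (eq_dot En En).
  have hsw' := H1Z (- s) hw.
  by rewrite dotZl// dotZr// mulrA mulrNN -expr2 Sw.
have nf := H1_nn hf; have nw := H1_nn hw.
have ntf := H1_nn htf; have nsw := H1_nn hsw.
have t0' := ltW t0; have s0' := ltW s0.
have nv : nehari_nod alpha p v.
  apply/nehari_nodP; split=> //.
  - by rewrite Sp mulr_gt0// exprn_gt0.
  - by rewrite Sn mulr_gt0// exprn_gt0.
  - rewrite (eq_energy alpha dv dp) (energyDl alpha ntf nsw ntf).
    rewrite !energy_densZ// Ef (energyC alpha nw nf) Efw -!EFinM -EFinD Sp -tp sp.
    by congr (_%:E); ring.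
  - rewrite (eq_energy alpha dv dn) (energyDl alpha ntf nsw nsw).
    rewrite !energy_densZ// Ew Efw -!EFinM -EFinD Sn sp.
    congr (_%:E); transitivity (t `^ p * t `^ p * (Q * (Q * a + b))); first by ring.
    by rewrite -bal2 mulrCA tp /s; ring.
have -> : kappa * (S / (a + Q * b)) `^ (p - 1)^-1 * S * (1 + r ^+ 2) = action alpha p v.
  rewrite action_nehari; last exact: nehari_nod_sub.
  by rewrite dot_split// Sp Sn -t2 /s; ring.
by apply: ereal_inf_lbound; exists v.
Qed.

(** If the norm of [w] were smaller than that of [u], then, the energy of [w]
    being at least that of [u], the factor that scales [w] into the Nehari set
    would be at most one, and the action would fall below the infimum. *)
Lemma minimal_norm u w : nehari alpha p u -> (action alpha p u)%:E = c_0 N alpha p ->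
  H1 w -> (E (dens u) (dens u) <= E (dens w) (dens w))%E ->
  (E (dens w) (dens w) < +oo)%E -> dot u u <= dot w w.
Proof.
move=> nu cu hw; have [hu u0 Eu] := (nehariP u).1 nu.
have := energy_ge0 alpha (H1_nn hw) (H1_nn hw).
case Ew : (E (dens w) (dens w)) => [d| |]// d0'; rewrite Eu lee_fin => Sd _.
have d0 : 0 < d by exact: lt_le_trans Sd.
rewrite leNgt; apply/negP => wS.
have w0 : 0 < dot w w.
  rewrite lt_neqAle dot_ge0// andbT; apply/negP => /eqP w0.
  have : E (dens w) (dens w) = 0%E; last by rewrite Ew => -[] h; move: d0; rewrite h ltxx.
  have z : ae_zero w by apply: contrapT => /(dot_gt0 N_gt0 hw); rewrite -w0 ltxx.
  exact: energy_ae_zero (H1_nn hw) hw z.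
have := c_0_le hw w0 d0 Ew; rewrite -cu (action_nehari nu) lee_fin leNgt => /negP; apply.
have k0 := kappa_gt0.
rewrite -mulrA; apply: (@le_lt_trans _ _ (kappa * dot w w)); last by rewrite ltr_pM2l.
rewrite ler_pM2l// ler_piMl ?(ltW w0)//.
have wd : dot w w / d <= 1 by rewrite ler_pdivrMr// mul1r; apply: le_trans Sd; exact: ltW.
have := @ge0_ler_powR R (p - 1)^-1 _ (dot w w / d) 1; rewrite !powR1; apply.
- by rewrite invr_ge0 subr_ge0 ltW.
- by rewrite nnegrE divr_ge0 ?ltW.
- by rewrite nnegrE.
- exact: wd.
Qed.

End nehari_sets.

(** * Equality of the two levels *)

Section cut_off.
Context {R : realType} {N : nat}.
Local Notation mu := (@lebesgue_rV R N).
Implicit Types (x : 'rV[R]_N).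

Let hat (t : R) : R := expR 2 * (flat 0 (1 * t + 1) * flat 0 (- 1 * t + 1)).

(* with [a + b = 2] one has [1 / a + 1 / b >= 2] *)
Let hat01 t : 0 <= hat t <= 1.
Proof.
rewrite /hat !mulr_ge0 ?expR_ge0 ?flat_ge0//= mul1r mulN1r /flat !expr0 !mul1r.
case: ifPn => [tl|]; last by rewrite mul0r mulr0.
case: ifPn => [tr|]; last by rewrite !mulr0.
rewrite -!expRD -[leRHS](@expR0 R) ler_expR.
have : 2 <= (t + 1)^-1 + (- t + 1)^-1; last lra.
have -> : (t + 1)^-1 + (- t + 1)^-1 = 2 / ((t + 1) * (- t + 1)).
  by field; rewrite !lt0r_neq0.
rewrite ler_pdivlMr ?mulr_gt0//.
have : 0 <= t ^+ 2 by exact: sqr_ge0.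
nra.
Qed.

Let hat0 : hat 0 = 1.
Proof.
rewrite /hat !mulr0 !add0r /flat ltr01 expr0 mul1r invr1 -!expRD.
by rewrite (_ : 2 + _ = 0) ?expR0//; ring.
Qed.

(** Dilations of a product of one-dimensional profiles, each normalised by the
    factor [expR 2] so that its maximum, at the origin, is 1. *)
Lemma cut_off_exists : exists (eta : nat -> 'rV[R]_N -> R) (C : R),
  [/\ forall n, test_function (eta n), forall n x, 0 <= eta n x <= 1, 0 <= C,
    forall n i x, `|partial i (eta n) x| <= C * n.+1%:R^-1 &
    forall x, eta n x @[n --> \oo] --> (1 : R)].
Proof.
pose g x := \prod_i hat (x ord0 i).
have sg : smooth g.
  apply: smooth_closureP; apply: (@smooth_prod _ _ _ (fun i x => hat (x ord0 i))) => i.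
  by apply: (@SCM _ _ (cst (expR 2))); [exact: SCcst|apply: SCM; exact: SCflat].
have tg : test_function g.
  apply/test_functionP; split=> //; exists 1 => x x1.
  have [i xi] : exists i, 1 < `|x ord0 i|.
    apply: contrapT => H; move: x1; rewrite ltNge => /negP; apply.
    apply: norm_rV_le => // i; rewrite leNgt; apply/negP => h; apply: H; by exists i.
  apply/eqP; rewrite /g; apply/prodf_eq0; exists i => //; rewrite /hat.
  move: xi; rewrite ltr_normr => /orP[xi|xi].
    by rewrite (@flat_le0 _ 0 (- 1 * _ + 1)) ?mulr0//; lra.
  by rewrite (@flat_le0 _ 0 (1 * _ + 1)) ?mul0r ?mulr0//; lra.
have g01 x : 0 <= g x <= 1.
  by rewrite prodr_ge0 ?prodr_ile1// => i _; case/andP: (hat01 (x ord0 i)).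
have [C C0 HC] : exists2 C : R, 0 <= C & forall i x, `|partial i g x| <= C.
  have H i : exists C, 0 <= C /\ forall x, `|partial i g x| <= C.
    by have [M [K [M0 _ HM _]]] := test_bounded (test_partial i tg); exists M.
  have [F HF] := choice H; exists (\sum_i F i); first by apply: sumr_ge0 => i _; case: (HF i).
  move=> i x; apply: le_trans ((HF i).2 x) _.
  by rewrite (bigD1 i)//= lerDl; apply: sumr_ge0 => j _; case: (HF j).
have n0 n : n.+1%:R^-1 != 0 :> R by rewrite invr_eq0 pnatr_eq0.
exists (fun n x => g (n.+1%:R^-1 *: x + 0)), C; split=> //.
- by move=> n; exact: test_comp.
- move=> n i x; rewrite partial_affine; last exact: (sg [::]).
  by rewrite normrM mulrC (@ger0_norm _ n.+1%:R^-1)//; apply: ler_wpM2r.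
- move=> x; have cg : {for 0, continuous g} := smooth_continuous sg (x := 0).
  have g0 : g 0 = 1 by rewrite /g big1// => i _; rewrite mxE hat0.
  have H : n.+1%:R^-1 *: x @[n --> \oo] --> (0 *: x : 'rV[R]_N).
    by apply: cvgZr_tmp; exact: cvg_harmonic.
  rewrite scale0r in H.
  have := cvg_comp _ g H cg; rewrite g0; apply: cvg_ext => n.
  by rewrite addr0.
Qed.

End cut_off.

Section balance.
Context {R : realType}.

Lemma one_powR (y : R) : 1 `^ y = 1.
Proof. by rewrite powR1. Qed.

Lemma powR_expR (s y : R) : expR s `^ y = expR (y * s).
Proof. by rewrite mulrC expRM. Qed.

(** As [2 - p < p], the function [r] with power [2 - p] dominates near the
    origin, where it vanishes: the balance is struck at a small [r] provided
    that the interaction [b] is small. *)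
Lemma balance_exists (p a b r0 : R) : 1 < p -> p < 2 -> 0 < a -> 0 < b -> 0 < r0 < 1 ->
  b <= (r0 `^ (2 - p) - r0 `^ p) * a ->
  exists r, [/\ 0 < r, r <= r0 & r `^ (2 - p) * a + r ^+ 2 * b = r `^ p * a + b].
Proof.
move=> p1 p2 a0 b0 /andP[r00 r01] bsmall.
pose F (s : R) := expR ((2 - p) * s) * a + expR (2 * s) * b - (expR (p * s) * a + b).
pose s0 := ln r0; have s00 : s0 < 0 by rewrite ln_lt0// r00.
have er0 : expR s0 = r0 by rewrite lnK.
pose s1 := Num.min s0 (ln (b / (a + b)) / (2 - p)).
have s10 : s1 <= s0 by rewrite ge_min lexx.
have p2' : 0 < 2 - p by lra.
have ab0 : 0 < a + b by lra.
have F0 : 0 <= F s0.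
  have : expR ((2 - p) * s0) * a - expR (p * s0) * a >= b.
    by move: bsmall; rewrite -er0 !powR_expR mulrBl.
  have : 0 <= expR (2 * s0) * b by rewrite mulr_ge0 ?expR_ge0 ?(ltW b0).
  by rewrite /F; lra.
have F1 : F s1 <= 0.
  have h1 : expR ((2 - p) * s1) * (a + b) <= b.
    rewrite -ler_pdivlMr// -[leRHS]lnK ?posrE ?divr_gt0// ler_expR mulrC -ler_pdivlMr//.
    by rewrite ge_min lexx orbT.
  have h2 : expR (2 * s1) * b <= expR ((2 - p) * s1) * b.
    by rewrite ler_pM2r// ler_expR; nra.
  have h3 : 0 <= expR (p * s1) * a by rewrite mulr_ge0 ?expR_ge0 ?(ltW a0).
  by rewrite /F; lra.
have cF : continuous F.
  have ce (c : R) : continuous (fun s : R => expR (c * s)).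
    by move=> s; apply: (@continuous_comp _ _ _ ( *%R c) expR);
      [exact: mulrl_continuous|exact: continuous_expR].
  move=> s; apply: cvgB; first by apply: cvgD; apply: cvgMl; exact: ce.
  by apply: cvgD; [apply: cvgMl; exact: ce|exact: cvg_cst].
have [|s] := @IVT R F s1 s0 0 s10 (continuous_subspaceT cF).
  by rewrite ge_min F1 le_max F0 orbT.
rewrite in_itv/= => /andP[_ ss0] Fs; exists (expR s); split.
- exact: expR_gt0.
- by rewrite -er0 ler_expR.
- rewrite !powR_expR -powR_mulrn ?expR_ge0// powR_expR.
  by apply/eqP; rewrite -subr_eq0 -/(F s) Fs.
Qed.

End balance.

Section level_equality.
Context {R : realType} {N : nat}.
Hypothesis N_gt0 : (0 < N)%N.
Variables alpha p : R.
Hypothesis alpha_gt0 : 0 < alpha.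
Hypothesis alpha_ltN : alpha < N%:R.
Hypothesis p1 : 1 < p.
Hypothesis p2 : p < 2.
Local Notation mu := (@lebesgue_rV R N).
Local Notation E := (@energy R N alpha).
Implicit Types (u v w f g : 'rV[R]_N -> R) (x h : 'rV[R]_N).

Let p0 : 0 < p. Proof. exact: lt_trans p1. Qed.
Let pneq0 : p != 0. Proof. by rewrite lt0r_neq0. Qed.

Lemma powR_le1_sqr (a : R) : 0 <= a -> a `^ p <= 1 + a ^+ 2.
Proof.
move=> a0; have [a1|a1] := leP a 1.
  apply: (@le_trans _ _ 1); last by rewrite lerDl sqr_ge0.
  rewrite -[leRHS](one_powR p); apply: ge0_ler_powR; rewrite ?nnegrE//; exact: ltW.
apply: (@le_trans _ _ (a ^+ 2)); last by rewrite lerDr.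
by rewrite -powR_mulrn//; apply: ler_powR; exact: ltW.
Qed.

(** As [p < 2], the density is at most [1 + u ^ 2]. *)
Lemma rint_dens_ball u (M : R) : L2 mu u -> rint mu (fun x => dens p u x * ballI M x).
Proof.
move=> lu; have mu' := L2_meas lu; have [_ su] := lu.
apply: (@le_rint _ _ _ mu _ (fun x => ballI M x + u x ^+ 2)).
- by apply: measurable_funM; [exact: (nn_dens p mu').1|exact: measurable_ballI].
- move=> x; rewrite ger0_norm; last by rewrite mulr_ge0 ?powR_ge0 ?ballI_ge0.
  have [xM|xM] := leP `|x| M; last by rewrite (ballI_out xM) mulr0 add0r sqr_ge0.
  rewrite (ballI_in xM) mulr1; apply: le_trans (powR_le1_sqr (normr_ge0 _)) _.
  by rewrite (real_normK (num_real _)).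
- by apply: rintD => //; exact: rint_ballI.
Qed.

Lemma absE u x : pos_part u x - neg_part u x = `|u x|.
Proof.
rewrite /pos_part /neg_part; have [h|h] := leP (u x) 0.
  by rewrite sub0r ler0_norm.
by rewrite subr0 gtr0_norm.
Qed.

Lemma H1_abs u : H1 u -> H1 (fun x => `|u x|) /\
  dot (fun x => `|u x|) (fun x => `|u x|) = dot u u.
Proof.
move=> hu; have hp := H1_pos N_gt0 hu; have hn := H1_neg N_gt0 hu.
rewrite (_ : (fun x => `|u x|) = fun x => pos_part u x - neg_part u x); last first.
  by apply/funext => x; rewrite absE.
split; first exact: H1B.
by rewrite dot_sqrB// dot_pos_neg// (dot_split N_gt0 hu) mulr0 subr0.
Qed.

Lemma cvg_powR1 (s : nat -> R) : s n @[n --> \oo] --> (1 : R) ->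
  s n `^ p @[n --> \oo] --> (1 : R).
Proof.
move=> s1; rewrite -[X in _ --> X](one_powR p).
apply: (cvg_comp _ (fun a : R => a `^ p) s1).
suff : {for 1, continuous (fun a : R => a `^ p)} by [].
apply: differentiable_continuous.
by apply/derivable1_diffP; apply: derivable_powR; rewrite in_itv/= ltr01.
Qed.

(** Cut off the modulus of [u]: slowly varying cut-off functions almost preserve
    the norm, and dominated convergence takes care of the energy. *)
Lemma compact_approximation u (lam : R) : nehari alpha p u -> 1 < lam ->
  exists f (K S a : R), [/\ H1 f, forall x, 0 <= f x,
    0 <= K /\ (forall x, K < `|x| -> f x = 0),
    [/\ dot f f = S, 0 < S & S <= lam * dot u u] &
    E (dens p f) (dens p f) = a%:E /\ dot u u <= lam * a].
Proof.
move=> nu l1; have [hu u0 Eu] := (nehariP N_gt0 alpha p1 u).1 nu.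
have l0 : 0 < lam by exact: lt_trans l1.
set T := dot u u in u0 Eu *.
have [hv Sv] := H1_abs hu; pose v x : R := `|u x|.
have dv : dens p v =1 dens p u by move=> x; rewrite /dens normr_id.
have nv := H1_nn p hv.
have Ev : E (dens p v) (dens p v) = T%:E by rewrite (eq_energy alpha dv dv).
have [eta [C [te e01 C0 eC ecv]]] := @cut_off_exists R N.
pose f n x := eta n x * v x.
have hf n : H1 (f n) := H1_mul (te n) hv.
have df n : dens p (f n) =1 fun x => eta n x `^ p * dens p v x.
  move=> x; rewrite /dens normrM powRM//; congr (_ `^ p * _).
  by rewrite ger0_norm//; case/andP: (e01 n x).
have he n : nn (fun x => eta n x `^ p).
  split=> [|x]; last exact: powR_ge0.
  exact: (measurableT_comp (measurable_powR p) (smooth_measurable (te n).1)).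
have e1 n x : eta n x `^ p <= 1.
  have /andP[h0 h1] := e01 n x.
  rewrite -[leRHS](one_powR p); apply: ge0_ler_powR; rewrite ?nnegrE//; exact: ltW.
have Efin : (E (dens p v) (dens p v) < +oo)%E by rewrite Ev ltry.
have cvE := energy_cut_cvg nv Efin he e1 (fun x => cvg_powR1 (ecv x)).
rewrite Ev /= in cvE.
pose c n : R := C * n.+1%:R^-1.
have c0 n : 0 <= c n by rewrite mulr_ge0.
have cc : c n @[n --> \oo] --> (0 : R).
  by rewrite -[X in _ --> X](mulr0 C); apply: cvgMr; exact: cvg_harmonic.
have cS : (1 + c n + N%:R * (c n + c n ^+ 2)) @[n --> \oo] --> (1 : R).
  have : (1 + c n + N%:R * (c n + c n ^+ 2)) @[n --> \oo] --> (1 + 0 + N%:R * (0 + 0 * 0) : R).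
    apply: cvgD; first by apply: cvgD => //; exact: cvg_cst.
    by apply: cvgMr; apply: cvgD => //; exact: (cvgM cc cc).
  by rewrite !(addr0, mulr0).
have Tl : T / lam < T by rewrite ltr_pdivrMr// ltr_pMr.
near \oo => n.
have nC : 1 + c n + N%:R * (c n + c n ^+ 2) <= lam.
  by near: n; exact: (cvgr_le 1 cS).
have nE : T / lam <= fine (E (fun x => eta n x `^ p * dens p v x) (fun x => eta n x `^ p * dens p v x)).
  by near: n; exact: (cvgr_ge T cvE).
have Ele : (E (dens p (f n)) (dens p (f n)) <= T%:E)%E.
  rewrite -Ev; apply: (energy_le alpha (H1_nn p (hf n)) nv (H1_nn p (hf n)) nv);
  by move=> y; rewrite df; apply: ler_piMl; [exact: powR_ge0|exact: e1].
move: nE; rewrite -(eq_energy alpha (df n) (df n)) => nE.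
have := energy_ge0 alpha (H1_nn p (hf n)) (H1_nn p (hf n)).
move: Ele nE; case Ef : (E (dens p (f n)) (dens p (f n))) => [a| |]//= _ nE _.
have a0 : 0 < a by apply: lt_le_trans nE; rewrite divr_gt0.
have [M [K [M0 K0 _ HK]]] := test_bounded (te n).
exists (f n), K, (dot (f n) (f n)), a; split=> //.
- by move=> x; case/andP: (e01 n x) => h0 _; exact: (mulr_ge0 h0 (normr_ge0 _)).
- by split=> // x /HK ex; rewrite /f ex mul0r.
- split=> //.
    apply: (dot_gt0 N_gt0 (hf n)) => z.
    by move: a0; have := energy_ae_zero alpha p1 (H1_nn p (hf n)) (hf n) z; rewrite Ef => -[->]; rewrite ltxx.
  apply: le_trans (dot_cut N_gt0 (te n) (c0 n) hv _ (eC n)) _.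
    by move=> x; case/andP: (e01 n x) => h0 h1; rewrite ger0_norm.
  by rewrite Sv; apply: ler_wpM2r => //; exact: ltW.
- by split=> //; rewrite mulrC -ler_pdivrMr.
Unshelve. all: by end_near.
Qed.

(** A compactly supported approximation [f] of the modulus of [u] and a distant
    translate of it, taken with a small factor and the opposite sign, form a
    nodal competitor. As the interaction [b] tends to 0, so may the factor [r],
    because [p < 2]: the action tends to that of [u] alone. *)
Lemma c_nod_le_action u : nehari alpha p u -> (c_nod N alpha p <= (action alpha p u)%:E)%E.
Proof.
move=> nu; have [hu u0 Eu] := (nehariP N_gt0 alpha p1 u).1 nu.
rewrite (action_nehari N_gt0 p1 nu); set T := dot u u in u0 Eu *.
have k0 := kappa_gt0 p1.
have kT : 0 < kappa p * T by rewrite mulr_gt0.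
apply/lee_addgt0Pr => e e0; rewrite -EFinD.
pose q : R := (p - 1)^-1; have q0 : 0 < q by rewrite invr_gt0 subr_gt0.
pose eps := e / (kappa p * T); have eps0 : 0 < eps by rewrite divr_gt0.
have q2 : 0 < 2 * q + 2 by rewrite addr_gt0// mulr_gt0.
pose lam := (1 + eps) `^ (2 * q + 2)^-1.
have l1 : 1 < lam.
  rewrite -[ltLHS](one_powR (2 * q + 2)^-1); apply: gt0_ltr_powR; rewrite ?nnegrE ?invr_gt0//.
    by rewrite ltW// addr_gt0.
  by rewrite ltrDl.
have l0 : 0 < lam by exact: lt_trans l1.
have lamE : (lam ^+ 2) `^ q * lam ^+ 2 = 1 + eps.
  rewrite -powR_mulrn ?(ltW l0)// -powRrM -powRD; last first.
    by rewrite (lt0r_neq0 l0) implybT.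
  by rewrite -powRrM mulVf ?lt0r_neq0// powRr1// addr_ge0 ?(ltW eps0).
have [f [K [S [a [hf f0 [K0 fK] [Sf S0 Sle] [Ef aT]]]]]] := compact_approximation nu l1.
have a0 : 0 < a by have := lt_le_trans u0 aT; rewrite pmulr_rgt0.
(* [r <= r0] must be below 1 for the balance, and [r ^ 2 <= lam - 1] for the
   norm of the small bump *)
pose r0 := Num.min 2^-1 (lam - 1).
have r00 : 0 < r0 by rewrite lt_min invr_gt0 ltr0n/= subr_gt0.
have r02 : r0 <= 2^-1 by rewrite ge_min lexx.
have r01 : r0 < 1 by apply: le_lt_trans r02 _; lra.
have rl : r0 <= lam - 1 by rewrite ge_min lexx orbT.
have beta0 : 0 < (r0 `^ (2 - p) - r0 `^ p) * a.
  rewrite mulr_gt0// subr_gt0.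
  have -> : r0 = expR (ln r0) by rewrite lnK.
  rewrite !powR_expR ltr_expR; have : ln r0 < 0 by rewrite ln_lt0// r00.
  by move: p1; nra.
have nf := H1_nn p hf.
have fi : rint mu (dens p f).
  have := rint_dens_ball K (H1_L2 hf); rewrite /rint; congr (integrable _ _ _).
  apply/funext => x /=; have [xK|xK] := leP `|x| K; first by rewrite (ballI_in xK) mulr1.
  by rewrite (ballI_out xK) mulr0 /dens fK// normr0 powR0.
have dK x : K < `|x| -> dens p f x = 0 by move=> xK; rewrite /dens fK// normr0 powR0.
have [h [hK hB]] := energy_far N_gt0 alpha_ltN nf nf fi fi K0 dK dK beta0.
pose w := tr h f; have hw : H1 w := H1_tr h hf.
have fz : ~ ae_zero f.
  by move=> z; move: a0; have := energy_ae_zero alpha p1 nf hf z; rewrite Ef => -[->]; rewrite ltxx.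
have wz : ~ ae_zero w.
  move=> z; have := energy_ae_zero alpha p1 (H1_nn p hw) hw z.
  by rewrite (energy_tr alpha h nf nf) Ef => -[aa]; move: a0; rewrite aa ltxx.
have A0 : @riesz_const R N alpha != 0.
  by apply: (@riesz_const_neq0 _ _ alpha (dens p f) (dens p f)); rewrite Ef lte_fin.
have := energy_gt0 N_gt0 A0 nf (H1_nn p hw) (dens_ae0 p1 fz) (dens_ae0 p1 wz).
move: hB; rewrite -[tr h (dens p f)]/(dens p w).
case Eb : (E (dens p f) (dens p w)) => [b| |]//; rewrite lee_fin lte_fin => bb' b0.
have [r [rp rr0 bal]] := balance_exists p1 p2 a0 b0 (introT andP (conj r00 r01)) bb'.
have Sw : dot w w = S by rewrite (dot_tr N_gt0 h hf hf).
have Ew : E (dens p w) (dens p w) = a%:E by rewrite -Ef -(energy_tr alpha h nf nf).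
have w0 x : 0 <= w x by exact: f0.
have fw x : f x * w x = 0.
  have [xK|/fK ->] := leP `|x| K; last by rewrite mul0r.
  have [xhK|/fK xh] := leP `|x + h| K; last by rewrite /w /tr xh mulr0.
  exfalso; have : `|h| <= `|x + h| + `|x|.
    by rewrite -{1}(addrK x h) (addrC h) ler_normB.
  by move: hK xK xhK; lra.
apply: le_trans (c_nod_le N_gt0 p1 hf hw f0 w0 fw Sf Sw S0 a0 (ltW b0) rp Ef Ew Eb bal) _.
rewrite lee_fin -/q.
have Q0 : 0 < r `^ p by exact: powR_gt0.
have d0 : a <= a + r `^ p * b by rewrite lerDl mulr_ge0 ?(ltW b0) ?(ltW Q0).
have d1 : 0 < a + r `^ p * b by exact: lt_le_trans d0.
have ratio : S / (a + r `^ p * b) <= lam ^+ 2.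
  rewrite ler_pdivrMr//; apply: le_trans Sle _; rewrite expr2 -mulrA.
  rewrite ler_pM2l//; apply: le_trans aT _; by rewrite ler_pM2l.
have ratioq : (S / (a + r `^ p * b)) `^ q <= (lam ^+ 2) `^ q.
  apply: ge0_ler_powR => //; rewrite ?nnegrE; first exact: ltW.
    by rewrite divr_ge0// ltW.
  by rewrite exprn_ge0// ltW.
have r2 : 1 + r ^+ 2 <= lam.
  have : r ^+ 2 <= r by rewrite expr2 ler_piMl ?(ltW rp)//; apply: le_trans rr0 _; exact: ltW.
  by lra.
have -> : kappa p * T + e = kappa p * ((lam ^+ 2) `^ q * (lam * T) * lam).
  rewrite (_ : _ * _ * lam = (lam ^+ 2) `^ q * lam ^+ 2 * T); last by ring.
  by rewrite lamE /eps; field; rewrite !lt0r_neq0.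
rewrite -!mulrA ler_pM2l// !mulrA.
apply: ler_pM => //.
- by rewrite mulr_ge0 ?powR_ge0 ?(ltW S0).
- by rewrite addr_ge0// sqr_ge0.
- by rewrite -mulrA; apply: ler_pM => //; rewrite ?powR_ge0 ?(ltW S0).
Qed.

Lemma c_nod_eq_c_0 : c_nod N alpha p = c_0 N alpha p.
Proof.
apply/eqP; rewrite eq_le (c_0_le_c_nod N_gt0 alpha p1) andbT.
by apply: le_ereal_inf_tmp => _ [u nu <-]; exact: c_nod_le_action.
Qed.

End level_equality.

(** * A strong maximum principle *)

Section maximum_principle.
Context {R : realType} {N : nat}.
Implicit Types (g : 'rV[R]_N -> R) (x y h c : 'rV[R]_N) (i : 'I_N).
Local Notation e i := (delta_mx ord0 i : 'rV[R]_N).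

(** Move along the coordinate directions one after the other. *)
Lemma coord_lipschitz_continuous g (C : R) : 0 <= C ->
  (forall h i s, `|g (h + s *: e i) - g h| <= C * `|s|) -> continuous g.
Proof.
move=> C0 gC; have H (r : seq 'I_N) h (v : 'rV[R]_N) :
    `|g (h + \sum_(i <- r) v ord0 i *: e i) - g h| <= C * \sum_(i <- r) `|v ord0 i|.
  elim: r h => [|i r IH] h; first by rewrite !big_nil addr0 subrr normr0 mulr0.
  rewrite !big_cons addrA mulrDr; have h1 := gC h i (v ord0 i).
  have h2 := IH (h + v ord0 i *: e i).
  set a := g (_ + \sum_(j <- r) _) in h2 *; set b := g (h + _) in h1 h2.
  rewrite (_ : a - g h = (a - b) + (b - g h)); last by rewrite addrA subrK.
  by apply: le_trans (ler_normD _ _) _; rewrite addrC lerD.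
have CN0 : 0 <= C * N%:R by rewrite mulr_ge0.
have HL x y : `|g x - g y| <= C * N%:R * `|x - y|.
  have := H (index_enum 'I_N) y (x - y).
  have Hx : y + (x - y) = x by rewrite addrC subrK.
  rewrite -(row_sum_delta (x - y)) Hx => /le_trans; apply.
  rewrite -mulrA; apply: ler_wpM2l => //.
  apply: (@le_trans _ _ (\sum_(i < N) `|x - y|)).
    by apply: ler_sum => i _; exact: coord_le_norm.
  by rewrite sumr_const card_ord mulr_natl.
move=> x A /nbhs_ballP[eps /= eps0 HA]; apply/nbhs_ballP.
have d0 : 0 < eps / (C * N%:R + 1) by rewrite divr_gt0// ltr_wpDl.
exists (eps / (C * N%:R + 1)) => //= y; rewrite -ball_normE/= => xy.
apply: HA; rewrite -ball_normE/=; apply: le_lt_trans (HL x y) _.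
apply: (@le_lt_trans _ _ ((C * N%:R + 1) * `|x - y|)).
  by apply: ler_wpM2r => //; rewrite lerDl.
by rewrite mulrC -ltr_pdivlMr// ltr_wpDl.
Qed.

Definition sqdist c y : R := \sum_i (y ord0 i - c ord0 i) ^+ 2.

Lemma sqdist_continuous c : continuous (sqdist c).
Proof.
have H (r : seq 'I_N) : continuous (fun y : 'rV[R]_N => \sum_(i <- r) (y ord0 i - c ord0 i) ^+ 2).
  elim: r => [|i r IH].
    rewrite (_ : (fun y => _) = cst 0); first exact: cst_continuous.
    by apply/funext => y; rewrite big_nil.
  rewrite (_ : (fun y => _) = (fun y : 'rV[R]_N => (y ord0 i - c ord0 i) * (y ord0 i - c ord0 i))
      \+ (fun y : 'rV[R]_N => \sum_(i <- r) (y ord0 i - c ord0 i) ^+ 2)); last first.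
    by apply/funext => y /=; rewrite big_cons expr2.
  have H : continuous (fun y : 'rV[R]_N => y ord0 i - c ord0 i).
    move=> y; apply: (@continuousB _ _ _ (fun y : 'rV[R]_N => y ord0 i) (cst (c ord0 i))).
      exact: coord_continuous.
    exact: cst_continuous.
  move=> y; apply: continuousD; last exact: IH.
  by apply: (@continuousM _ _ _ _ y (H y) (H y)).
move=> y; exact: H.
Qed.

Lemma sqdist_ge c y : `|y - c| ^+ 2 <= sqdist c y.
Proof.
have q0 : 0 <= sqdist c y by apply: sumr_ge0 => i _; exact: sqr_ge0.
rewrite -(sqr_sqrtr q0) lerXn2r// ?nnegrE ?sqrtr_ge0//.
apply: norm_rV_le => [|i]; first exact: sqrtr_ge0.
rewrite -sqrtr_sqr; apply: ler_wsqrtr; rewrite /sqdist (bigD1 i)//= !mxE.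
by rewrite lerDl; apply: sumr_ge0 => j _; exact: sqr_ge0.
Qed.

Lemma sqdist_shift c y i (s : R) :
  sqdist c (y + s *: e i) = sqdist c y + (2 * s * (y ord0 i - c ord0 i) + s ^+ 2).
Proof.
rewrite /sqdist (bigD1 i)//= [in RHS](bigD1 i)//= !mxE !eqxx mulr1.
rewrite (eq_bigr (fun j => (y ord0 j - c ord0 j) ^+ 2)); last first.
  by move=> j ji; rewrite !mxE (negbTE ji) mulr0 addr0.
by ring.
Qed.

Lemma expRD_ge (a : R) : 2 + a ^+ 2 / 4 <= expR a + expR (- a).
Proof.
wlog a0 : a / 0 <= a => [H|].
  have [/H//|/ltW a0] := leP 0 a.
  by have := H (- a); rewrite oppr_ge0 sqrrN opprK (addrC (expR (- a))); apply.
have h1 : 1 + a / 2 <= expR (a / 2) by exact: expR_ge1Dx.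
have h2 : expR (- (a / 2)) <= 1 by rewrite expR_le1 oppr_le0 divr_ge0.
have h3 : expR (a / 2) * expR (- (a / 2)) = 1 by rewrite -expRD subrr expR0.
have h4 : expR a = expR (a / 2) ^+ 2 by rewrite expr2 -expRD -splitr.
have h5 : expR (- a) = expR (- (a / 2)) ^+ 2.
  by rewrite expr2 -expRD -opprD -splitr.
rewrite h4 h5; set p := expR (a / 2) in h1 h3 *; set q := expR _ in h2 h3 *.
have : (a / 2) ^+ 2 <= (p - q) ^+ 2.
  by rewrite lerXn2r// ?nnegrE; lra.
by move: h3; nra.
Qed.

Definition barrier (k : R) c y : R := expR (- k * sqdist c y).

(** Away from the centre, the leading term in [k] makes a steep Gaussian a
    strict subsolution. *)
Lemma barrier_second_difference c y i (k s : R) : 0 <= k ->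
  barrier k c y * (s ^+ 2 * (k ^+ 2 * (y ord0 i - c ord0 i) ^+ 2 - 2 * k
    - k ^+ 3 * s ^+ 2 * (y ord0 i - c ord0 i) ^+ 2)) <=
  barrier k c (y + s *: e i) + barrier k c (y + (- s) *: e i) - 2 * barrier k c y.
Proof.
move=> k0; pose w := barrier k c; rewrite -/w {2 3}/w /barrier !sqdist_shift; set t := y ord0 i - c ord0 i.
set a := 2 * k * s * t.
have E1 : - k * (sqdist c y + (2 * s * t + s ^+ 2)) =
  - k * sqdist c y + (- k * s ^+ 2 + (- a)) by rewrite /a; ring.
have E2 : - k * (sqdist c y + (2 * - s * t + (- s) ^+ 2)) =
  - k * sqdist c y + (- k * s ^+ 2 + a) by rewrite /a; ring.
have Ew : expR (- k * sqdist c y) = w y by [].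
rewrite E1 E2 !expRD Ew (_ : _ - 2 * w y =
  w y * (expR (- k * s ^+ 2) * (expR a + expR (- a)) - 2)); last by ring.
rewrite ler_pM2l ?expR_gt0//.
have h1 : 1 + - k * s ^+ 2 <= expR (- k * s ^+ 2) by exact: expR_ge1Dx.
have h2 := expRD_ge a.
have a2 : 0 <= a ^+ 2 by exact: sqr_ge0.
have h3 : (1 + - k * s ^+ 2) * (2 + a ^+ 2 / 4) <=
    expR (- k * s ^+ 2) * (expR a + expR (- a)).
  apply: (@le_trans _ _ (expR (- k * s ^+ 2) * (2 + a ^+ 2 / 4))).
    by apply: ler_wpM2r => //; lra.
  by apply: ler_wpM2l => //; exact: expR_ge0.
apply: le_trans (lerB h3 (lexx 2)).
by rewrite le_eqVlt; apply/orP; left; apply/eqP; rewrite /a; field.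
Qed.

(** The strong maximum principle for continuous supersolutions of
    [- Delta g + g >= 0], in terms of limits of second differences: where [g]
    vanishes, a multiple of a barrier can be slid below [g] until it touches,
    away from the centre of the barrier, which violates the equation. *)
Lemma strong_maximum_principle g (s : nat -> R) (L : 'rV[R]_N -> R) h0 :
  continuous g -> (forall y, 0 <= g y) -> (forall n, s n != 0) ->
  s n @[n --> \oo] --> (0 : R) ->
  (forall y, \sum_i (g (y + s n *: e i) + g (y + (- s n) *: e i) - 2 * g y) / s n ^+ 2
     @[n --> \oo] --> L y) ->
  (forall y, L y <= g y) -> g h0 = 0 -> forall c, g c = 0.
Proof.
move=> cg g0 sn0 scv gL Lg gh0 c; apply/eqP; rewrite eq_le g0 andbT leNgt.
apply/negP => gc0; pose m := g c / 2.
have m0 : 0 < m by rewrite divr_gt0.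
have [rho rho0 Hrho] : exists2 rho, 0 < rho & forall y, `|y - c| <= rho -> m <= g y.
  have : \forall y \near c, m <= g y.
    by apply: (cvgr_ge (g c) (cg c)); rewrite /m; lra.
  move=> /nbhs_ballP[r /= r0 Hr]; exists (r / 2); first by rewrite divr_gt0.
  move=> y yr; apply: Hr; rewrite -ball_normE/= distrC; lra.
(* chosen so that [k ^ 2 * rho ^ 2 / 2 - 2 * k * N >= 1], which makes the barrier
   a subsolution at distance at least [rho] from its centre *)
pose k : R := (4 * N%:R + 2) / rho ^+ 2 + 1.
have k1 : 1 <= k by rewrite lerDr divr_ge0// ?sqr_ge0// addr_ge0// mulr_ge0.
have k0 : 0 < k by exact: lt_le_trans k1.
pose w := barrier k c.
have wp y : 0 < w y by exact: expR_gt0.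
have w1 y : w y <= 1.
  rewrite /w /barrier -expR0 ler_expR mulNr oppr_le0 mulr_ge0 ?(ltW k0)//.
  by apply: le_trans (sqdist_ge c y); exact: sqr_ge0.
(* lowering the barrier by [d] makes it negative far away and keeps it positive
   at [h0], so that [g - m * (w - d)] attains a negative minimum *)
pose d := w h0 / 2; have d0 : 0 < d by rewrite divr_gt0.
pose G y := g y - m * (w y - d).
have Gh0 : G h0 < 0 by rewrite /G gh0 sub0r oppr_lt0 mulr_gt0// subr_gt0 /d; have := wp h0; lra.
have Gge y : w y <= d -> 0 <= G y.
  by move=> wd; rewrite /G subr_ge0 (le_trans _ (g0 y))// pmulr_rle0// subr_le0.
pose M : R := `|ln d| + 1.
have wM y : M < `|y - c| -> w y <= d.
  move=> My; rewrite -[leRHS]lnK ?posrE// ler_expR mulNr lerNl.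
  have n0 := normr_ge0 (ln d).
  have h1 : `|ln d| <= sqdist c y.
    by apply: le_trans (sqdist_ge c y); rewrite /M in My; nra.
  have : - ln d <= `|ln d| by rewrite -normrN ler_norm.
  by nra.
pose K : R := M + `|c|.
have HK y : K < `|y| -> 0 <= G y.
  move=> Ky; apply: Gge; apply: wM; have : `|y| <= `|y - c| + `|c|.
    by rewrite -{1}(subrK c y) ler_normD.
  by rewrite /K in Ky; lra.
have cw : continuous w.
  move=> y; apply: (@continuous_comp _ _ _ (fun z => - k * sqdist c z) expR).
    apply: (@continuous_comp _ _ _ (sqdist c) ( *%R (- k))); first exact: sqdist_continuous.
    exact: mulrl_continuous.
  exact: continuous_expR.
have cG : continuous G.
  move=> y; apply: (@continuousB _ _ _ g (fun y => m * (w y - d))); first exact: cg.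
  apply: (@continuous_comp _ _ _ (fun y => w y - d) ( *%R m)); last exact: mulrl_continuous.
  apply: (@continuousB _ _ _ w (cst d)); first exact: cw.
  exact: cst_continuous.
pose A := [set y : 'rV[R]_N | `|y| <= K].
have Ah0 : A h0 by rewrite /A/= leNgt; apply/negP => /HK; rewrite leNgt Gh0.
have cA : compact A by exact: compact_norm_le.
have [y yA Gmin] := EVT_min_rV (ex_intro _ h0 Ah0) cA (continuous_subspaceT cG).
have Gy : G y < 0 by apply: le_lt_trans Gh0; apply: Gmin; rewrite inE.
have Gall z : G y <= G z.
  have [zK|/HK Gz] := leP `|z| K; first by apply: Gmin; rewrite inE.
  by apply: le_trans Gz; exact: ltW.
have yrho : rho < `|y - c|.
  rewrite ltNge; apply/negP => /Hrho my.
  move: Gy; rewrite /G ltNge => /negP; apply; rewrite subr_ge0.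
  by have := w1 y; nra.
have qy : rho ^+ 2 <= sqdist c y.
  by apply: le_trans (sqdist_ge c y); rewrite lerXn2r// ?nnegrE// ltW.
(* at a minimum of [G] the second differences of [G] are nonnegative *)
have sd n i : m * (w (y + s n *: e i) + w (y + (- s n) *: e i) - 2 * w y) <=
    g (y + s n *: e i) + g (y + (- s n) *: e i) - 2 * g y.
  by have := Gall (y + s n *: e i); have := Gall (y + (- s n) *: e i); rewrite /G; lra.
have : m * w y <= L y.
  apply: (cvgr_to_ge (gL y)); near=> n.
  have s2 : 0 < s n ^+ 2 by rewrite exprn_even_gt0//= sn0.
  have ssmall : s n ^+ 2 <= (2 * k)^-1.
    have sn : `|s n| <= (2 * k)^-1.
      by near: n; apply: cvgr_le (cvg_norm scv) _ _; rewrite normr0 invr_gt0 mulr_gt0.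
    rewrite -(real_normK (num_real _)) expr2; apply: le_trans (sn).
    rewrite -[leRHS]mulr1; apply: ler_wpM2l => //; apply: le_trans sn _.
    by rewrite invf_le1 ?mulr_gt0//; lra.
  apply: (@le_trans _ _ (\sum_i m * w y * (k ^+ 2 * (y ord0 i - c ord0 i) ^+ 2 - 2 * k
      - k ^+ 3 * s n ^+ 2 * (y ord0 i - c ord0 i) ^+ 2))).
    rewrite -mulr_sumr -[leLHS]mulr1; apply: ler_wpM2l; first by rewrite mulr_ge0// ltW.
    rewrite (eq_bigr (fun i => (k ^+ 2 - k ^+ 3 * s n ^+ 2) * (y ord0 i - c ord0 i) ^+ 2
      + - (2 * k))); last by move=> i _; ring.
    rewrite big_split/= -mulr_sumr -/(sqdist c y) sumr_const card_ord.
    rewrite -mulr_natr.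
    have h1 : k ^+ 2 / 2 <= k ^+ 2 - k ^+ 3 * s n ^+ 2.
      have : k ^+ 3 * s n ^+ 2 <= k ^+ 3 * (2 * k)^-1.
        by apply: ler_wpM2l => //; rewrite exprn_ge0// ltW.
      rewrite (_ : k ^+ 3 * (2 * k)^-1 = k ^+ 2 / 2); first by lra.
      by field; exact: lt0r_neq0.
    have h2 : k ^+ 2 / 2 * rho ^+ 2 <= (k ^+ 2 - k ^+ 3 * s n ^+ 2) * sqdist c y.
      by apply: ler_pM => //; rewrite ?divr_ge0 ?sqr_ge0.
    have h3 : 4 * N%:R + 2 <= k * rho ^+ 2.
      have -> : k * rho ^+ 2 = 4 * N%:R + 2 + rho ^+ 2.
        by rewrite /k; field; exact: lt0r_neq0.
      by rewrite lerDl sqr_ge0.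
    have h4 : k ^+ 2 / 2 * rho ^+ 2 = k / 2 * (k * rho ^+ 2) by ring.
    move: h2; rewrite h4 => h2.
    have h5 : k / 2 * (4 * N%:R + 2) <= k / 2 * (k * rho ^+ 2).
      by apply: ler_wpM2l => //; rewrite divr_ge0// ltW.
    by apply: (@le_trans _ _ (k / 2 * (4 * N%:R + 2) + - (2 * k) * N%:R)); [lra|lra].
  apply: ler_sum => i _; rewrite ler_pdivlMr//; apply: le_trans (sd n i).
  have := barrier_second_difference c y i (s n) (ltW k0); rewrite -/(w _) => H.
  have := ler_wpM2l (ltW m0) H; apply: le_trans.
  by rewrite le_eqVlt; apply/orP; left; apply/eqP; ring.
apply/negP; rewrite -ltNge; apply: le_lt_trans (Lg y) _.
move: Gy; rewrite /G subr_lt0 => /lt_le_trans; apply.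
by rewrite ler_pM2l// lerBlDr lerDl ltW.
Unshelve. all: by end_near.
Qed.

End maximum_principle.

(** * Minimisers do not change sign *)

Section correlation.
Context {R : realType} {N : nat}.
Hypothesis N_gt0 : (0 < N)%N.
Local Notation mu := (@lebesgue_rV R N).
Local Notation e i := (delta_mx ord0 i : 'rV[R]_N).
Implicit Types (f z : 'rV[R]_N -> R) (x h : 'rV[R]_N) (i : 'I_N).

(** The correlation of [z] and [f] is a mollification of [z] by [f]: second
    differences of it converge although [z] has only weak derivatives. *)
Definition corr z f h : R := ip mu z (tr h f).

Lemma tr_shift s i h f x : s != 0 ->
  tr (h + s *: e i) f x = tr h f x + s * dq s i (tr h f) x.
Proof.
move=> s0; rewrite /dq /tr mulrCA divff// mulr1 [RHS]addrC subrK.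
by congr f; rewrite addrA addrAC.
Qed.

(** The difference quotients fall on [f], where they are bounded in [L^2]. *)
Lemma corr_lipschitz z f F : L2 mu z -> sob f F -> exists2 C : R, 0 <= C &
  forall h i s, `|corr z f (h + s *: e i) - corr z f h| <= C * `|s|.
Proof.
move=> lz sf; have [lf HF] := sf.
exists (nrm mu z * \sum_i nrm mu (F i)).
  by rewrite mulr_ge0 ?nrm_ge0//; apply: sumr_ge0 => i _; exact: nrm_ge0.
move=> h i s; have [->|s0] := eqVneq s 0.
  by rewrite scale0r addr0 subrr !normr0 mulr0.
have [lh HFh] := sob_tr h sf; have [lFi wFi] := HFh i.
have ld := L2_dq s i lh.
have -> : corr z f (h + s *: e i) - corr z f h = s * ip mu z (dq s i (tr h f)).
  rewrite /corr (@eq_ip _ _ _ mu z z _ (fun x => tr h f x + s * dq s i (tr h f) x))//.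
    by rewrite ipDr ?ipZr//; [rewrite addrC addKr|exact: L2Z].
  by move=> x; exact: tr_shift.
rewrite normrM mulrC; apply: ler_wpM2r => //.
apply: le_trans (ip_bound lz ld) _; apply: ler_wpM2l; first exact: nrm_ge0.
apply: (@le_trans _ _ (nrm mu (tr h (F i)))).
  by apply: ler_wsqrtr; exact: (dq_bound N_gt0).
have [lF _] := HF i.
rewrite /nrm ip_tr; [|exact: L2_meas lF|exact: L2_meas lF].
by rewrite (bigD1 i)//= lerDl; apply: sumr_ge0 => j _; exact: nrm_ge0.
Qed.

Lemma corr_second_difference z f (s : R) i h : L2 mu z -> L2 mu f -> s != 0 ->
  (corr z f (h + s *: e i) + corr z f (h + (- s) *: e i) - 2 * corr z f h) / s ^+ 2 =
  - ip mu (dq s i z) (dq s i (tr h f)).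
Proof.
move=> lz lf s0; have lh := L2_tr h lf; have ld := L2_dq s i lh.
rewrite dq_adj// opprK; have ldd := L2_dq (- s) i ld.
have l1 := L2_tr (h + s *: e i) lf; have l2 := L2_tr (h + (- s) *: e i) lf.
apply: (mulIf (expf_neq0 2 s0)); rewrite divfK ?expf_neq0// [RHS]mulrC -(@ipZr _ _ _ mu (s ^+ 2) _ _ ldd lz).
rewrite (@eq_ip _ _ _ mu z z _ (fun x => (tr (h + s *: e i) f x + tr (h + (- s) *: e i) f x)
    - 2 * tr h f x))//; last first.
  move=> x; rewrite /dq /tr -!addrA [_ *: e i + h]addrC.
  rewrite (_ : - s *: e i + (h + s *: e i) = h); last first.
    by rewrite addrCA scaleNr addNr addr0.
  by rewrite [- s *: e i + h]addrC; field; exact: s0.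
by rewrite ipBr ?ipDr ?ipZr//; [exact: L2D|exact: L2Z].
Qed.

(** One difference quotient is moved to each factor. *)
Lemma corr_laplacian z Z f F (s : nat -> R) h : sob z Z -> sob f F ->
  (forall n, s n != 0) -> s n @[n --> \oo] --> (0 : R) ->
  \sum_i (corr z f (h + s n *: e i) + corr z f (h + (- s n) *: e i) - 2 * corr z f h)
    / s n ^+ 2 @[n --> \oo] --> corr z f h - dot z (tr h f).
Proof.
move=> sz sf s0 scv; have [lz HZ] := sz; have [lf _] := sf.
have sh := sob_tr h sf; have [lh HF] := sh.
rewrite (dotE N_gt0 sz sh) /corr opprD addrC subrK -sumrN.
have H i : (corr z f (h + s n *: e i) + corr z f (h + (- s n) *: e i) - 2 * corr z f h)
    / s n ^+ 2 @[n --> \oo] --> - ip mu (Z i) (tr h (F i)).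
  have [lZ wZ] := HZ i; have [lF wF] := HF i.
  apply: (@cvg_ext R (fun n => - ip mu (dq (s n) i z) (dq (s n) i (tr h f)))).
    by move=> n; rewrite corr_second_difference.
  apply: cvgN; apply: cvg_ip2 => //; [by move=> n; exact: L2_dq|by move=> n; exact: L2_dq| |].
    exact: (dq_cvg_weak_partial N_gt0).
  exact: (dq_cvg_weak_partial N_gt0).
by apply: cvg_big => // [|i _]; [exact: add_continuous|exact: H].
Qed.

(** By Tonelli and translation invariance, the integral of a correlation is the
    product of the integrals of the two functions. *)
Lemma corr_eq0 z f : L2 mu z -> rint mu f -> (forall x, 0 <= z x) ->
  (forall x, 0 <= f x) -> (forall h, rint mu (fun x => z x * tr h f x)) ->
  (forall h, corr z f h = 0) -> ~ ae_zero f -> ae_zero z.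
Proof.
move=> lz fi z0 f0 zfi zf f_neq; have mf := rint_meas fi; have mz := L2_meas lz.
have [F F0 FE] : exists2 F : R, 0 < F & (\int[mu]_x (f x)%:E = F%:E)%E.
  exists (\int[mu]_x f x); last by rewrite EFin_Rintegral.
  rewrite lt_neqAle Rintegral_ge0// andbT; apply/negP => /eqP F0.
  by apply: f_neq; apply: ge0_Rintegral_eq0.
have T : (\int[mu]_h \int[mu]_x (z x * f (x + h))%:E =
          \int[mu]_x \int[mu]_h (z x * f (x + h))%:E)%E.
  apply: (fubini_tonelli (fun w : 'rV[R]_N * 'rV[R]_N => (z w.2 * f (w.2 + w.1))%:E)).
    apply/measurable_EFinP; apply: measurable_funM.
      exact: (measurableT_comp mz measurable_snd).
    apply: (measurableT_comp mf); apply: measurable_fun_rV => i.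
    rewrite (_ : (fun _ => _) = fun w : 'rV[R]_N * 'rV[R]_N =>
      (w.2 ord0 i : measurableTypeR R) + w.1 ord0 i); last by apply/funext => w; rewrite !mxE.
    by apply: measurable_funD;
      [exact: (measurableT_comp (measurable_coord i) measurable_snd)
      |exact: (measurableT_comp (measurable_coord i) measurable_fst)].
  by move=> w; rewrite lee_fin mulr_ge0.
have inner x : (\int[mu]_h (z x * f (x + h))%:E = (z x * F)%:E)%E.
  under eq_integral do rewrite EFinM.
  rewrite ge0_integralZl_EFin; first last.
  - exact: z0.
  - apply/measurable_EFinP; rewrite (_ : (fun h => _) = tr x f); first exact: measurable_tr.
    by apply/funext => h; rewrite /tr addrC.
  - by move=> h _; rewrite lee_fin.
  - exact: measurableT.
  rewrite EFinM -FE; congr (_ * _)%E.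
  rewrite -[RHS](@ge0_integral_translation R N (fun y => (f y)%:E) x).
  - by apply: eq_integral => h _; rewrite addrC.
  - exact/measurable_EFinP.
  - by move=> y; rewrite lee_fin.
have T0 : (\int[mu]_x (z x * F)%:E = 0)%E.
  rewrite -(eq_integral _ _ (fun x _ => inner x)) -T.
  rewrite (eq_integral (cst 0%E)); first exact: integral0.
  by move=> h _; rewrite -(EFin_Rintegral (zfi h)); congr (_%:E); exact: zf.
have zF0 x : 0 <= z x * F := mulr_ge0 (z0 x) (ltW F0).
have mzF : measurable_fun setT (fun x => z x * F) by exact: measurable_funM.
have zFi : rint mu (fun x => z x * F) by apply: (ge0_rint mzF zF0); rewrite T0.
have zF_int : \int[mu]_x (z x * F) = 0 by rewrite /Rintegral T0.
apply: filterS (ge0_Rintegral_eq0 zFi zF0 zF_int) => x /eqP.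
by rewrite mulf_eq0 (gt_eqF F0) orbF => /eqP.
Qed.

End correlation.

Section non_achievement.
Context {R : realType} {N : nat}.
Hypothesis N_gt0 : (0 < N)%N.
Variables alpha p : R.
Hypothesis alpha_gt0 : 0 < alpha.
Hypothesis alpha_ltN : alpha < N%:R.
Hypothesis p1 : 1 < p.
Hypothesis p2 : p < 2.
Local Notation mu := (@lebesgue_rV R N).
Local Notation E := (@energy R N alpha).
Implicit Types (u v w f : 'rV[R]_N -> R) (x h : 'rV[R]_N).

Let p0 : 0 < p. Proof. exact: lt_trans p1. Qed.

Lemma powRD_le (a b : R) : 0 <= a -> 0 <= b ->
  (a + b) `^ p <= 2 `^ p * (a `^ p + b `^ p).
Proof.
move=> a0 b0; wlog ba : a b a0 b0 / b <= a => [H|].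
  have [/H|/ltW /H] := leP b a; first exact.
  by rewrite addrC (addrC (b `^ p)); apply.
apply: (@le_trans _ _ ((2 * a) `^ p)).
  by apply: ge0_ler_powR; rewrite ?nnegrE ?addr_ge0 ?mulr_ge0 ?(ltW p0)//; lra.
by rewrite powRM//; apply: ler_wpM2l; rewrite ?powR_ge0// lerDl powR_ge0.
Qed.

Section minimiser.
Variable u : 'rV[R]_N -> R.
Hypothesis nod_u : nehari_nod alpha p u.
Hypothesis min_u : (action alpha p u)%:E = c_0 N alpha p.

Let nu : nehari alpha p u := nehari_nod_sub N_gt0 p1 nod_u.
Let hu : H1 u. Proof. by case: nu. Qed.
Let hp : H1 (pos_part u) := H1_pos N_gt0 hu.
Let hn : H1 (neg_part u) := H1_neg N_gt0 hu.
Let Eu : E (dens p u) (dens p u) = (dot u u)%:E.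
Proof. by have [] := (nehariP N_gt0 alpha p1 u).1 nu. Qed.

(** Raising the positive part, while keeping the modulus of the negative part
    as a lower bound, does not decrease the energy: as the Dirichlet form is a
    lattice valuation, minimality turns the positive part alone into a
    supersolution of [- Delta z + z >= 0], across the nodal set. *)
Lemma pos_part_supersolution phi : H1 phi -> (forall x, 0 <= phi x) ->
  (E (dens p u) (dens p phi) < +oo)%E -> (E (dens p phi) (dens p phi) < +oo)%E ->
  0 <= dot (pos_part u) phi.
Proof.
move=> hphi phi0 fin1 fin2; pose z x : R := (- 1) * neg_part u x.
have hz : H1 z := H1Z _ hn.
have Efin_u : (E (dens p u) (dens p u) < +oo)%E by rewrite Eu ltry.
have np := H1_nn p hphi; have nnu := H1_nn p hu.
have key (eps : R) : 0 < eps -> eps <= 1 ->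
    0 <= 2 * dot (pos_part u) phi + eps * dot phi phi.
  move=> e0 e1; pose b x := pos_part u x + eps * phi x.
  have hep := H1Z eps hphi; have hb : H1 b := H1D hp hep.
  pose w x : R := Num.max (z x) (b x).
  have hw : H1 w := H1_max N_gt0 hz hb.
  have abs_u x : `|u x| = Num.max (z x) (pos_part u x).
    rewrite /z mulN1r /pos_part /neg_part; have [h|h] := leP (u x) 0.
      by rewrite ler0_norm// max_l// oppr_ge0.
    by rewrite gtr0_norm// oppr0 max_r// ltW.
  have ephi x : 0 <= eps * phi x by rewrite mulr_ge0// ltW.
  have uw x : `|u x| <= w x.
    by rewrite abs_u /w /b ge_max !le_max lexx/= lerDl ephi orbT.
  have wu x : w x <= `|u x| + phi x.
    have ep : eps * phi x <= phi x by rewrite ler_piMl.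
    rewrite /w /b ge_max; apply/andP; split.
      by rewrite abs_u -[leLHS]addr0; apply: lerD; rewrite ?le_max ?lexx.
    by apply: lerD => //; rewrite abs_u le_max lexx orbT.
  have w0 x : 0 <= w x by exact: le_trans (uw x).
  have nw := H1_nn p hw.
  have Ele : (E (dens p u) (dens p u) <= E (dens p w) (dens p w))%E.
    by apply: (energy_le alpha nnu nw nnu nw) => x; apply: dens_le => //;
      rewrite (ger0_norm (w0 x)).
  have c0 : 0 <= 2 `^ p :> R by exact: powR_ge0.
  pose F x := dens p u x + dens p phi x.
  have nF : nn F := nnD nnu np.
  have Efin : (E (dens p w) (dens p w) < +oo)%E.
    have wF x : dens p w x <= 2 `^ p * F x.
      rewrite /F; apply: le_trans (powRD_le (normr_ge0 (u x)) (normr_ge0 (phi x))).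
      apply: ge0_ler_powR; rewrite ?nnegrE ?addr_ge0 ?(ltW p0)//.
      by rewrite ger0_norm// (ger0_norm (phi0 x)).
    have ncF := nnZ c0 nF.
    apply: le_lt_trans (energy_le alpha nw ncF nw ncF wF wF) _.
    rewrite (energyZl alpha c0 nF ncF) (energyZr alpha c0 nF nF) muleA -EFinM.
    apply: lte_mul_pinfty; [by rewrite lee_fin mulr_ge0|by []|].
    rewrite /F (energyDl alpha nnu np nF) (energyDr alpha nnu nnu np).
    rewrite (energyDr alpha np nnu np) (energyC alpha np nnu).
    exact: (lte_add_pinfty (lte_add_pinfty Efin_u fin1) (lte_add_pinfty fin1 fin2)).
  have Sle := minimal_norm N_gt0 p1 nu min_u hw Ele Efin.
  have [hmin V] := dot_max_min N_gt0 hz hb.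
  have mge := dot_ge0 N_gt0 hmin.
  have Sz : dot z z = dot (neg_part u) (neg_part u).
    by rewrite /z dotZl// dotZr// mulrA mulrNN !mul1r.
  have Sb : dot b b = dot (pos_part u) (pos_part u) +
      eps * (2 * dot (pos_part u) phi + eps * dot phi phi).
    by rewrite /b dot_sqrD// dotZr// dotZl// dotZr//; ring.
  have : 0 <= eps * (2 * dot (pos_part u) phi + eps * dot phi phi).
    by move: V Sle; rewrite -/w Sz Sb (dot_split N_gt0 hu); lra.
  by rewrite pmulr_rge0.
have s0 := dot_ge0 N_gt0 hphi; set d := dot _ phi in key *; set s := dot phi phi in key s0.
rewrite leNgt; apply/negP => d0.
pose eps := Num.min 1 (- d / (s + 1)).
have s1 : 0 < s + 1 by lra.
have e0 : 0 < eps by rewrite lt_min ltr01/= divr_gt0// oppr_gt0.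
have e1 : eps <= 1 by rewrite ge_min lexx.
have e2 : eps * s <= - d.
  have : eps * (s + 1) <= - d by rewrite -ler_pdivlMr// ge_min lexx orbT.
  lra.
by have := key eps e0 e1; lra.
Qed.

(** Translates of bounded, compactly supported minorants of the modulus of [u]
    are admissible perturbations: they have at most the energy of [u], and their
    interaction with [u] is at most that of a ball. *)
Lemma translate_supersolution f (K : R) h : H1 f -> (forall x, 0 <= f x <= 1) ->
  (forall x, f x <= `|u x|) -> (forall x, K < `|x| -> f x = 0) ->
  0 <= dot (pos_part u) (tr h f).
Proof.
move=> hf f01 fu fK; have ht := H1_tr h hf.
have f0 x : 0 <= f x by case/andP: (f01 x).
have nf := H1_nn p hf; have nnu := H1_nn p hu.
apply: pos_part_supersolution => //; first by move=> x; exact: f0.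
  pose M := K + `|h|.
  have nb : nn (ballI M : 'rV[R]_N -> R).
    by split; [exact: measurable_ballI|move=> x; exact: ballI_ge0].
  apply: (@le_lt_trans _ _ (E (dens p u) (ballI M))).
    apply: (energy_le alpha nnu nnu (H1_nn p ht) nb) => // x.
    have [xM|xM] := leP `|x| M.
      rewrite (ballI_in xM) -[leRHS](one_powR p); apply: ge0_ler_powR; rewrite ?nnegrE ?(ltW p0)//.
      by rewrite ger0_norm; case/andP: (f01 (x + h)).
    rewrite (ballI_out xM) /dens /tr fK ?normr0 ?powR0 ?lt0r_neq0//.
    have : `|x| <= `|x + h| + `|h| by rewrite -{1}(addrK h x) ler_normB.
    by rewrite /M in xM; lra.
  apply: (energy_ball_finite N_gt0 alpha_gt0 alpha_ltN) => //.
  - by apply: (dens_ae0 p1); case: nu.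
  - by rewrite Eu ltry.
  - by move=> M'; apply: rint_ltoo; exact: (rint_dens_ball p1 p2 M' (H1_L2 hu)).
rewrite (energy_tr alpha h nf nf); apply: (@le_lt_trans _ _ (E (dens p u) (dens p u))).
  by apply: (energy_le alpha nf nnu nf nnu) => x; apply: dens_le => //; rewrite ger0_norm.
by rewrite Eu ltry.
Qed.

(** The positive part of [u] is a supersolution, hence so is its correlation with
    a piece [f n] of the negative part. That correlation vanishes at the origin,
    the supports being disjoint; by the strong maximum principle it vanishes
    everywhere, and then one of the two parts is trivial. *)
Lemma no_nodal_minimiser : False.
Proof.
have [_ up un _ _] := nod_u.
pose z x : R := (- 1) * neg_part u x; have hz : H1 z := H1Z _ hn.
have z0 x : 0 <= z x by rewrite /z mulN1r oppr_ge0 /neg_part ge_min lexx orbT.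
have [eta [C [te e01 _ _ ecv]]] := @cut_off_exists R N.
pose f n x : R := Num.min (z x) (eta n x).
have [n fn] : exists n, ~ ae_zero (f n).
  apply: contrapT => /forallNP H; apply: un.
  have : {ae mu, forall x, forall n, f n x = 0}.
    by apply: ae_foralln => n; exact: contrapT (H n).
  apply: filterS => x Hx; apply/eqP; rewrite -oppr_eq0 -mulN1r -/(z x) eq_le z0 andbT leNgt.
  apply/negP => zx.
  (* where [z] is positive, all the cut-off functions would vanish *)
  have : 1 <= (0 : R); last by rewrite ler10.
  apply: (cvgr_to_le (ecv x)); near=> k.
  have := Hx k; rewrite /f; have [h|/ltW h] := leP (z x) (eta k x).
    by move=> zx0; move: zx; rewrite zx0 ltxx.
  by move=> ->.
have [M [K [_ _ _ eK]]] := test_bounded (te n).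
have hf : H1 (f n) by have [] := dot_max_min N_gt0 hz (H1_test (te n)).
have f01 x : 0 <= f n x <= 1.
  by have /andP[h0 h1] := e01 n x; rewrite /f le_min z0 h0/= ge_min h1 orbT.
have f0 x : 0 <= f n x by case/andP: (f01 x).
have zu x : z x <= `|u x|.
  rewrite /z mulN1r /neg_part; have [h|h] := leP (u x) 0; first by rewrite ler0_norm.
  by rewrite oppr0.
have fu x : f n x <= `|u x| by apply: le_trans (zu x); rewrite ge_min lexx.
have fK x : K < `|x| -> f n x = 0 by move=> /eK ex; rewrite /f ex min_r.
have pp x : 0 <= pos_part u x by rewrite /pos_part le_max lexx orbT.
have sp := H1_sob hp; have sf := H1_sob hf.
have lp := H1_L2 hp; have lf := H1_L2 hf.
pose g := corr (pos_part u) (f n).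
have g0 h : 0 <= g h by apply: Rintegral_ge0 => x _; rewrite mulr_ge0// /tr.
have [C' C'0 HC'] := corr_lipschitz N_gt0 lp sf.
have cg : continuous g := coord_lipschitz_continuous C'0 HC'.
pose s (k : nat) : R := k.+1%:R^-1.
have s0 k : s k != 0 by rewrite invr_eq0 pnatr_eq0.
have gz : g 0 = 0.
  rewrite /g /corr /ip (@eq_Rintegral _ _ _ mu setT (cst 0)).
    by rewrite (Rintegral_cst _ measurableT) mul0r.
  move=> x _; rewrite /tr addr0 /f /z mulN1r /=.
  have /eqP := pos_negM u x; rewrite mulf_eq0 => /orP[/eqP ->|/eqP ->]; first by rewrite mul0r.
  by rewrite oppr0 min_l ?mulr0//; case/andP: (e01 n x).
have scv : s k @[k --> \oo] --> (0 : R) by exact: cvg_harmonic.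
have gL y := corr_laplacian N_gt0 (h := y) sp sf s0 scv.
have Lg y : corr (pos_part u) (f n) y - dot (pos_part u) (tr y (f n)) <= g y.
  by rewrite gerBl; exact: (translate_supersolution y hf f01 fu fK).
have gall := strong_maximum_principle cg g0 s0 scv gL Lg gz.
have fi : rint mu (f n).
  apply: (@le_rint _ _ _ mu _ (ballI K)); [exact: H1_measurable hf| |exact: rint_ballI].
  move=> x; rewrite ger0_norm//; have [xK|xK] := leP `|x| K.
    by rewrite (ballI_in xK); case/andP: (f01 x).
  by rewrite (ballI_out xK) fK.
apply: up; apply: (corr_eq0 lp fi pp f0 _ gall fn) => h.
exact: L2M lp (L2_tr h lf).
Unshelve. all: by end_near.
Qed.

End minimiser.
End non_achievement.

Theorem theorem3 (R : realType) (N : nat) (alpha p : R)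
    (N_ge1 : (1 <= N)%N) (alpha_gt0 : 0 < alpha) (alpha_ltN : alpha < N%:R)
    (p_gt0 : 0 < p)
    (p_lower : Num.max ((N%:R - 2) / (N%:R + alpha)) (1 / 2) < 1 / p)
    (p_upper : 1 / p < N%:R / (N%:R + alpha)) :
  c_nod N alpha p = c_0 N alpha p /\
  ~ (exists u : 'rV[R]_N -> R,
       nehari_nod alpha p u /\ (action alpha p u)%:E = c_nod N alpha p).
Proof.
have p1 : 1 < p.
  rewrite -invf_lt1// -div1r; apply: lt_trans p_upper _.
  by rewrite ltr_pdivrMr ?mul1r ?ltrDl// addr_gt0// (lt_trans alpha_gt0).
have p2 : p < 2.
  by move: p_lower; rewrite gt_max => /andP[_]; rewrite !div1r ltf_pV2// posrE.
have eq_c := c_nod_eq_c_0 N_ge1 alpha_ltN p1 p2.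
split=> // -[u [nod_u]]; rewrite eq_c => min_u.
exact: (no_nodal_minimiser N_ge1 alpha_gt0 alpha_ltN p1 p2 nod_u min_u).
Qed.
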